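(* Let $\Lambda\subseteq\mathbb Z$. (1) Let $p\in[1,\infty)$ with $p\ne2$. If $(z^k)_{k\in\Lambda}$ is a completely unconditional basis of $\mathrm L^p_\Lambda$, then $\Lambda$ does not contain sumsets $R+C$ of arbitrarily large sets; that is, there is an integer $N$ such that $R+C\not\subseteq\Lambda$ for all $R,C\subseteq\mathbb Z$ with $\#R\ge N$ and $\#C\ge N$. (2) If either the space $\mathrm L^1_\Lambda$ admits some completely unconditional approximating sequence, or the space $\mathrm C_\Lambda$ of continuous functions with spectrum in $\Lambda$ admits some unconditional approximating sequence, then $\Lambda$ does not contain the sumset $R+C$ of two infinite sets $R,C\subseteq\mathbb Z$.
   Context: $\mathbb T$ is the unit circle with normalised Haar measure; $\mathrm L^p=\mathrm L^p(\mathbb T)$; $\mathrm L^p_\Lambda$ (resp. $\mathrm C_\Lambda$) is the closed span of $\{z^k:k\in\Lambda\}$ in $\mathrm L^p$ (resp. in the space of continuous functions on $\mathbb T$). $R+C=\{r+c:r\in R,\,c\in C\}$. $\mathrm S^p$ is the Schatten class of $\ell^2$, and $\mathrm L^p_\Lambda(\mathrm S^p)$ is the closed span of $\{x\otimes z^k:x\in\mathrm S^p,k\in\Lambda\}$ in $\mathrm L^p(\mathbb T;\mathrm S^p)$. $(z^k)_{k\in\Lambda}$ is a completely unconditional basis of $\mathrm L^p_\Lambda$ if there is a constant $D$ such that $\|\sum_{k\in\Lambda'}x_k\otimes\varepsilon_kz^k\|\le D\|x\|$ for every $x\in\mathrm L^p_\Lambda(\mathrm S^p)$ with Fourier coefficients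 $x_k\in\mathrm S^p$, every finite $\Lambda'\subseteq\Lambda$ and all $\varepsilon_k\in\mathbb T$. Let $X$ be $\mathrm L^1_\Lambda$ or $\mathrm C_\Lambda$. An approximating sequence for $X$ is a sequence $(T_k)_{k\ge1}$ of bounded finite rank operators on $X$ with $T_kx\to x$ for every $x\in X$. Put $\Delta T_1=T_1$ and $\Delta T_k=T_k-T_{k-1}$ for $k\ge2$. The sequence is unconditional if the operators $\sum_{k=1}^n\varepsilon_k\Delta T_k$ with $n\ge1$ and $\varepsilon_k\in\{-1,1\}$ are uniformly bounded on $X$, and completely unconditional if they are uniformly completely bounded; an operator $T$ on $\mathrm L^1_\Lambda$ is completely bounded if $\mathrm{Id}_{\mathrm S^1}\otimes T$ extends to a bounded operator on $\mathrm L^1_\Lambda(\mathrm S^1)$, its complete norm being the norm of this operator. *)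

(* Defs.v *)
From mathcomp Require Import all_boot all_order all_algebra finmap.
From mathcomp Require Import all_classical all_reals all_analysis.
From mathcomp.real_closed Require Import complex.

Set Implicit Arguments.
Unset Strict Implicit.
Unset Printing Implicit Defensive.

Import Order.TTheory GRing.Theory Num.Theory.
Import numFieldNormedType.Exports.

Local Open Scope classical_set_scope.
Local Open Scope complex_scope.
Local Open Scope ring_scope.

(* Functions on the unit circle T are represented by functions R[i] -> V of    *)
(* which only the values on [circle] matter; integrals over T with respect to  *)
(* normalised Haar measure are integrals over t in [0, 1] along [circ].        *)
Section Circle.
Context {R : realType}.

Definition circle : set R[i] := [set z | `|z| = 1].

Definition circ (t : R) : R[i] := cos (2 * pi * t) +i* sin (2 * pi * t).

Definition cnorm (z : R[i]) : \bar R := (Normc.normc z)%:E.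

Definition cintegral (h : R[i] -> R[i]) : R[i] :=
  (\int[lebesgue_measure]_(t in `[0, 1]) complex.Re (h (circ t))) +i*
  (\int[lebesgue_measure]_(t in `[0, 1]) complex.Im (h (circ t))).

End Circle.

(* The Bochner space L^p(T; E), where E is the complex vector space of the     *)
(* v : V with nu v < +oo, normed by nu. Functions are not quotiented by        *)
(* almost everywhere equality, that is, by Lpnorm nu p (f - g) = 0.            *)
Section Bochner.
Context {R : realType} {V : lmodType R[i]}.
Implicit Types (nu : V -> \bar R) (p : R) (f : R[i] -> V) (L : set int).

Definition simple_fun nu f :=
  [/\ finite_set (f @` circle),
      forall z, circle z -> (nu (f z) < +oo)%E &
      forall v, measurable [set t : R | f (circ t) = v]].

Definition strongly_measurable nu f :=
  (forall z, circle z -> (nu (f z) < +oo)%E) /\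
  exists2 g : nat -> R[i] -> V, forall n, simple_fun nu (g n) &
    forall z, circle z -> nu (g n z - f z) @[n --> \oo] --> 0%E.

Definition Lpnorm nu p f : \bar R :=
  ((\int[lebesgue_measure]_(t in `[0%R, 1%R]) (nu (f (circ t)) `^ p))
    `^ p^-1)%E.

Definition Lp nu p : set (R[i] -> V) :=
  [set f | strongly_measurable nu f /\ (Lpnorm nu p f < +oo)%E].

Definition tensor (x : V) (f : R[i] -> R[i]) : R[i] -> V := fun z => f z *: x.

Definition trigpoly nu L : set (R[i] -> V) :=
  [set P | exists (F : {fset int}) (x : int -> V),
    [/\ [set` F] `<=` L, forall k, (nu (x k) < +oo)%E &
        P = \sum_(k <- F) tensor (x k) (fun z => z ^ k)]].

(* L^p_Lambda(E) *)
Definition LpL nu p L : set (R[i] -> V) :=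
  [set f | Lp nu p f /\ forall e : R, 0 < e ->
    exists2 P, trigpoly nu L P & (Lpnorm nu p (f - P)%R < e%:E)%E].

End Bochner.

Section Continuous.
Context {R : realType}.

Definition supnorm (f : R[i] -> R[i]) : \bar R :=
  ereal_sup [set cnorm (f z) | z in circle].

(* C_Lambda *)
Definition CL (L : set int) : set (R[i] -> R[i]) :=
  [set f | {within (circle : set R[i]^o), continuous (f : R[i]^o -> R[i]^o)} /\ forall e : R, 0 < e ->
    exists2 P, trigpoly cnorm L P & (supnorm (f - P)%R < e%:E)%E].

End Continuous.

(* Bounded operators on l^2 are identified with their matrices                 *)
(* x i j = <x e_j, e_i> in the canonical basis.                                *)
Section Schatten.
Context {R : realType}.
Implicit Types (x : nat -> nat -> R[i]) (p : R).

Definition orthonormal_seq (u : nat -> nat -> R[i]) :=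
  forall m n, series (fun i => u m i * (u n i)^*%C) @ \oo --> ((m == n)%:R : R[i]^o).

(* x = \sum_n s_n <., v_n> u_n: the s_n are the singular values of x, possibly *)
(* with additional zeros.                                                      *)
Definition singular_values x (s : nat -> R) :=
  (forall n, 0 <= s n) /\
  exists u v, [/\ orthonormal_seq u, orthonormal_seq v &
    forall i j, series (fun n => (s n)%:C * u n i * (v n j)^*%C) @ \oo
      --> (x i j : R[i]^o)].

(* The nonzero terms of s are determined by x up to order as soon as the sum   *)
(* is finite, so this infimum is the S^p-norm of x, and +oo if x is not in     *)
(* S^p.                                                                        *)
Definition schatten p x : \bar R :=
  ereal_inf [set ((\sum_(0 <= n <oo) (s n `^ p)%:E) `^ p^-1)%E
            | s in singular_values x].

Definition fourier (f : R[i] -> nat -> nat -> R[i]) (k : int) :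
    nat -> nat -> R[i] :=
  fun i j => cintegral (fun z => z ^ (- k) * f z i j).

Definition completely_unconditional_basis p (L : set int) :=
  exists D : R, forall f, LpL (schatten p) p L f ->
    forall (F : {fset int}) (eps : int -> R[i]), [set` F] `<=` L ->
      (forall k, circle (eps k)) ->
    (Lpnorm (schatten p) p
       (\sum_(k <- F) tensor (fourier f k) (fun z => (eps k * z ^ k)%R))%R
     <= D%:E * Lpnorm (schatten p) p f)%E.

End Schatten.

(* Operators on a Banach space given as a linear space X with a seminorm N, in *)
(* which f and g stand for the same vector if N (f - g) = 0.                   *)
Section Operators.
Context {R : realType} {W : lmodType R[i]}.
Implicit Types (X : set W) (N : W -> \bar R) (T : W -> W).

Definition operator X N T :=
  (forall f, X f -> X (T f)) /\
  (forall (a : R[i]) f g, X f -> X g ->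
    N (T (a *: f + g) - (a *: T f + T g)) = 0%E).

Definition bounded_by X N T (K : R) :=
  forall f, X f -> (N (T f) <= K%:E * N f)%E.

Definition finite_rank X N T :=
  exists (n : nat) (g : 'I_n -> W), (forall i, X (g i)) /\
    forall f, X f -> exists c : 'I_n -> R[i],
      N (T f - \sum_(i < n) c i *: g i) = 0%E.

(* Indexing starts at 0: T k stands for T_(k+1). *)
Definition approximating_sequence X N (T : nat -> W -> W) :=
  (forall k, [/\ operator X N (T k), exists K, bounded_by X N (T k) K &
                 finite_rank X N (T k)]) /\
  (forall f, X f -> N (T k f - f) @[k --> \oo] --> 0%E).

Definition Delta (T : nat -> W -> W) (k : nat) : W -> W :=
  if k is k'.+1 then fun f => T k f - T k' f else T 0%N.

Definition signed_sum (T : nat -> W -> W) (eps : nat -> bool) (n : nat) :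
    W -> W :=
  fun f => \sum_(k < n.+1) (-1) ^+ eps k *: Delta T k f.

Definition unconditional X N (T : nat -> W -> W) :=
  exists K : R, forall eps n, bounded_by X N (signed_sum T eps n) K.

End Operators.

Section CompletelyBounded.
Context {R : realType}.
Implicit Types (L : set int).

Let S1 := @schatten R 1.

(* Id_(S^1) (x) T extends to an operator on L^1_Lambda(S^1) of norm <= K *)
Definition completely_bounded_by L (T : (R[i] -> R[i]) -> R[i] -> R[i])
    (K : R) :=
  exists U : (R[i] -> nat -> nat -> R[i]) -> R[i] -> nat -> nat -> R[i],
  [/\ operator (LpL S1 1 L) (Lpnorm S1 1) U,
      forall x f, (S1 x < +oo)%E -> LpL cnorm 1 L f ->
        Lpnorm S1 1 (U (tensor x f) - tensor x (T f))%R = 0%E &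
      bounded_by (LpL S1 1 L) (Lpnorm S1 1) U K].

Definition completely_unconditional L
    (T : nat -> (R[i] -> R[i]) -> R[i] -> R[i]) :=
  exists K : R, forall eps n,
    completely_bounded_by L (signed_sum T eps n) K.

End CompletelyBounded.

Definition sumset (A B : set int) : set int :=
  [set r + c | r in A & c in B].

(* Main.v *)
Require Import Defs.
From mathcomp Require Import all_boot all_order all_algebra finmap.
From mathcomp Require Import all_classical all_reals all_analysis.
From mathcomp Require Import measurable_realfun.
From mathcomp.real_closed Require Import complex.
From mathcomp Require Import ring lra zify.

Set Implicit Arguments.
Unset Strict Implicit.
Unset Printing Implicit Defensive.

Import Order.TTheory GRing.Theory Num.Theory.
Import numFieldNormedType.Exports.

Local Open Scope classical_set_scope.
Local Open Scope complex_scope.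
Local Open Scope ring_scope.

(** Both parts transfer Fourier multipliers to Schur multipliers. If every
    [r_i + c_j] lies in [Lambda] and [a] is an n x n matrix, then the function
    [f(z) = (a_ij z^(r_i + c_j))] is [D(z) a D'(z)] with [D(z)] and [D'(z)]
    diagonal and unitary. So [f(z)] has the Schatten norm of [a] at every point
    of the circle, while a multiplier on [Lambda] acts on [f] by multiplying
    the entries of [a].

    Part (1). Large finite sets contain subsets of n elements whose n^2 sums are
    distinct ([distinct_sums]), so that all sign changes of the entries are
    available. The matrix of ones has rank one and S^p-norm n; a Walsh matrix
    differs from it by signs only, but it is the square root of n times a
    unitary matrix and has S^p-norm n^(1/2 + 1/p). Hence D is at least
    n^|1/p - 1/2| ([unconditional_transfer]).

    Part (2). Let [phi_k m] be the m-th Fourier coefficient of [T_k (z^m)]: it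
    is the multiplier that one gets by averaging [T_k] over rotations. It tends
    to 1 as k grows, and to 0 as |m| grows because [T_k] has finite rank
    ([finite_rank_coef]). A gliding hump then selects [r_0, c_0, r_1, c_1, ...]
    in turn, and signs, such that the multiplier of a signed sum is close to 1
    at [r_i + c_j] if [i <= j] and close to -1 otherwise ([triangular_signs]).
    This amounts to the boundedness of the projection of matrices onto their
    upper triangle. To contradict it, let [h] be the dyadic skew matrix of size
    n = 2^(q^2): its blocks on scale m have entries 1/m above and -1/m below
    the diagonal. By orthogonality between scales, the bilinear form of [h] is
    at most [q (|x|^2 + |y|^2)] ([skew_form_le]), although the moduli of its
    entries add up to [q^2 n]. In C_Lambda one applies the signed sum to
    [sum_ij h_ij z^(r_i + c_j)] and evaluates, after a rotation, at one point
    ([unconditional_C_bound]); in L^1_Lambda(S^1) one applies it to the matrix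
    of ones, of norm n, and pairs with [h] ([unconditional_S1_bound]). Either
    way [q^2 n / 2 <= 2 K q n], which fails for large q.

    The S^p-norm is an infimum over singular value decompositions. Upper bounds
    come from explicit decompositions ([schatten_le]) or from the spectral
    theorem ([finite_svd]); lower bounds hold for all decompositions at once,
    by pairing the matrix with a contraction ([entry_pairing_le],
    [schatten_ge]). *)

Local Notation nc := Normc.normc.
Local Notation mu := lebesgue_measure.
Local Notation I01 := `[0%R, 1%R]%classic.

(** * Moduli of complex numbers and the unit circle *)

Section Modulus.
Context {R : realType}.
Implicit Types (z w : R[i]).

Lemma ncE z : nc z = Num.sqrt (complex.Re z ^+ 2 + complex.Im z ^+ 2).
Proof. by case: z. Qed.

Lemma norm_nc z : `|z| = (nc z)%:C.
Proof. by rewrite normc_def ncE. Qed.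

Lemma nc_ge0 z : 0 <= nc z.
Proof. by rewrite ncE sqrtr_ge0. Qed.

Lemma nc_sq z : nc z ^+ 2 = complex.Re z ^+ 2 + complex.Im z ^+ 2.
Proof. by rewrite ncE sqr_sqrtr // addr_ge0 // sqr_ge0. Qed.

Lemma nc0 : nc (0 : R[i]) = 0. Proof. exact: Normc.normc0. Qed.

Lemma nc1 : nc (1 : R[i]) = 1. Proof. exact: Normc.normc1. Qed.

Lemma nc_eq0 z : nc z = 0 -> z = 0.
Proof. exact: Normc.eq0_normc. Qed.

Lemma ncM z w : nc (z * w) = nc z * nc w.
Proof. exact: Normc.normcM. Qed.

Lemma ncD z w : nc (z + w) <= nc z + nc w.
Proof. exact: le_normcD. Qed.

Lemma ncN z : nc (- z) = nc z.
Proof. exact: normcN. Qed.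

Lemma ncB z w : nc (z - w) = nc (w - z).
Proof. by rewrite -ncN opprB. Qed.

Lemma nc_sum (I : Type) (s : seq I) (P : pred I) (F : I -> R[i]) :
  nc (\sum_(i <- s | P i) F i) <= \sum_(i <- s | P i) nc (F i).
Proof.
elim/big_ind2 : _ => [|x a y b xa yb|//]; first by rewrite nc0.
exact: le_trans (ncD _ _) (lerD xa yb).
Qed.

Lemma nc_conj z : nc z^*%C = nc z.
Proof. by case: z => a b /=; rewrite sqrrN. Qed.

Lemma nc_real (x : R) : nc x%:C = `|x|.
Proof. by rewrite ncE /= expr0n addr0 sqrtr_sqr. Qed.

Lemma nc_Re z : `|complex.Re z| <= nc z.
Proof.
by rewrite -sqrtr_sqr ncE ler_wsqrtr // lerDl sqr_ge0.
Qed.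

Lemma nc_Im z : `|complex.Im z| <= nc z.
Proof.
by rewrite -sqrtr_sqr ncE ler_wsqrtr // lerDr sqr_ge0.
Qed.

Lemma nc_leReIm z : nc z <= `|complex.Re z| + `|complex.Im z|.
Proof.
rewrite {1}[z]complexE; apply: le_trans (ncD _ _) _; rewrite ncM !nc_real /=.
by rewrite expr0n /= expr1n add0r sqrtr1 mul1r.
Qed.

Lemma conjM z w : (z * w)^*%C = z^*%C * w^*%C.
Proof. by rewrite rmorphM. Qed.

Lemma mul_conj z : z * z^*%C = (nc z ^+ 2)%:C.
Proof.
rewrite nc_sq; case: z => a b /=; apply/eqP; rewrite eq_complex /=.
by apply/andP; split; apply/eqP; ring.
Qed.

Lemma Re_add z w : complex.Re (z + w) = complex.Re z + complex.Re w.
Proof. by case: z; case: w. Qed.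

Lemma Im_add z w : complex.Im (z + w) = complex.Im z + complex.Im w.
Proof. by case: z; case: w. Qed.

Lemma Re_sum (I : Type) (s : seq I) (P : pred I) (F : I -> R[i]) :
  complex.Re (\sum_(i <- s | P i) F i) = \sum_(i <- s | P i) complex.Re (F i).
Proof. exact: (big_morph _ Re_add (erefl : complex.Re (0:R[i]) = 0)). Qed.

Lemma Re_mul z w : complex.Re (z * w) =
  complex.Re z * complex.Re w - complex.Im z * complex.Im w.
Proof. by case: z; case: w. Qed.

Lemma Im_mul z w : complex.Im (z * w) =
  complex.Re z * complex.Im w + complex.Im z * complex.Re w.
Proof. by case: z; case: w. Qed.

Lemma circleP z : circle z <-> nc z = 1.
Proof.
rewrite /circle /= norm_nc; split => [[//]|->//].
Qed.

Lemma circle_neq0 z : circle z -> z != 0.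
Proof.
by move=> /circleP zz; apply/eqP => z0; move: zz; rewrite z0 nc0 => /eqP; rewrite eq_sym oner_eq0.
Qed.

Lemma nc_circle z : circle z -> nc z = 1. Proof. by move=> /circleP. Qed.

Lemma circleM z w : circle z -> circle w -> circle (z * w).
Proof. by move=> /circleP zz /circleP ww; apply/circleP; rewrite ncM zz ww mulr1. Qed.

Lemma ncV z : nc z^-1 = (nc z)^-1.
Proof. exact: Normc.normcV. Qed.

Lemma circle1 : circle (1 : R[i]).
Proof. by apply/circleP; rewrite nc1. Qed.

Lemma ncXn z n : nc (z ^+ n) = nc z ^+ n.
Proof. by elim: n => [|n ih]; rewrite ?expr0 ?nc1 // !exprS ncM ih. Qed.

Lemma circleX z (k : int) : circle z -> circle (z ^ k).
Proof.
move=> /circleP zz; apply/circleP; case: k => n; first by rewrite /= ncXn zz expr1n.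
by rewrite /exprz ncV ncXn zz expr1n invr1.
Qed.

Lemma circ_circle (t : R) : circle (circ t).
Proof. by apply/circleP; rewrite /= cos2Dsin2 sqrtr1. Qed.

Lemma circD (s t : R) : circ (s + t) = circ s * circ t.
Proof.
rewrite /circ mulrDr cosD sinD; apply/eqP; rewrite eq_complex /=.
by rewrite eqxx /= addrC [sin _ * cos _]mulrC eqxx.
Qed.

Lemma circ0 : circ (0 : R) = 1.
Proof. by rewrite /circ mulr0 cos0 sin0. Qed.

Lemma circMn (t : R) n : circ (t *+ n) = circ t ^+ n.
Proof. by elim: n => [|n ih]; rewrite ?mulr0n ?circ0 // mulrS circD ih exprS. Qed.

Lemma circN (t : R) : circ (- t) = (circ t)^-1.
Proof.
apply: (mulfI (circle_neq0 (circ_circle t))).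
by rewrite -circD subrr circ0 divff // circle_neq0 //; exact: circ_circle.
Qed.

Lemma circX (t : R) (k : int) : circ t ^ k = circ (t *~ k).
Proof.
case: k => n; first by rewrite -pmulrn circMn.
by rewrite NegzE mulrNz -pmulrn circN circMn.
Qed.

(** Turns convergence for the topology of the complex field, whose epsilons are
    complex numbers, into an estimate with real ones. *)
Lemma cvgC_ltP (u : nat -> R[i]) (l : R[i]) :
  (u @ \oo --> (l : R[i]^o)) <->
  (forall e : R, 0 < e -> exists n0, forall n, (n0 <= n)%N -> nc (u n - l) < e).
Proof.
split.
  move=> /(@cvgrPdist_lt _ R[i]^o) ul e e0.
  have eC : 0 < e%:C :> R[i] by rewrite ltcR.
  have [n0 _ hn0] := ul _ eC; exists n0 => n nn0.
  by have := hn0 n nn0; rewrite /= norm_nc ncB ltcR.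
move=> ul; apply/(@cvgrPdist_lt _ R[i]^o) => e e0.
have Re0 : 0 < complex.Re e by move: e0; rewrite ltcE /= => /andP[].
have eE : e = (complex.Re e)%:C.
  by move: e0; rewrite ltcE /= => /andP[/eqP + _]; case: (e) => a b /= ->.
have [n0 hn0] := ul _ Re0; exists n0 => // n /= nn0.
by rewrite norm_nc eE ltcR /= ncB hn0.
Qed.

Lemma cvgC_sum N (u : nat -> nat -> R[i]) (l : nat -> R[i]) :
  (forall i, (u i @ \oo --> (l i : R[i]^o))) ->
  (fun n => \sum_(i < N) u i n) @ \oo --> ((\sum_(i < N) l i) : R[i]^o).
Proof.
move=> ul; apply: (@cvg_big R[i]^o _ +%R 0 xpredT add_continuous) => i _.
exact: ul.
Qed.

Lemma cvgC_Ml (a : R[i]) (u : nat -> R[i]) (l : R[i]) :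
  (u @ \oo --> (l : R[i]^o)) -> (fun n => a * u n) @ \oo --> (a * l : R[i]^o).
Proof. by move=> ul; apply: (@cvgMl_tmp R[i]). Qed.

End Modulus.

(** * Lower bounds for Schatten norms *)

Section SchattenLower.
Context {R : realType}.
Implicit Types (u v x y : nat -> nat -> R[i]) (N M n : nat).

Lemma orthonormal_seq_sumP u m n : orthonormal_seq u ->
  forall e : R, 0 < e -> exists n0, forall K, (n0 <= K)%N ->
    nc (\sum_(i < K) u m i * (u n i)^*%C - (m == n)%:R) < e.
Proof.
move=> ou e e0; have /cvgC_ltP/(_ e e0)[n0 h] := ou m n.
by exists n0 => K /h; rewrite /series /= big_mkord.
Qed.

(** The squared distance from [a], cut off at [N], to the combination of the
    [u n] with coefficients [c n] is nonnegative on each initial segment of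
    indices, and in the limit it is |a|^2 - sum |c n|^2. *)
Lemma bessel u (a : nat -> R[i]) N M : orthonormal_seq u ->
  \sum_(n < M) nc (\sum_(i < N) a i * (u n i)^*%C) ^+ 2
    <= \sum_(i < N) nc (a i) ^+ 2.
Proof.
move=> ou; set c := fun n : nat => \sum_(i < N) a i * (u n i)^*%C.
pose a' i := if (i < N)%N then a i else 0.
pose w i := \sum_(n < M) c n * u n i.
pose S := \sum_(n < M) nc (c n) ^+ 2.
pose G K (n m : nat) := \sum_(i < K) u n i * (u m i)^*%C.
have a'E K (F : nat -> R[i]) : (N <= K)%N ->
    \sum_(i < K) a' i * F i = \sum_(i < N) a i * F i.
  move=> NK; rewrite (big_ord_widen _ (fun i => a i * F i) NK) [RHS]big_mkcond /=.
  by apply: eq_bigr => i _; rewrite /a'; case: ifP => // _; rewrite mul0r.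
have a'w K : (N <= K)%N -> \sum_(i < K) a' i * (w i)^*%C = S%:C.
  move=> NK; rewrite (a'E _ (fun i => (w i)^*%C)) // /S rmorph_sum /=.
  under eq_bigr do rewrite /w rmorph_sum mulr_sumr.
  rewrite exchange_big; apply: eq_bigr => n _; rewrite -mul_conj /=.
  rewrite {1}/c mulr_suml; apply: eq_bigr => i _.
  by rewrite rmorphM /=; ring.
have ww K : \sum_(i < K) w i * (w i)^*%C =
    \sum_(n < M) \sum_(m < M) (c n * (c m)^*%C) * G K n m.
  under eq_bigr do rewrite /w rmorph_sum mulr_suml.
  rewrite exchange_big; apply: eq_bigr => n _ /=.
  under eq_bigr do rewrite mulr_sumr.
  rewrite exchange_big; apply: eq_bigr => m _ /=.
  rewrite /G mulr_sumr; apply: eq_bigr => i _.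
  by rewrite rmorphM /=; ring.
have wwlim : (fun K => \sum_(i < K) w i * (w i)^*%C) @ \oo --> (S%:C : R[i]^o).
  under eq_fun do rewrite ww.
  have -> : S%:C = \sum_(n < M) \sum_(m < M) (c n * (c m)^*%C) * (n == m :> nat)%:R.
    rewrite /S rmorph_sum; apply: eq_bigr => n _ /=.
    rewrite (bigD1 n) //= eqxx mulr1 mul_conj big1 ?addr0 // => m mn.
    by rewrite eq_sym (negbTE mn : (m == n :> nat) = false) mulr0.
  apply: (@cvgC_sum _ _ (fun n K => \sum_(m < M) (c n * (c m)^*%C) * G K n m)
      (fun n => \sum_(m < M) (c n * (c m)^*%C) * (n == m :> nat)%:R)) => n.
  apply: (@cvgC_sum _ _ (fun m K => (c n * (c m)^*%C) * G K n m)
      (fun m => (c n * (c m)^*%C) * (n == m :> nat)%:R)) => m.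
  apply: (cvgC_Ml (u := fun K => G K n m)).
  by have := ou n m; rewrite /series /=; under eq_fun do rewrite big_mkord.
rewrite -/S; apply/ler_addgt0Pr => e e0.
have /cvgC_ltP/(_ e e0)[n0 hn0] := wwlim.
pose K := maxn n0 N.
have NK : (N <= K)%N by rewrite leq_maxr.
have h := hn0 K (leq_maxl _ _).
have : 0 <= \sum_(i < K) nc (a' i - w i) ^+ 2 by apply: sumr_ge0 => i _; exact: sqr_ge0.
have -> : \sum_(i < K) nc (a' i - w i) ^+ 2 = complex.Re
   (\sum_(i < N) a i * (a i)^*%C - S%:C - S%:C + \sum_(i < K) w i * (w i)^*%C).
  transitivity (complex.Re (\sum_(i < K) (a' i - w i) * (a' i - w i)^*%C)).
    rewrite Re_sum.
    by apply: eq_bigr => i _; rewrite mul_conj.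
  congr complex.Re.
  set A := \sum_(i < N) _; set W := \sum_(i < K) w i * _.
  have -> : A - S%:C - S%:C + W = A - \sum_(i < K) a' i * (w i)^*%C
      - (\sum_(i < K) a' i * (w i)^*%C)^*%C + W by rewrite a'w // conjc_real.
  rewrite rmorph_sum /= /A /W.
  have -> : \sum_(i < N) a i * (a i)^*%C = \sum_(i < K) a' i * (a' i)^*%C.
    rewrite (a'E _ (fun i => (a' i)^*%C)) //.
    by apply: eq_bigr => i _; rewrite /a' ltn_ord.
  rewrite -!sumrB -big_split /=; apply: eq_bigr => i _.
  by rewrite rmorphB rmorphM /= conjcK; ring.
rewrite !Re_add /=.
have -> : complex.Re (\sum_(i < N) a i * (a i)^*%C) = \sum_(i < N) nc (a i) ^+ 2.
  rewrite Re_sum.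
  by apply: eq_bigr => i _; rewrite mul_conj.
have : `|complex.Re (\sum_(i < K) w i * (w i)^*%C - S%:C)| < e.
  exact: le_lt_trans (nc_Re _) h.
rewrite Re_add /= ltr_norml => /andP[_].
lra.
Qed.

Lemma bessel_proj u N n : orthonormal_seq u ->
  \sum_(i < N) nc (u n i) ^+ 2 <= 1.
Proof.
move=> ou; apply/ler_addgt0Pr => e e0.
have [n0 h] := orthonormal_seq_sumP n n ou e0.
have {h} := h (maxn n0 N) (leq_maxl _ _); rewrite eqxx.
set K := maxn _ _ => h.
have NK : (N <= K)%N by rewrite leq_maxr.
apply: (@le_trans _ _ (\sum_(i < K) nc (u n i) ^+ 2)).
  rewrite (big_ord_widen _ (fun i => nc (u n i) ^+ 2) NK) big_mkcond /=.
  by apply: ler_sum => i _; case: ifP => // _; exact: sqr_ge0.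
have := le_lt_trans (nc_Re _) h; rewrite Re_add /=.
have -> : complex.Re (\sum_(i < K) u n i * (u n i)^*%C) = \sum_(i < K) nc (u n i) ^+ 2.
  rewrite Re_sum.
  by apply: eq_bigr => i _; rewrite mul_conj.
by rewrite ltr_norml => /andP[_]; lra.
Qed.

(** Bessel's inequality for the first [N] vectors of the canonical basis. *)
Lemma bessel_rows u N M : orthonormal_seq u ->
  \sum_(n < M) \sum_(i < N) nc (u n i) ^+ 2 <= N%:R.
Proof.
move=> ou; rewrite exchange_big /=.
apply: (@le_trans _ _ (\sum_(i < N) (1 : R))); last by rewrite sumr_const card_ord.
apply: ler_sum => i _.
have := @bessel u (fun k => (k == i :> nat)%:R) N M ou.
have -> : \sum_(k < N) nc ((k == i :> nat)%:R : R[i]) ^+ 2 = 1.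
  rewrite (bigD1 i) //= eqxx nc1 expr1n big1 ?addr0 // => k ki.
  by rewrite (negbTE ki : (k == i :> nat) = false) nc0 expr0n.
apply: le_trans; apply: ler_sum => n _.
rewrite (bigD1 i) //= eqxx mul1r big1 ?addr0 ?nc_conj // => k ki.
by rewrite (negbTE ki : (k == i :> nat) = false) mul0r.
Qed.

(** The matrix [y] tested against the rank one operator [<., v> u]. *)
Definition pairing y N (u v : nat -> R[i]) : R[i] :=
  \sum_(i < N) \sum_(j < N) y i j * (u i * (v j)^*%C).

Definition entry_pairing y N x : R[i] :=
  \sum_(i < N) \sum_(j < N) y i j * x i j.

(** Only entrywise convergence of the decomposition of [x] is available, but a
    finite number of entries suffices for the pairing. *)
Lemma entry_pairing_le x s u v y N (S : R) :
  (forall n, 0 <= s n) ->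
  (forall i j, series (fun n => (s n)%:C * u n i * (v n j)^*%C) @ \oo
      --> (x i j : R[i]^o)) ->
  (forall M, \sum_(n < M) s n * nc (pairing y N (u n) (v n)) <= S) ->
  nc (entry_pairing y N x) <= S.
Proof.
move=> s0 xE hS; apply/ler_addgt0Pr => e e0.
have lim : (fun M => \sum_(n < M) (s n)%:C * pairing y N (u n) (v n)) @ \oo
    --> (entry_pairing y N x : R[i]^o).
  have -> : (fun M => \sum_(n < M) (s n)%:C * pairing y N (u n) (v n)) =
      (fun M => \sum_(i < N) \sum_(j < N)
          y i j * series (fun n => (s n)%:C * u n i * (v n j)^*%C) M).
    apply/funext => M; rewrite /pairing.
    under eq_bigr do rewrite mulr_sumr.
    rewrite exchange_big /=; apply: eq_bigr => i _.
    under eq_bigr do rewrite mulr_sumr.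
    rewrite exchange_big /=; apply: eq_bigr => j _.
    rewrite /series /= big_mkord mulr_sumr; apply: eq_bigr => n _; ring.
  set w := fun i j M => series (fun n => (s n)%:C * u n i * (v n j)^*%C) M.
  apply: (@cvgC_sum _ _ (fun i M => \sum_(j < N) y i j * w i j M)
      (fun i => \sum_(j < N) y i j * x i j)) => i.
  apply: (@cvgC_sum _ _ (fun j M => y i j * w i j M) (fun j => y i j * x i j)) => j.
  exact: cvgC_Ml (xE i j).
have /cvgC_ltP/(_ e e0)[n0 /(_ n0 (leqnn _)) h] := lim.
rewrite -(subrK (\sum_(n < n0) (s n)%:C * pairing y N (u n) (v n)) (entry_pairing _ _ _)).
apply: le_trans (ncD _ _) _; rewrite addrC; apply: lerD; last by rewrite ncB ltW.
apply: le_trans (nc_sum _ _ _) _; apply: le_trans (hS n0).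
by apply: ler_sum => n _; rewrite ncM nc_real ger0_norm.
Qed.

(** Duality with the contractions: [y] is one when all its pairings with rank
    one operators of norm 1 are bounded by 1. *)
Lemma schatten1_ge x y N :
  (forall u v, orthonormal_seq u -> orthonormal_seq v ->
     forall n, nc (pairing y N (u n) (v n)) <= 1) ->
  ((nc (entry_pairing y N x))%:E <= schatten 1 x)%E.
Proof.
move=> hy; apply/ereal_infP => _ [s [s0 [u [v [ou ov xE]]]] <-].
rewrite invr1 poweRe1; last by apply: nneseries_ge0 => n _ _; rewrite lee_fin powR_ge0.
set P := (\sum_(0 <= n <oo) _)%E.
have P0 : (0 <= P)%E by apply: nneseries_ge0 => n _ _; rewrite lee_fin powR_ge0.
case PE : P P0 => [r| |] //; last by move=> _; rewrite leey.
move=> _; rewrite lee_fin.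
apply: (entry_pairing_le s0 xE) => M.
have : ((\sum_(n < M) s n)%:E <= r%:E)%E.
  rewrite -PE -sumEFin.
  have := @nneseries_lim_ge R (fun n => (s n `^ 1)%:E) xpredT 0%N M
    (fun n _ _ => eqbRL (lee_fin _ _) (powR_ge0 _ _)).
  by rewrite big_mkord; under eq_bigr do rewrite powRr1 //.
rewrite lee_fin; apply: le_trans; apply: ler_sum => n _.
by rewrite ler_piMr // hy.
Qed.

(** Young's inequality for the product of [x] and 1. *)
Lemma young1 (p x : R) : 1 <= p -> 0 <= x -> x <= x `^ p / p + (1 - p^-1).
Proof.
move=> p1 x0; have p0 : 0 < p by lra.
have [->|pn1] := eqVneq p 1; first by rewrite powRr1 // invr1 mulr1 subrr addr0.
have lt1p : 1 < p by rewrite lt_neqAle eq_sym pn1.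
pose q := (1 - p^-1)^-1.
have q0 : 0 < 1 - p^-1 by rewrite subr_gt0 invf_lt1.
have := @conjugate_powR R x 1 p q x0 ler01 p0.
rewrite invr_gt0 invrK q0 => /(_ isT).
rewrite addrC subrK => /(_ erefl).
by rewrite mulr1 powR1 mul1r.
Qed.

(** Here [y] is a contraction whose nuclear norm is at most [tau]. With
    [t n = nc (pairing y (u n) (v n))], Jensen's inequality for the weights
    [t n / tau] bounds [sum s n * t n] by [tau^(1 - 1/p) (sum s n ^ p)^(1/p)];
    the proof uses Young's inequality for [s n / sigma] instead. *)
Lemma schatten_ge p x y N (sigma tau : R) : 1 <= p -> 0 < sigma -> 0 < tau ->
  (forall u v, orthonormal_seq u -> orthonormal_seq v ->
     (forall n, nc (pairing y N (u n) (v n)) <= 1) /\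
     (forall M, \sum_(n < M) nc (pairing y N (u n) (v n)) <= tau)) ->
  sigma * tau <= nc (entry_pairing y N x) ->
  ((sigma * tau `^ p^-1)%:E <= schatten p x)%E.
Proof.
move=> p1 sg0 tau0 hy hx; have p0 : 0 < p by lra.
apply/ereal_infP => _ [s [s0 [u [v [ou ov xE]]]] <-].
have {hy} [t1 tM] := hy u v ou ov.
set P := (\sum_(0 <= n <oo) _)%E.
have P0 : (0 <= P)%E by apply: nneseries_ge0 => n _ _; rewrite lee_fin powR_ge0.
case PE : P P0 => [r| |] //; last first.
  by move=> _; rewrite poweRyr ?leey // invr_eq0 gt_eqF.
rewrite lee_fin poweR_EFin lee_fin => r0.
suff : sigma `^ p * tau <= r.
  move=> h; have pn0 : p != 0 by rewrite gt_eqF.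
  have -> : sigma * tau `^ p^-1 = (sigma `^ p * tau) `^ p^-1.
    rewrite powRM ?powR_ge0 ?ltW // -powRrM mulfV // powRr1 // ltW //.
  by apply: ge0_ler_powR => //; rewrite ?nnegrE ?invr_ge0 ?mulr_ge0 ?powR_ge0 // ltW.
have sums M : \sum_(n < M) s n `^ p <= r.
  have : ((\sum_(n < M) s n `^ p)%:E <= r%:E)%E.
    rewrite -PE -sumEFin.
    have := @nneseries_lim_ge R (fun n => (s n `^ p)%:E) xpredT 0%N M
      (fun n _ _ => eqbRL (lee_fin _ _) (powR_ge0 _ _)).
    by rewrite big_mkord.
  by rewrite lee_fin.
have sp0 : 0 < sigma `^ p by rewrite powR_gt0.
have main : sigma * tau <= sigma * (r / sigma `^ p / p + (1 - p^-1) * tau).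
  apply: le_trans hx _.
  apply: (entry_pairing_le s0 xE) => M.
  apply: (@le_trans _ _ (\sum_(n < M) sigma * (s n `^ p / (sigma `^ p) / p
     + (1 - p^-1) * nc (pairing y N (u n) (v n))))).
    apply: ler_sum => n _; set t := nc _.
    have t0 : 0 <= t by apply: nc_ge0.
    have := @young1 p (s n / sigma) p1 (divr_ge0 (s0 n) (ltW sg0)).
    have sVp : sigma^-1 `^ p = (sigma `^ p)^-1.
      by rewrite -(powR_inv1 (ltW sg0)) -powRrM mulN1r powRN.
    rewrite powRM ?invr_ge0 ?(ltW sg0) // sVp => hyg.
    have -> : s n * t = sigma * (s n / sigma * t).
      by rewrite mulrA [sigma * _]mulrC divfK ?gt_eqF.
    rewrite ler_pM2l //; set a := s n / sigma in hyg *; set b := s n `^ p / sigma `^ p in hyg *.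
    have b0 : 0 <= b / p by rewrite !divr_ge0 ?powR_ge0 // ltW.
    have := ler_wpM2r t0 hyg.
    have : b / p * t <= b / p by rewrite ler_piMr // t1.
    rewrite mulrDl; lra.
  rewrite -mulr_sumr ler_pM2l // big_split /= -mulr_sumr -!mulr_suml. apply: lerD.
    by rewrite ler_pM2r ?invr_gt0 // ler_pM2r ?invr_gt0 // sums.
  by apply: ler_wpM2l; [rewrite subr_ge0 invf_le1|exact: tM].
move: main; rewrite ler_pM2l // mulrBl mul1r => main.
have : tau / p <= r / sigma `^ p / p by lra.
by rewrite ler_pM2r ?invr_gt0 // ler_pdivlMr // mulrC.
Qed.

End SchattenLower.

(** * Upper bounds for Schatten norms *)

Section SchattenUpper.
Context {R : realType}.
Implicit Types (p : R) (x U V : nat -> nat -> R[i]) (s : nat -> R) (N n : nat).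

(** Finite matrices are infinite ones that vanish outside a square. *)
Definition supported N x := forall i j, ~~ ((i < N) && (j < N))%N -> x i j = 0.

Definition orthonormal_on N s U := forall n m, (n < N)%N -> (m < N)%N ->
  s n != 0 -> s m != 0 -> \sum_(i < N) U n i * (U m i)^*%C = (n == m)%:R.

(** Completes a finite orthonormal family to an orthonormal sequence: indices
    that carry no singular value are sent to basis vectors beyond [N], on which
    the family vanishes. *)
Definition pad N s U : nat -> nat -> R[i] := fun n i =>
  if (n < N)%N && (s n != 0) then (if (i < N)%N then U n i else 0)
  else (i == N + n)%N%:R.

Lemma pad_orthonormal N s U : orthonormal_on N s U -> orthonormal_seq (pad N s U).
Proof.
move=> oU m n; apply/cvgC_ltP => e e0; exists (N + (m + n).+1)%N => K NK.
suff -> : series (fun i => pad N s U m i * (pad N s U n i)^*%C) K = (m == n)%:R.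
  by rewrite subrr nc0.
have NleK : (N <= K)%N by apply: leq_trans NK; exact: leq_addr.
have NmK : (N + m < K)%N.
  by apply: leq_trans NK; rewrite ltn_add2l ltnS leq_addr.
rewrite /series /= big_mkord /pad.
case: (boolP ((m < N)%N && (s m != 0))) => hm; case: (boolP ((n < N)%N && (s n != 0))) => hn.
- have /andP[mN sm] := hm; have /andP[nN sn] := hn.
  rewrite -(oU m n) // (big_ord_widen _ (fun i => U m i * (U n i)^*%C) NleK).
  rewrite [RHS]big_mkcond /=; apply: eq_bigr => i _.
  by case: ifP => // _; rewrite mul0r.
- rewrite big1 => [|i _].
    by case: eqVneq => // mn; move: hn; rewrite -mn hm.
  case: ifP => [iN|_]; last by rewrite mul0r.
  rewrite (_ : (i == N + n :> nat)%N = false) ?conjc0 ?mulr0 //.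
  by apply/negbTE; rewrite neq_ltn (leq_trans iN) // leq_addr.
- rewrite big1 => [|i _].
    by case: eqVneq => // mn; move: hm; rewrite mn hn.
  case: ifP => [iN|_]; last by rewrite conjc0 mulr0.
  rewrite (_ : (i == N + m :> nat)%N = false) ?mul0r //.
  by apply/negbTE; rewrite neq_ltn (leq_trans iN) // leq_addr.
- rewrite (bigD1 (Ordinal NmK)) //= eqxx mul1r big1 ?addr0 => [|i]; last first.
    by rewrite -val_eqE /= => /negbTE ->; rewrite mul0r.
  by rewrite eqn_add2l conjc_nat.
Qed.

Lemma nneseries_fin N (f : nat -> R) : (forall n, 0 <= f n) ->
  (forall n, (N <= n)%N -> f n = 0) ->
  (\sum_(0 <= n <oo) (f n)%:E)%E = (\sum_(n < N) f n)%:E.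
Proof.
move=> f0 fN; rewrite (@nneseries_split R _ 0 N) => [|n _]; last by rewrite lee_fin.
rewrite add0n [X in (_ + X)%E]eseries0 => [|n Nn _]; last by rewrite fN.
by rewrite adde0 big_mkord sumEFin.
Qed.

(** Vectors for vanishing singular values may be arbitrary, since [pad]
    replaces them. *)
Lemma schatten_le p N x s U V : 0 < p -> (forall n, 0 <= s n) ->
  orthonormal_on N s U -> orthonormal_on N s V -> supported N x ->
  (forall i j, (i < N)%N -> (j < N)%N ->
     x i j = \sum_(n < N) (s n)%:C * U n i * (V n j)^*%C) ->
  (schatten p x <= ((\sum_(n < N) s n `^ p) `^ p^-1)%:E)%E.
Proof.
move=> p0 s0 oU oV supp xE.
pose s' n := if (n < N)%N then s n else 0.
apply: ge_ereal_inf; exists ((\sum_(0 <= n <oo) (s' n `^ p)%:E) `^ p^-1)%E; last first.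
  rewrite (@nneseries_fin N (fun n => s' n `^ p)).
  - rewrite poweR_EFin lee_fin le_eqVlt; apply/orP; left; apply/eqP; congr (_ `^ _).
    by apply: eq_bigr => n _; rewrite /s' ltn_ord.
  - by move=> n; exact: powR_ge0.
  - by move=> n Nn; rewrite /s' ltnNge Nn /= powR0 // gt_eqF.
exists s' => //; split; first by move=> n; rewrite /s'; case: ifP.
exists (pad N s U), (pad N s V); split; [exact: pad_orthonormal..|].
move=> i j; apply/cvgC_ltP => e e0; exists N => K NK.
suff -> : series (fun n => (s' n)%:C * pad N s U n i * (pad N s V n j)^*%C) K = x i j.
  by rewrite subrr nc0.
rewrite /series /= big_mkord.
transitivity (\sum_(n < N) (s n)%:C * pad N s U n i * (pad N s V n j)^*%C).
  rewrite (big_ord_widen _ (fun n => (s n)%:C * pad N s U n i * (pad N s V n j)^*%C) NK).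
  rewrite [RHS]big_mkcond /=; apply: eq_bigr => n _.
  by rewrite /s'; case: ifP => // _; rewrite !mul0r.
case: (boolP ((i < N) && (j < N))%N) => [/andP[iN jN]|h].
  rewrite xE //; apply: eq_bigr => n _; rewrite /pad ltn_ord iN jN /=.
  by case: eqVneq => // ->; rewrite /= !mul0r.
rewrite supp //; apply: big1 => n _; rewrite /pad ltn_ord /=.
have [->|_] /= := eqVneq (s n) 0; first by rewrite !mul0r.
move: h; rewrite negb_and => /orP[] /negbTE ->; first by rewrite mulr0 mul0r.
by rewrite conjc0 mulr0.
Qed.

Lemma schatten_ge0 p x : (0 <= schatten p x)%E.
Proof. by apply/ereal_infP => _ [s _ <-]; exact: poweR_ge0. Qed.

Lemma schatten0 p : 0 < p -> schatten p (0 : nat -> nat -> R[i]) = 0%E.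
Proof.
move=> p0; apply/le_anti; rewrite schatten_ge0 andbT.
have := @schatten_le p 0 0 (fun=> 0) (fun _ _ => 0) (fun _ _ => 0) p0.
move=> h; apply: le_trans (h _ _ _ _ _) _ => //.
by rewrite big_ord0 powR0 // invr_eq0 gt_eqF.
Qed.

Lemma sum_sqr_le (I : Type) (t : seq I) (P : pred I) (F : I -> R) : (forall i, 0 <= F i) ->
  \sum_(i <- t | P i) F i ^+ 2 <= (\sum_(i <- t | P i) F i) ^+ 2.
Proof.
move=> F0; elim: t => [|i t ih]; first by rewrite !big_nil expr0n.
rewrite !big_cons; case: ifP => // _.
have : 0 <= \sum_(j <- t | P j) F j by apply: sumr_ge0.
have := F0 i; move: ih; set a := F i; set b := \sum_(j <- _ | _) F j.
move=> h a0 b0; have : 0 <= a * b by rewrite mulr_ge0.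
rewrite sqrrD; lra.
Qed.

Local Open Scope sesquilinear_scope.

(** If P diagonalises M^* M, then the columns of W = M P^* are orthogonal, their
    norms are the singular values of M, and M = W P. *)
Lemma finite_svd N x : supported N x -> exists s U V,
  [/\ forall n, 0 <= s n, orthonormal_on N s U, orthonormal_on N s V,
  forall i j, (i < N)%N -> (j < N)%N ->
     x i j = \sum_(n < N) (s n)%:C * U n i * (V n j)^*%C &
  forall n, (n < N)%N -> s n <= \sum_(i < N) \sum_(j < N) nc (x i j)].
Proof.
move=> supp.
pose M : 'M[R[i]]_N := \matrix_(i, j) x i j.
pose A := M^t* *m M.
pose P := spectralmx A; pose d := spectral_diag A.
have PU : P \is unitarymx by exact: spectral_unitarymx.
have AN : A \is normalmx.
  apply/normalmxP; suff -> : A^t* = A by [].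
  by rewrite /A trmx_mul map_mxM trmxCK.
have AE := (orthomx_spectralP AN : A = _).
rewrite -/P -/d invmx_unitary // in AE.
have [W Wdef] : {W | W = M *m P^t*} by exists (M *m P^t*).
have PP : P *m P^t* = 1%:M by exact/unitarymxP.
have PP' : P^t* *m P = 1%:M by rewrite -invmx_unitary // mulVmx // spectral_unit.
have WW : W^t* *m W = diag_mx d.
  rewrite Wdef trmx_mul map_mxM trmxCK !mulmxA -[P *m M^t* *m M]mulmxA -/A AE.
  by rewrite !mulmxA PP mul1mx -mulmxA PP mulmx1.
have MW : M = W *m P by rewrite Wdef -mulmxA PP' mulmx1.
have conjE (z : R[i]) : (z^*)%R = z^*%C by [].
(* The entries as functions of natural numbers, 0 out of range. *)
pose m (B : 'M[R[i]]_N) (i j : nat) : R[i] :=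
  if insub i is Some i' then if insub j is Some j' then B i' j' else 0 else 0.
have mE B (i j : 'I_N) : m B i j = B i j by rewrite /m !valK.
pose s n := Num.sqrt (\sum_(i < N) nc (m W i n) ^+ 2).
have s2 n : s n ^+ 2 = \sum_(i < N) nc (m W i n) ^+ 2.
  by rewrite sqr_sqrtr // sumr_ge0 // => i _; exact: sqr_ge0.
have WE (n k : 'I_N) : \sum_(i < N) W i n * (W i k)^*%C = (n == k)%:R * ((s n) ^+ 2)%:C.
  transitivity ((W^t* *m W) k n).
    by rewrite mxE; apply: eq_bigr => i _; rewrite !mxE mulrC.
  rewrite WW mxE eq_sym; case: eqVneq => [->|_]; last by rewrite mul0r.
  rewrite mul1r mulr1n s2 rmorph_sum /=.
  transitivity ((W^t* *m W) k k); first by rewrite WW mxE eqxx mulr1n.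
  by rewrite mxE; apply: eq_bigr => i _; rewrite !mxE mE mulrC mul_conj.
exists s, (fun n i => m W i n / (s n)%:C), (fun n j => (m P n j)^*%C); split.
- by move=> n; exact: sqrtr_ge0.
- move=> n k nN kN sn sk.
  have := WE (Ordinal nN) (Ordinal kN); rewrite -val_eqE /= => WEnk.
  transitivity ((\sum_(i < N) W i (Ordinal nN) * (W i (Ordinal kN))^*%C) / ((s n)%:C * (s k)%:C)).
    rewrite mulr_suml; apply: eq_bigr => i _.
    rewrite (mE W i (Ordinal nN)) (mE W i (Ordinal kN)) conjM conjc_inv conjc_real.
    by rewrite invfM; ring.
  rewrite WEnk; case: eqVneq => [->|_]; last by rewrite !mul0r.
  by rewrite mul1r rmorphXn /= expr2 divff // mulf_neq0 // -[0]/((0:R)%:C) (inj_eq (@complexI _)).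
- move=> n k nN kN _ _.
  transitivity ((P *m P^t*) (Ordinal kN) (Ordinal nN)).
    rewrite mxE; apply: eq_bigr => i _; rewrite !mxE conjE.
    by rewrite (mE P (Ordinal nN) i) (mE P (Ordinal kN) i) conjcK mulrC.
  by rewrite PP mxE -val_eqE /= eq_sym.
- move=> i j iN jN; transitivity (M (Ordinal iN) (Ordinal jN)); first by rewrite mxE.
  rewrite {1}MW mxE; apply: eq_bigr => n _.
  rewrite conjcK (mE W (Ordinal iN) n) (mE P n (Ordinal jN)); congr (_ * _).
  have [sn|sn] := eqVneq (s n) 0; last first.
    by rewrite mulrC divfK // -[0]/((0:R)%:C) (inj_eq (@complexI _)).
  rewrite sn mul0r; apply: nc_eq0; apply/eqP; rewrite -sqrf_eq0.
  have := s2 n; rewrite sn expr0n /= => /esym/eqP.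
  rewrite psumr_eq0 => [|k _]; last exact: sqr_ge0.
  by move=> /allP/(_ (Ordinal iN) (mem_index_enum _)) /=; rewrite (mE W (Ordinal iN) n).
- move=> n nN.
  have P1 (j : 'I_N) : nc (P (Ordinal nN) j) <= 1.
    have /(congr1 (fun B : 'M[R[i]]_N => complex.Re (B (Ordinal nN) (Ordinal nN)))) := PP.
    rewrite !mxE eqxx /= Re_sum (bigD1 j) //= !mxE conjE mul_conj /= => h.
    rewrite -(@expr_le1 _ 2) ?nc_ge0 // -h lerDl sumr_ge0 // => k _.
    by rewrite !mxE conjE mul_conj /= sqr_ge0.
  rewrite -(@ler_pXn2r _ 2) ?nnegrE ?sqrtr_ge0 //; last first.
    by apply: sumr_ge0 => i _; apply: sumr_ge0 => j _; exact: nc_ge0.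
  rewrite s2; apply: le_trans (sum_sqr_le _ _ _) _; first by move=> i; exact: nc_ge0.
  rewrite ler_pXn2r ?nnegrE //; first last.
  - by apply: sumr_ge0 => i _; apply: sumr_ge0 => j _; exact: nc_ge0.
  - by apply: sumr_ge0 => i _; exact: nc_ge0.
  apply: ler_sum => i _; rewrite (mE W i (Ordinal nN)) Wdef mxE.
  apply: le_trans (nc_sum _ _ _) _; apply: ler_sum => j _.
  by rewrite !mxE ncM conjE nc_conj ler_piMr // nc_ge0.
Qed.

(** The dependence on the entries makes matrix-valued functions with continuous
    entries continuous for the Schatten norm. *)
Lemma schatten_le_entries p N x : 0 < p -> supported N x ->
  (schatten p x <=
    (N%:R `^ p^-1 * (\sum_(i < N) \sum_(j < N) nc (x i j)))%:E)%E.
Proof.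
move=> p0 supp; have [s [U [V [s0 oU oV xE sE]]]] := finite_svd supp.
apply: le_trans (schatten_le p0 s0 oU oV supp xE) _; rewrite lee_fin.
set E := \sum_(i < N) _ in sE *.
have E0 : 0 <= E by apply: sumr_ge0 => i _; apply: sumr_ge0 => j _; exact: nc_ge0.
have -> : N%:R `^ p^-1 * E = (N%:R * E `^ p) `^ p^-1.
  by rewrite powRM ?powR_ge0 // -powRrM divff ?gt_eqF // powRr1.
have sumle : \sum_(n < N) s n `^ p <= N%:R * E `^ p.
  rewrite mulr_natl -[N in _ *+ N]card_ord -sumr_const; apply: ler_sum => n _.
  by apply: ge0_ler_powR; rewrite ?nnegrE ?(ltW p0) ?sE.
have sum0 : 0 <= \sum_(n < N) s n `^ p by apply: sumr_ge0 => i _; exact: powR_ge0.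
apply: ge0_ler_powR (sumle); rewrite ?nnegrE ?invr_ge0 ?(ltW p0) //.
exact: le_trans sum0 sumle.
Qed.

End SchattenUpper.

(** * Dyadic skew matrices and Walsh matrices *)

Section DyadicMatrices.
Context {R : realType}.
Implicit Types (x y : nat -> R[i]) (l N i j : nat).

Definition norm2 N x : R := \sum_(i < N) nc (x i) ^+ 2.

Definition shift l x : nat -> R[i] := fun i => x (2 ^ l + i)%N.

Lemma sum_pow2S (V : nmodType) l (F : nat -> V) :
  \sum_(i < 2 ^ l.+1) F i =
  \sum_(i < 2 ^ l) F i + \sum_(i < 2 ^ l) F (2 ^ l + i)%N.
Proof. by rewrite expnS mul2n -addnn big_split_ord. Qed.

Lemma norm2S l x : norm2 (2 ^ l.+1) x = norm2 (2 ^ l) x + norm2 (2 ^ l) (shift l x).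
Proof. exact: (sum_pow2S l (fun i => nc (x i) ^+ 2)). Qed.

Lemma parallelogram (a b : R[i]) :
  nc (a + b) ^+ 2 + nc (a - b) ^+ 2 = 2 * (nc a ^+ 2 + nc b ^+ 2).
Proof. by rewrite !nc_sq; case: a => a1 a2; case: b => b1 b2 /=; ring. Qed.

Lemma ncM_le (a b : R[i]) (q : R) : 0 < q ->
  nc (a * b) <= 2^-1 * (nc a ^+ 2 / q + q * nc b ^+ 2).
Proof.
move=> q0; rewrite ncM; set s := nc a; set t := nc b.
have -> : 2^-1 * (s ^+ 2 / q + q * t ^+ 2) = s * t + (s - q * t) ^+ 2 / (2 * q).
  by field; rewrite gt_eqF.
by rewrite lerDl divr_ge0 ?sqr_ge0 // mulr_ge0 // ltW.
Qed.

Lemma norm2_sum_le l x : nc (\sum_(i < 2 ^ l) x i) ^+ 2 <= 2 ^+ l * norm2 (2 ^ l) x.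
Proof.
elim: l x => [|l ih] x; first by rewrite expr0 mul1r /norm2 !big_ord1.
rewrite (sum_pow2S l x) norm2S.
have -> : \sum_(i < 2 ^ l) x (2 ^ l + i)%N = \sum_(i < 2 ^ l) shift l x i by [].
set a := \sum_(i < _) x i; set b := \sum_(i < _) shift l x i.
have := parallelogram a b; have := sqr_ge0 (nc (a - b)).
have := ih x; have := ih (shift l x); rewrite -/a -/b [2 ^+ _.+1]exprS.
by move: (2 ^+ l) => m; lra.
Qed.

(** On each dyadic scale, of half-length m, the entries are 1/m in the upper
    right block and -1/m in the lower left one. *)
Fixpoint skew l : nat -> nat -> R :=
  if l is l'.+1 then fun i j =>
    if (i < 2 ^ l')%N then
      if (j < 2 ^ l')%N then skew l' i j else (2 ^+ l')^-1
    else if (j < 2 ^ l')%N then - (2 ^+ l')^-1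
         else skew l' (i - 2 ^ l') (j - 2 ^ l')
  else fun _ _ => 0.

Lemma sum2_pow2S (V : nmodType) l (F : nat -> nat -> V) :
  \sum_(i < 2 ^ l.+1) \sum_(j < 2 ^ l.+1) F i j =
  \sum_(i < 2 ^ l) \sum_(j < 2 ^ l) F i j +
  \sum_(i < 2 ^ l) \sum_(j < 2 ^ l) F i (2 ^ l + j)%N +
  (\sum_(i < 2 ^ l) \sum_(j < 2 ^ l) F (2 ^ l + i)%N j +
  \sum_(i < 2 ^ l) \sum_(j < 2 ^ l) F (2 ^ l + i)%N (2 ^ l + j)%N).
Proof.
rewrite (sum_pow2S l (fun i => \sum_(j < 2 ^ l.+1) F i j)).
by congr (_ + _); rewrite -big_split; apply: eq_bigr => i _; rewrite sum_pow2S.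
Qed.

Lemma ltn_addl_false m i : (m + i < m)%N = false.
Proof. by apply/negbTE; rewrite -leqNgt leq_addr. Qed.

Lemma skew_abs_sum l :
  \sum_(i < 2 ^ l) \sum_(j < 2 ^ l) `|skew l i j| = l%:R * 2 ^+ l.
Proof.
elim: l => [|l ih]; first by rewrite !big_ord1 /= normr0 mul0r.
rewrite (sum2_pow2S l (fun i j => `|skew l.+1 i j|)).
have V0 : 0 < (2 ^+ l : R) by apply: exprn_gt0.
have const (F : nat -> nat -> R) : (forall i j : 'I_(2 ^ l), F i j = (2 ^+ l)^-1) ->
    \sum_(i < 2 ^ l) \sum_(j < 2 ^ l) F i j = 2 ^+ l.
  move=> FE; under eq_bigr do under eq_bigr do rewrite FE.
  rewrite !sumr_const !card_ord -mulrnA -(mulr_natr (2 ^+ l)^-1) natrM natrX.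
  by field; rewrite gt_eqF.
rewrite (const (fun i j => `|skew l.+1 i (2 ^ l + j)%N|)); last first.
  by move=> i j /=; rewrite ltn_ord ltn_addl_false ger0_norm // invr_ge0 ltW.
rewrite (const (fun i j => `|skew l.+1 (2 ^ l + i)%N j|)); last first.
  by move=> i j /=; rewrite ltn_ord ltn_addl_false normrN ger0_norm // invr_ge0 ltW.
under eq_bigr do under eq_bigr do rewrite /= !ltn_ord.
under [X in _ + (_ + X)]eq_bigr do under eq_bigr do rewrite /= !ltn_addl_false !addKn.
rewrite ih [2 ^+ _.+1]exprS -natr1; ring.
Qed.

Definition upper_sign i j : R := if (i <= j)%N then 1 else -1.

Lemma skew_sign l i j : (i < 2 ^ l)%N -> (j < 2 ^ l)%N ->
  skew l i j = `|skew l i j| * upper_sign i j.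
Proof.
elim: l i j => [|l ih] i j; first by rewrite normr0 mul0r.
rewrite expnS mul2n -addnn /= /upper_sign => iN jN.
have V0 : 0 <= (2 ^+ l : R)^-1 by rewrite invr_ge0 exprn_ge0.
case: (ltnP i) => im; case: (ltnP j) => jm.
- exact: ih.
- by rewrite (leq_trans (ltnW im) jm) ger0_norm // mulr1.
- by rewrite leqNgt (leq_trans jm im) normrN ger0_norm // mulrN1.
- rewrite {1}ih ?ltn_subLR //; congr (_ * _); rewrite /upper_sign.
  by rewrite leq_sub2rE.
Qed.

Definition bilinear_form N (h : nat -> nat -> R) x y : R[i] :=
  \sum_(i < N) \sum_(j < N) (h i j)%:C * (x i * y j).

Lemma skew_formS l x y : bilinear_form (2 ^ l.+1) (skew l.+1) x y =
  bilinear_form (2 ^ l) (skew l) x y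
  + bilinear_form (2 ^ l) (skew l) (shift l x) (shift l y)
  + ((2 ^+ l)^-1)%:C * ((\sum_(i < 2 ^ l) x i) * (\sum_(j < 2 ^ l) shift l y j)
       - (\sum_(i < 2 ^ l) shift l x i) * (\sum_(j < 2 ^ l) y j)).
Proof.
rewrite /bilinear_form (sum2_pow2S l (fun i j => (skew l.+1 i j)%:C * (x i * y j))).
have const c (F : nat -> nat -> R) x' y' : (forall i j : 'I_(2 ^ l), F i j = c) ->
    \sum_(i < 2 ^ l) \sum_(j < 2 ^ l) (F i j)%:C * (x' i * y' j) =
    c%:C * ((\sum_(i < 2 ^ l) x' i) * (\sum_(j < 2 ^ l) y' j)).
  move=> FE; rewrite mulr_suml mulr_sumr; apply: eq_bigr => i _.
  by rewrite !mulr_sumr; apply: eq_bigr => j _; rewrite FE.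
rewrite (const (2 ^+ l)^-1 (fun i j => skew l.+1 i (2 ^ l + j)%N) x (shift l y)); last first.
  by move=> i j /=; rewrite ltn_ord ltn_addl_false.
rewrite (const (- (2 ^+ l)^-1) (fun i j => skew l.+1 (2 ^ l + i)%N j) (shift l x) y); last first.
  by move=> i j /=; rewrite ltn_ord ltn_addl_false.
have -> : \sum_(i < 2 ^ l) \sum_(j < 2 ^ l) (skew l.+1 i j)%:C * (x i * y j) =
    \sum_(i < 2 ^ l) \sum_(j < 2 ^ l) (skew l i j)%:C * (x i * y j).
  by apply: eq_bigr => i _; apply: eq_bigr => j _ /=; rewrite !ltn_ord.
have -> : \sum_(i < 2 ^ l) \sum_(j < 2 ^ l) (skew l.+1 (2 ^ l + i)%N (2 ^ l + j)%N)%:C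
      * (x (2 ^ l + i)%N * y (2 ^ l + j)%N) =
    \sum_(i < 2 ^ l) \sum_(j < 2 ^ l) (skew l i j)%:C * (shift l x i * shift l y j).
  by apply: eq_bigr => i _; apply: eq_bigr => j _ /=; rewrite !ltn_addl_false !addKn.
have -> : (- (2 ^+ l)^-1)%:C = - ((2 ^+ l)^-1)%:C :> R[i] by rewrite rmorphN.
by ring.
Qed.

(** With X1, X2 and Y1, Y2 the sums of [x] and [y] over the two halves, the
    outermost scale contributes (X1 Y2 - X2 Y1) / m. This is a combination of
    products of a sum X1 + X2 by a difference Y1 - Y2, and vice versa. The
    sums are bounded by the Cauchy-Schwarz inequality; the squares of the
    differences add up over all scales to at most |y|^2, by orthogonality of
    the Haar functions, and the subtracted terms keep track of what is left. *)
Lemma skew_form_le_aux l x y (q : R) : 0 < q ->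
  nc (bilinear_form (2 ^ l) (skew l) x y) <=
  2^-1 * (l%:R / q * (norm2 (2 ^ l) x + norm2 (2 ^ l) y)
   + q * (norm2 (2 ^ l) x - nc (\sum_(i < 2 ^ l) x i) ^+ 2 / 2 ^+ l
        + (norm2 (2 ^ l) y - nc (\sum_(i < 2 ^ l) y i) ^+ 2 / 2 ^+ l))).
Proof.
move=> q0; elim: l x y => [|l ih] x y.
  rewrite /bilinear_form !big_ord1 /= mul0r nc0 !mul0r add0r.
  by rewrite /norm2 !big_ord1 expr0 invr1 !mulr1 !subrr addr0 mulr0 mulr0.
have nx := norm2_sum_le l.+1 x; have ny := norm2_sum_le l.+1 y.
have := ih x y; have := ih (shift l x) (shift l y).
rewrite skew_formS; move: nx ny.
rewrite !norm2S (sum_pow2S l x) (sum_pow2S l y) -/(shift l x) -/(shift l y).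
set n1 := norm2 _ x; set n2 := norm2 _ (shift _ x).
set p1 := norm2 _ y; set p2 := norm2 _ (shift _ y).
have -> : \sum_(i < 2 ^ l) x (2 ^ l + i)%N = \sum_(i < 2 ^ l) shift l x i by [].
have -> : \sum_(i < 2 ^ l) y (2 ^ l + i)%N = \sum_(i < 2 ^ l) shift l y i by [].
set X1 := \sum_(i < _) x i; set X2 := \sum_(i < _) shift l x i.
set Y1 := \sum_(i < _) y i; set Y2 := \sum_(i < _) shift l y i.
set Q1 := bilinear_form _ _ _ _; set Q2 := bilinear_form _ _ _ _.
rewrite [2 ^+ _.+1]exprS; have : 0 < (2 ^+ l : R) by apply: exprn_gt0.
set m : R := 2 ^+ l => m0 nx ny h2 h1.
have px := parallelogram X1 X2; have py := parallelogram Y1 Y2.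
have -> : (m^-1)%:C * (X1 * Y2 - X2 * Y1) =
    ((2 * m)^-1)%:C * (- ((X1 + X2) * (Y1 - Y2)) - (- ((X1 - X2) * (Y1 + Y2)))).
  have -> : (m^-1)%:C = 2 * ((2 * m)^-1)%:C :> R[i].
    have -> : m^-1 = 2 * (2 * m)^-1 by field; rewrite gt_eqF.
    by rewrite rmorphM /= rmorph_nat.
  by ring.
apply: le_trans (ncD _ _) _; apply: le_trans (lerD (ncD _ _) (lexx _)) _.
apply: le_trans (lerD (lerD h1 h2) (lexx _)) _.
have cross : nc (- ((X1 + X2) * (Y1 - Y2)) - (- ((X1 - X2) * (Y1 + Y2)))) <=
    2^-1 * (nc (X1 + X2) ^+ 2 / q + q * nc (Y1 - Y2) ^+ 2) +
    2^-1 * (nc (Y1 + Y2) ^+ 2 / q + q * nc (X1 - X2) ^+ 2).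
  apply: le_trans (ncD _ _) _; rewrite !ncN; apply: lerD; first exact: ncM_le.
  by rewrite mulrC; exact: ncM_le.
have m2 : 0 <= (2 * m)^-1 by rewrite invr_ge0 mulr_ge0 // ltW.
rewrite ncM nc_real (ger0_norm m2).
apply: le_trans (lerD (lexx _) (ler_wpM2l m2 cross)) _.
move: nx ny px py; set Sx := nc (X1 + X2) ^+ 2; set Sy := nc (Y1 + Y2) ^+ 2.
set Dx := nc (X1 - X2) ^+ 2; set Dy := nc (Y1 - Y2) ^+ 2.
move=> nx ny px py.
have {}px : nc X1 ^+ 2 = (Sx + Dx) / 2 - nc X2 ^+ 2 by lra.
have {}py : nc Y1 ^+ 2 = (Sy + Dy) / 2 - nc Y2 ^+ 2 by lra.
rewrite px py -subr_ge0 -natr1.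
set E := (X in 0 <= X).
have -> : E = (2 * q * (2 * m))^-1 * ((2 * m * (n1 + n2) - Sx) + (2 * m * (p1 + p2) - Sy)).
  by rewrite /E; field; rewrite !gt_eqF.
apply: mulr_ge0; first by rewrite invr_ge0 !mulr_ge0 // ltW.
by rewrite addr_ge0 // subr_ge0.
Qed.

(** The bound with parameter [q] is balanced for [q^2] scales. *)
Lemma skew_form_le (q : nat) x y : (0 < q)%N ->
  nc (bilinear_form (2 ^ (q ^ 2)) (skew (q ^ 2)) x y) <=
  q%:R * (norm2 (2 ^ (q ^ 2)) x + norm2 (2 ^ (q ^ 2)) y).
Proof.
move=> q0; have qR : 0 < q%:R :> R by rewrite ltr0n.
apply: le_trans (skew_form_le_aux _ _ _ qR) _.
set n := norm2 _ x; set p := norm2 _ y; set a := nc _ ^+ 2; set b := nc _ ^+ 2.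
have a0 : 0 <= a / 2 ^+ (q ^ 2) by rewrite divr_ge0 ?sqr_ge0 ?exprn_ge0.
have b0 : 0 <= b / 2 ^+ (q ^ 2) by rewrite divr_ge0 ?sqr_ge0 ?exprn_ge0.
have -> : (q ^ 2)%:R / q%:R = q%:R :> R by rewrite natrX; field; rewrite gt_eqF.
have : q%:R * (n - a / 2 ^+ (q ^ 2) + (p - b / 2 ^+ (q ^ 2))) <= q%:R * (n + p).
  by rewrite ler_pM2l //; lra.
lra.
Qed.

Fixpoint walsh l : nat -> nat -> R :=
  if l is l'.+1 then fun i j =>
    if (i < 2 ^ l')%N then
      if (j < 2 ^ l')%N then walsh l' i j else walsh l' i (j - 2 ^ l')
    else if (j < 2 ^ l')%N then walsh l' (i - 2 ^ l') j
         else - walsh l' (i - 2 ^ l') (j - 2 ^ l')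
  else fun _ _ => 1.

Lemma walsh_norm l i j : `|walsh l i j| = 1.
Proof.
elim: l i j => [|l ih] i j /=; first by rewrite normr1.
by case: ifP => _; case: ifP => _ //; rewrite normrN.
Qed.

(** Hence [walsh l] divided by the square root of 2^l is unitary. *)
Lemma walsh_orth l i k : (i < 2 ^ l)%N -> (k < 2 ^ l)%N ->
  \sum_(j < 2 ^ l) walsh l i j * walsh l k j = (i == k)%:R * 2 ^+ l.
Proof.
elim: l i k => [|l ih] i k.
  by rewrite !ltnS !leqn0 => /eqP -> /eqP ->; rewrite big_ord1 /= !mulr1.
move=> iN kN; rewrite (sum_pow2S l (fun j => walsh l.+1 i j * walsh l.+1 k j)) /=.
under eq_bigr do rewrite !ltn_ord.
under [X in _ + X]eq_bigr do rewrite !ltn_addl_false !addKn.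
rewrite expnS mul2n -addnn in iN kN.
case: (ltnP i) => im; case: (ltnP k) => km.
- by rewrite !ih // [2 ^+ _.+1]exprS; ring.
- under [X in _ + X]eq_bigr do rewrite mulrN.
  rewrite sumrN subrr; case: eqVneq => [ik|]; last by rewrite mul0r.
  by move: im; rewrite ik ltnNge km.
- under [X in _ + X]eq_bigr do rewrite mulNr.
  rewrite sumrN subrr; case: eqVneq => [ik|]; last by rewrite mul0r.
  by move: km; rewrite -ik ltnNge im.
- under [X in _ + X]eq_bigr do rewrite mulrNN.
  rewrite !ih ?ltn_subLR // [2 ^+ _.+1]exprS.
  rewrite (_ : (i - 2 ^ l == k - 2 ^ l)%N = (i == k)); first by ring.
  by rewrite -(eqn_add2r (2 ^ l)) !subnK.
Qed.

(** By induction: the form on a square of double size is the sum of the forms of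
    the first half of [x] with the sum, and of the second half with the
    difference, of the two halves of [y]. *)
Lemma walsh_form_le_aux l x y (q : R) : 0 < q ->
  nc (bilinear_form (2 ^ l) (walsh l) x y) <=
  2^-1 * (norm2 (2 ^ l) x * 2 ^+ l / q + q * norm2 (2 ^ l) y).
Proof.
elim: l x y q => [|l ih] x y q q0.
  rewrite /bilinear_form /norm2 !big_ord1 /= mul1r expr0 mulr1.
  exact: ncM_le.
have -> : bilinear_form (2 ^ l.+1) (walsh l.+1) x y =
    bilinear_form (2 ^ l) (walsh l) x (fun j => y j + shift l y j)
  + bilinear_form (2 ^ l) (walsh l) (shift l x) (fun j => y j - shift l y j).
  rewrite /bilinear_form (sum2_pow2S l (fun i j => (walsh l.+1 i j)%:C * (x i * y j))).
  rewrite -!big_split /=; apply: eq_bigr => i _.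
  rewrite -!big_split /=; apply: eq_bigr => j _ /=.
  rewrite !ltn_ord !ltn_addl_false !addKn rmorphN /= /shift; ring.
apply: le_trans (ncD _ _) _.
have q20 : 0 < q / 2 by rewrite divr_gt0.
apply: le_trans (lerD (ih _ _ _ q20) (ih _ _ _ q20)) _.
rewrite !norm2S.
have : norm2 (2 ^ l) (fun j => y j + shift l y j) + norm2 (2 ^ l) (fun j => y j - shift l y j)
    = 2 * (norm2 (2 ^ l) y + norm2 (2 ^ l) (shift l y)).
  rewrite /norm2 -!big_split mulr_sumr; apply: eq_bigr => j _; exact: parallelogram.
set a := norm2 _ (fun j => _ + _); set b := norm2 _ (fun j => _ - _) => ab.
have -> : a = 2 * (norm2 (2 ^ l) y + norm2 (2 ^ l) (shift l y)) - b by lra.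
rewrite le_eqVlt; apply/orP; left; apply/eqP; rewrite [2 ^+ _.+1]exprS.
by field; rewrite gt_eqF.
Qed.

Lemma walsh_form_le l x y :
  nc (bilinear_form (2 ^ l) (walsh l) x y) <=
  Num.sqrt (2 ^+ l) * (2^-1 * (norm2 (2 ^ l) x + norm2 (2 ^ l) y)).
Proof.
have q0 : 0 < Num.sqrt (2 ^+ l) :> R by rewrite sqrtr_gt0 exprn_gt0.
apply: le_trans (walsh_form_le_aux l x y q0) _.
have -> : norm2 (2 ^ l) x * 2 ^+ l / Num.sqrt (2 ^+ l) = norm2 (2 ^ l) x * Num.sqrt (2 ^+ l).
  rewrite -[in X in X / _](@sqr_sqrtr _ (2 ^+ l)) ?exprn_ge0 //.
  by field; rewrite gt_eqF.
by rewrite le_eqVlt; apply/orP; left; apply/eqP; ring.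
Qed.

End DyadicMatrices.

Arguments skew {R}.
Arguments walsh {R}.
Arguments upper_sign {R}.

(** * Schatten norms of the model matrices *)

Section ExplicitMatrices.
Context {R : realType}.
Implicit Types (p : R) (w : nat -> nat -> R) (a b u v : nat -> R[i]) (l N i j : nat).

(** A finite matrix multiplied by diagonal matrices on both sides. With [a] and
    [b] on the circle these are unitary, so the decompositions and the
    contractions that determine a Schatten norm carry over from [w]. *)
Definition twist N w a b : nat -> nat -> R[i] := fun i j =>
  if ((i < N) && (j < N))%N then (w i j)%:C * (a i * b j) else 0.

Lemma twist_supported N w a b : supported N (twist N w a b).
Proof. by move=> i j /negbTE h; rewrite /twist h. Qed.

Lemma norm2M N a u : (forall i, circle (a i)) -> norm2 N (fun i => a i * u i) = norm2 N u.
Proof. by move=> ca; apply: eq_bigr => i _; rewrite ncM nc_circle // mul1r. Qed.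

Lemma norm2_conj N u : norm2 N (fun i => (u i)^*%C) = norm2 N u.
Proof. by apply: eq_bigr => i _; rewrite nc_conj. Qed.

Lemma norm2_circle N a : (forall i, circle (a i)) -> norm2 N a = N%:R.
Proof.
move=> ca; rewrite /norm2 (eq_bigr (fun=> 1)) ?sumr_const ?card_ord // => i _.
by rewrite nc_circle // expr1n.
Qed.

Lemma pairing_scaled_twist (c : R) N w a b u v :
  pairing (fun i j => c%:C * twist N w a b i j) N u v =
  c%:C * bilinear_form N w (fun i => a i * u i) (fun j => b j * (v j)^*%C).
Proof.
rewrite /pairing /bilinear_form mulr_sumr; apply: eq_bigr => i _.
rewrite mulr_sumr; apply: eq_bigr => j _; rewrite /twist !ltn_ord /=; ring.
Qed.

Lemma schatten_rank1_le p N a b : 0 < p -> (0 < N)%N ->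
  (forall i, circle (a i)) -> (forall i, circle (b i)) ->
  (schatten p (twist N (fun _ _ => 1%R) a b) <= N%:R%:E)%E.
Proof.
move=> p0 N0 ca cb.
have NR : 0 < N%:R :> R by rewrite ltr0n.
pose s n : R := if n == 0%N then N%:R else 0.
pose r : R[i] := (Num.sqrt N%:R)^-1%:C.
have rr : r * r = (N%:R^-1)%:C by rewrite /r -rmorphM /= -invfM -expr2 sqr_sqrtr // ltW.
have on (c : nat -> R[i]) : (forall i, circle (c i)) -> orthonormal_on N s (fun _ i => c i * r).
  have s0 k : s k != 0 -> k = 0%N by rewrite /s; case: (eqVneq k 0%N) => // _; rewrite eqxx.
  move=> cc n m _ _ /s0 -> /s0 ->; rewrite eqxx.
  rewrite (eq_bigr (fun=> (N%:R^-1)%:C)) => [|i _].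
    by rewrite sumr_const card_ord -rmorphMn /= -mulr_natr mulVf // gt_eqF.
  by rewrite conjM -rr conjc_real mulrACA mul_conj nc_circle // expr1n mul1r.
have := @schatten_le _ p N (twist N (fun _ _ => 1%R) a b) s (fun _ i => a i * r)
   (fun _ j => (b j)^*%C * r) p0.
have -> : \sum_(n < N) s n `^ p = N%:R `^ p.
  rewrite (bigD1 (Ordinal N0)) //= big1 ?addr0 // => i i0.
  rewrite /s ifF; first by rewrite powR0 // gt_eqF.
  by apply/negbTE; move: i0; rewrite -val_eqE.
rewrite -powRrM divff ?gt_eqF // powRr1 ?(ltW NR) //; apply.
- by move=> n; rewrite /s; case: ifP => // _; exact: ltW.
- exact: on.
- by apply: on => i; apply/circleP; rewrite nc_conj nc_circle.
- exact: twist_supported.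
- move=> i j iN jN; rewrite /twist iN jN /= (bigD1 (Ordinal N0)) //= big1 ?addr0.
    have -> : ((b j)^*%C * r)^*%C = b j * r by rewrite conjM conjcK conjc_real.
    have : (N%:R : R)%:C * (r * r) = 1.
      by rewrite rr -rmorphM /= divff ?gt_eqF.
    by rewrite /s /= mul1r => h; rewrite -[LHS]mul1r -h; ring.
  move=> n n0; rewrite /s ifF ?mul0r //.
  by apply/negbTE; move: n0; rewrite -val_eqE.
Qed.

Lemma schatten_walsh_le p l a b : 0 < p ->
  (forall i, circle (a i)) -> (forall i, circle (b i)) ->
  (schatten p (twist (2 ^ l) (walsh l) a b) <=
     (Num.sqrt (2 ^+ l) * (2 ^+ l) `^ p^-1)%:E)%E.
Proof.
move=> p0 ca cb; set N := (2 ^ l)%N; set t : R := Num.sqrt _.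
have t2 : t ^+ 2 = 2 ^+ l by rewrite sqr_sqrtr // exprn_ge0.
have t0 : 0 < t by rewrite sqrtr_gt0 exprn_gt0.
have tC : t%:C != 0 :> R[i] by rewrite -[0]/((0:R)%:C) (inj_eq (@complexI _)) gt_eqF.
have := @schatten_le _ p N (twist N (walsh l) a b) (fun=> t)
  (fun n i => (i == n)%:R * a i)
  (fun n j => ((walsh l n j)%:C * b j)^*%C / t%:C) p0.
have -> : (\sum_(n < N) t `^ p) `^ p^-1 = t * (2 ^+ l) `^ p^-1.
  rewrite sumr_const card_ord -(mulr_natr (t `^ p)) powRM ?powR_ge0 // -powRrM divff ?gt_eqF //.
  by rewrite powRr1 ?ltW // natrX.
apply.
- by move=> n; exact: ltW.
- move=> n m nN mN _ _; rewrite (bigD1 (Ordinal nN)) //= big1 ?addr0 => [|i].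
    rewrite eqxx mul1r conjM conjc_nat mulrCA mul_conj nc_circle // expr1n.
    by rewrite mulr1.
  by rewrite -val_eqE /= => /negbTE ->; rewrite !mul0r.
- move=> n m nN mN _ _.
  transitivity ((\sum_(j < N) walsh l n j * walsh l m j)%:C / (t ^+ 2)%:C).
    rewrite rmorph_sum mulr_suml; apply: eq_bigr => j _.
    rewrite !conjM conjc_inv !conjcK !conjc_real rmorphM rmorphXn /= expr2 invfM.
    transitivity ((walsh l n j)%:C * (walsh l m j)%:C * (b j * (b j)^*%C) / t%:C / t%:C).
      by ring.
    by rewrite mul_conj nc_circle // expr1n; ring.
  rewrite walsh_orth // t2 -fmorphV -rmorphM /= mulfK; last by rewrite gt_eqF // exprn_gt0.
  by rewrite rmorph_nat.
- exact: twist_supported.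
- move=> i j iN jN; rewrite /twist iN jN /= (bigD1 (Ordinal iN)) //= big1 ?addr0 => [|n].
    rewrite eqxx !conjM conjc_inv !conjcK !conjc_real.
    by rewrite mulr1n; field.
  by rewrite -val_eqE eq_sym /= => /negbTE ->; rewrite mul0r mulr0 mul0r.
Qed.

Lemma entry_pairing_twist (c : R) N w a b :
  (forall i, circle (a i)) -> (forall i, circle (b i)) ->
  entry_pairing (fun i j => c%:C *
      twist N w (fun i => (a i)^*%C) (fun j => (b j)^*%C) i j) N (twist N w a b) =
  (c * \sum_(i < N) \sum_(j < N) w i j ^+ 2)%:C.
Proof.
move=> ca cb; rewrite /entry_pairing mulr_sumr rmorph_sum; apply: eq_bigr => i _.
rewrite mulr_sumr rmorph_sum; apply: eq_bigr => j _; rewrite /twist !ltn_ord /=.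
transitivity (c%:C * ((w i j)%:C * (w i j)%:C) * (a i * (a i)^*%C) * (b j * (b j)^*%C)).
  by ring.
by rewrite !mul_conj !nc_circle // expr1n !mulr1 expr2 !rmorphM.
Qed.

Lemma circle_conj (z : R[i]) : circle z -> circle z^*%C.
Proof. by move=> cz; apply/circleP; rewrite nc_conj nc_circle. Qed.

(** The contraction to pair with is the complex conjugate of the matrix, divided
    by N; its nuclear norm is 1. *)
Lemma schatten_rank1_ge p N a b : 1 <= p -> (0 < N)%N ->
  (forall i, circle (a i)) -> (forall i, circle (b i)) ->
  (N%:R%:E <= schatten p (twist N (fun _ _ => 1%R) a b))%E.
Proof.
move=> p1 N0 ca cb.
have NR : 0 < N%:R :> R by rewrite ltr0n.
have := @schatten_ge _ p (twist N (fun _ _ => 1%R) a b)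
  (fun i j => N%:R^-1%:C * twist N (fun _ _ => 1%R) (fun i => (a i)^*%C) (fun j => (b j)^*%C) i j)
  N N%:R 1 p1 NR ltr01.
rewrite powR1 mulr1; apply; last first.
  rewrite entry_pairing_twist // nc_real.
  rewrite (eq_bigr (fun=> N%:R)); last first.
    by move=> i _; rewrite (eq_bigr (fun=> 1)) ?sumr_const ?card_ord // => j _; rewrite expr1n.
  rewrite sumr_const card_ord -(mulr_natr N%:R) mulKf ?gt_eqF //.
  by rewrite ger0_norm // ltW.
move=> u v ou ov.
pose A n := \sum_(i < N) a i * (u n i)^*%C.
pose B n := \sum_(j < N) (b j)^*%C * (v n j)^*%C.
have le n : nc (pairing (fun i j => N%:R^-1%:C * twist N (fun _ _ => 1%R)
    (fun i => (a i)^*%C) (fun j => (b j)^*%C) i j) N (u n) (v n))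
    <= (2 * N%:R)^-1 * (nc (A n) ^+ 2 + nc (B n) ^+ 2).
  rewrite pairing_scaled_twist.
  have -> : bilinear_form N (fun _ _ => 1%R) (fun i => (a i)^*%C * u n i)
      (fun j => (b j)^*%C * (v n j)^*%C) = (A n)^*%C * B n.
    rewrite /bilinear_form /A rmorph_sum mulr_suml; apply: eq_bigr => i _.
    rewrite mulr_sumr; apply: eq_bigr => j _ /=.
    by rewrite rmorphM /= conjcK mul1r.
  have h : nc ((A n)^*%C * B n) <= 2^-1 * (nc (A n) ^+ 2 + nc (B n) ^+ 2).
    by have := @ncM_le _ (A n)^*%C (B n) 1 ltr01; rewrite divr1 mul1r nc_conj.
  rewrite ncM nc_real ger0_norm ?invr_ge0 ?(ltW NR) //.
  rewrite invfM [_ * N%:R^-1]mulrC -mulrA.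
  by apply: ler_wpM2l h; rewrite invr_ge0 ltW.
have sum_le M : \sum_(n < M) nc (pairing (fun i j => N%:R^-1%:C * twist N (fun _ _ => 1%R)
    (fun i => (a i)^*%C) (fun j => (b j)^*%C) i j) N (u n) (v n)) <= 1.
  apply: (@le_trans _ _ (\sum_(n < M) (2 * N%:R)^-1 * (nc (A n) ^+ 2 + nc (B n) ^+ 2))).
    by apply: ler_sum => n _; exact: le.
  rewrite -mulr_sumr big_split /=.
  have hA := @bessel _ u a N M ou; have hB := @bessel _ v (fun j => (b j)^*%C) N M ov.
  have ncirc c : (forall i, circle (c i)) -> \sum_(i < N) nc (c i : R[i]) ^+ 2 = N%:R.
    exact: norm2_circle.
  rewrite ncirc // in hA; rewrite (ncirc (fun j => (b j)^*%C)) in hB; last first.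
    by move=> i; exact: circle_conj.
  rewrite mulrC ler_pdivrMr ?mulr_gt0 // mul1r; rewrite -/(A _) in hA.
  have : \sum_(i < M) nc (A i) ^+ 2 + \sum_(i < M) nc (B i) ^+ 2 <= N%:R + N%:R by apply: lerD.
  lra.
split=> // n; apply: le_trans (sum_le n.+1).
by rewrite big_ord_recr /= lerDr; apply: sumr_ge0 => k _; exact: nc_ge0.
Qed.

(** The contraction to pair with is unitary on its support, and its nuclear norm
    is 2^l. *)
Lemma schatten_walsh_ge p l a b : 1 <= p ->
  (forall i, circle (a i)) -> (forall i, circle (b i)) ->
  ((Num.sqrt (2 ^+ l) * (2 ^+ l) `^ p^-1)%:E <=
    schatten p (twist (2 ^ l) (walsh l) a b))%E.
Proof.
move=> p1 ca cb; set N := (2 ^ l)%N; set t : R := Num.sqrt _.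
have t2 : t ^+ 2 = 2 ^+ l by rewrite sqr_sqrtr // exprn_ge0.
have t0 : 0 < t by rewrite sqrtr_gt0 exprn_gt0.
have NR : N%:R = 2 ^+ l :> R by rewrite natrX.
have := @schatten_ge _ p (twist N (walsh l) a b)
  (fun i j => t^-1%:C * twist N (walsh l) (fun i => (a i)^*%C) (fun j => (b j)^*%C) i j)
  N t (2 ^+ l) p1 t0 (exprn_gt0 _ (ltr0n _ 2)); apply; last first.
  rewrite entry_pairing_twist // nc_real.
  rewrite (eq_bigr (fun=> 2 ^+ l)); last first.
    move=> i _; under eq_bigr do rewrite expr2.
    by rewrite walsh_orth // eqxx mul1r.
  rewrite sumr_const card_ord -(mulr_natr (2 ^+ l)) NR -t2.
  have -> : t^-1 * (t ^+ 2 * t ^+ 2) = t * t ^+ 2 by field; rewrite gt_eqF.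
  by rewrite ger0_norm // mulr_ge0 ?sqr_ge0 // ltW.
move=> u v ou ov.
have le n : nc (pairing (fun i j => t^-1%:C * twist N (walsh l)
    (fun i => (a i)^*%C) (fun j => (b j)^*%C) i j) N (u n) (v n))
    <= 2^-1 * (norm2 N (u n) + norm2 N (v n)).
  rewrite pairing_scaled_twist ncM nc_real ger0_norm ?invr_ge0 ?(ltW t0) //.
  have := @walsh_form_le _ l (fun i => (a i)^*%C * u n i) (fun j => (b j)^*%C * (v n j)^*%C).
  rewrite !norm2M ?norm2_conj; [|by move=> i; exact: circle_conj..].
  by rewrite -/t -/N ler_pdivrMl.
split=> [n|M].
  apply: le_trans (le n) _.
  have := bessel_proj N n ou; have := bessel_proj N n ov; rewrite -!/(norm2 _ _); lra.
apply: (@le_trans _ _ (\sum_(n < M) 2^-1 * (norm2 N (u n) + norm2 N (v n)))).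
  by apply: ler_sum => n _; exact: le.
rewrite -mulr_sumr big_split /=.
have := bessel_rows N M ou; have := bessel_rows N M ov.
rewrite NR /norm2; lra.
Qed.

(** So the skew matrix divided by [2 q] is a contraction. *)
Lemma skew_pairing_le (q : nat) a b (u v : nat -> nat -> R[i]) : (0 < q)%N ->
  (forall i, circle (a i)) -> (forall i, circle (b i)) ->
  orthonormal_seq u -> orthonormal_seq v -> forall n,
  nc (pairing (fun i j => (2 * q%:R)^-1%:C * twist (2 ^ (q ^ 2)) (skew (q ^ 2)) a b i j)
     (2 ^ (q ^ 2)) (u n) (v n)) <= 1.
Proof.
move=> q0 ca cb ou ov n; have qR : 0 < 2 * q%:R :> R by rewrite mulr_gt0 ?ltr0n.
rewrite pairing_scaled_twist ncM nc_real ger0_norm ?invr_ge0 ?(ltW qR) //.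
rewrite ler_pdivrMl // mulr1.
apply: le_trans (skew_form_le _ _ q0) _; rewrite !norm2M // norm2_conj.
rewrite mulrC ler_pM2r ?ltr0n //.
have := bessel_proj (2 ^ (q ^ 2)) n ou; have := bessel_proj (2 ^ (q ^ 2)) n ov.
rewrite -!/(norm2 _ _); lra.
Qed.

End ExplicitMatrices.

(** * Integration over the circle *)

Section CircleIntegral.
Context {R : realType}.
Implicit Types (f g : R[i] -> R[i]).

(** Without measurability: integrals of nonnegative functions are suprema over
    simple functions. Norms of vector-valued functions are not known to be
    measurable. *)
Lemma ge0_le_integral_nomeas (f g : R -> \bar R) (D : set R) :
  (forall x, D x -> (0 <= f x)%E) -> (forall x, D x -> (f x <= g x)%E) ->
  (\int[mu]_(x in D) f x <= \int[mu]_(x in D) g x)%E.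
Proof.
move=> f0 fg.
rewrite !ge0_integralE //; last by move=> x Dx; exact: le_trans (f0 x Dx) (fg x Dx).
apply: ereal_sup_le => _ /= [h hf <-]; exists h => // x.
apply: le_trans (hf x) _; rewrite /patch; case: ifPn => // xD.
by apply: fg; rewrite inE in xD.
Qed.

Lemma mI01 : measurable (I01 : set (measurableTypeR R)).
Proof. exact: measurable_itv. Qed.

Lemma mu01 : mu (I01 : set R) = 1%E.
Proof. by rewrite lebesgue_measure_itv /= lte01 sube0. Qed.

Lemma integral01_cst (c : R) : (\int[mu]_(t in (I01 : set R)) c%:E = c%:E)%E.
Proof.
by rewrite (integral_cst mu mI01 c%:E) -[RHS]mule1; congr (_ * _)%E; exact: mu01.
Qed.

Definition int01 (g : R -> R) := mu.-integrable (I01 : set R) (EFin \o g).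

Lemma int01Z (r : R) (g : R -> R) : int01 g -> int01 (fun t => r * g t).
Proof.
move=> ig; have := integrableZl mI01 r ig.
by apply: eq_integrable => [|t _]; [exact: mI01|rewrite /= EFinM].
Qed.

Lemma int01D (g h : R -> R) : int01 g -> int01 h -> int01 (fun t => g t + h t).
Proof.
move=> ig ih; have := integrableD mI01 ig ih.
by apply: eq_integrable => [|t _]; [exact: mI01|rewrite /= EFinD].
Qed.

Lemma int01B (g h : R -> R) : int01 g -> int01 h -> int01 (fun t => g t - h t).
Proof.
move=> ig ih; have := integrableB mI01 ig ih.
by apply: eq_integrable => [|t _]; [exact: mI01|rewrite /= EFinB].
Qed.

Definition cmeas f :=
  measurable_fun (setT : set R) (fun t => complex.Re (f (circ t))) /\
  measurable_fun (setT : set R) (fun t => complex.Im (f (circ t))).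

Definition L1norm f : \bar R := (\int[mu]_(t in I01) (nc (f (circ t)))%:E)%E.

Definition cint f := cmeas f /\ (L1norm f < +oo)%E.

Lemma cint_Re f : cint f -> int01 (fun t => complex.Re (f (circ t))).
Proof.
move=> [[mR mI] fin]; apply/integrableP; split.
  apply/measurable_EFinP; exact: measurable_funTS.
apply: le_lt_trans fin; apply: ge0_le_integral_nomeas => t _ //=.
by rewrite lee_fin nc_Re.
Qed.

Lemma cint_Im f : cint f -> int01 (fun t => complex.Im (f (circ t))).
Proof.
move=> [[mR mI] fin]; apply/integrableP; split.
  apply/measurable_EFinP; exact: measurable_funTS.
apply: le_lt_trans fin; apply: ge0_le_integral_nomeas => t _ //=.
by rewrite lee_fin nc_Im.
Qed.

Lemma cintP f : cmeas f ->
  int01 (fun t => complex.Re (f (circ t))) ->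
  int01 (fun t => complex.Im (f (circ t))) -> cint f.
Proof.
move=> mf iR iI; split=> //.
have [mR mI] := mf.
apply: (@le_lt_trans _ _ (\int[mu]_(t in I01) (`|(complex.Re (f (circ t)))%:E| + `|(complex.Im (f (circ t)))%:E|))%E).
  apply: ge0_le_integral_nomeas => t _; first by rewrite lee_fin nc_ge0.
  by rewrite -EFinD lee_fin nc_leReIm.
have mabs (h : R -> R) : measurable_fun setT h ->
    measurable_fun (I01 : set R) ((fun t => `|(h t)%:E|%E) : R -> \bar R).
  by move=> mh; apply/measurable_EFinP/measurable_funTS/measurableT_comp.
rewrite (ge0_integralD mu mI01 _ (mabs _ mR) _ (mabs _ mI)) //.
by rewrite lte_add_pinfty //; [case/integrableP : iR|case/integrableP : iI].
Qed.

Lemma cmeasM f g : cmeas f -> cmeas g -> cmeas (fun z => f z * g z).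
Proof.
move=> [fR fI] [gR gI]; split.
  under eq_fun do rewrite Re_mul.
  by apply: measurable_funB; apply: measurable_funM.
under eq_fun do rewrite Im_mul.
by apply: measurable_funD; apply: measurable_funM.
Qed.

Lemma cmeasD f g : cmeas f -> cmeas g -> cmeas (fun z => f z + g z).
Proof.
move=> [fR fI] [gR gI]; split.
  by under eq_fun do rewrite Re_add; apply: measurable_funD.
by under eq_fun do rewrite Im_add; apply: measurable_funD.
Qed.

Lemma cmeas_cst (c : R[i]) : cmeas (fun=> c).
Proof. by split; exact: measurable_cst. Qed.

Lemma cintZ (c : R[i]) f : cint f -> cint (fun z => c * f z).
Proof.
move=> cf; apply: cintP.
- by apply: cmeasM; [exact: cmeas_cst|case: cf].
- under eq_fun do rewrite Re_mul.
  by apply: int01B; apply: int01Z; [exact: cint_Re|exact: cint_Im].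
- under eq_fun do rewrite Im_mul.
  by apply: int01D; apply: int01Z; [exact: cint_Im|exact: cint_Re].
Qed.

Lemma cintD f g : cint f -> cint g -> cint (fun z => f z + g z).
Proof.
move=> cf cg; apply: cintP; first by apply: cmeasD; [case: cf|case: cg].
- by under eq_fun do rewrite Re_add; apply: int01D; exact: cint_Re.
- by under eq_fun do rewrite Im_add; apply: int01D; exact: cint_Im.
Qed.

Lemma cintegralD f g : cint f -> cint g ->
  cintegral (fun z => f z + g z) = cintegral f + cintegral g.
Proof.
move=> cf cg; rewrite /cintegral; apply/eqP; rewrite eq_complex /=.
under eq_Rintegral do rewrite Re_add.
under [X in _ && (X == _)]eq_Rintegral do rewrite Im_add.
rewrite !RintegralD ?eqxx //; first [exact: mI01|exact: cint_Re|exact: cint_Im].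
Qed.

Lemma cintegralZ (c : R[i]) f : cint f ->
  cintegral (fun z => c * f z) = c * cintegral f.
Proof.
move=> cf; rewrite /cintegral; apply/eqP; rewrite eq_complex.
have RZ (r : R) : \int[mu]_(t in I01) (r * complex.Re (f (circ t))) =
    r * \int[mu]_(t in I01) complex.Re (f (circ t)).
  exact: (@RintegralZl _ _ R mu I01 _ r mI01 (cint_Re cf)).
have IZ (r : R) : \int[mu]_(t in I01) (r * complex.Im (f (circ t))) =
    r * \int[mu]_(t in I01) complex.Im (f (circ t)).
  exact: (@RintegralZl _ _ R mu I01 _ r mI01 (cint_Im cf)).
have iRZ (r : R) := int01Z r (cint_Re cf).
have iIZ (r : R) := int01Z r (cint_Im cf).
rewrite Re_mul Im_mul /=.
under eq_Rintegral do rewrite Re_mul.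
under [X in _ && (X == _)]eq_Rintegral do rewrite Im_mul.
rewrite RintegralB ?RintegralD ?RZ ?IZ ?eqxx //; first [exact: mI01|exact: iRZ|exact: iIZ].
Qed.

(** Multiplying by the unimodular [w] that makes the integral nonnegative reduces
    the claim to real parts. *)
Lemma nc_cintegral_le f : cint f -> ((nc (cintegral f))%:E <= L1norm f)%E.
Proof.
move=> cf; set J := cintegral f.
have [J0|J0] := eqVneq (nc J) 0.
  by rewrite J0; apply: integral_ge0 => t _; rewrite lee_fin nc_ge0.
have Jp : 0 < nc J by rewrite lt_neqAle eq_sym J0 nc_ge0.
pose w : R[i] := J^*%C * ((nc J)^-1)%:C.
have w1 : nc w = 1.
  by rewrite /w ncM nc_conj nc_real ger0_norm ?invr_ge0 ?nc_ge0 // divff.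
have wJ : w * J = (nc J)%:C.
  rewrite /w mulrAC [_ * J]mulrC mul_conj -rmorphM /=; congr (_%:C).
  by rewrite expr2 mulfK.
have -> : nc J = complex.Re (w * J) by rewrite wJ.
have cwf := cintZ w cf.
rewrite /J -cintegralZ // /= /Rintegral fineK; last exact: integrable_fin_num (cint_Re cwf).
apply: le_trans (lee_abs _) _.
apply: le_trans (le_abse_integral _ mI01 _) _.
  by apply: measurable_int (cint_Re cwf).
apply: ge0_le_integral_nomeas => t _ //=; rewrite lee_fin.
by apply: le_trans (nc_Re _) _; rewrite ncM w1 mul1r.
Qed.

Lemma L1norm_ge0 f : (0 <= L1norm f)%E.
Proof. by apply: integral_ge0 => t _; rewrite lee_fin nc_ge0. Qed.

Lemma cintM_circle f g : cint f -> cmeas g -> (forall z, circle z -> nc (g z) <= 1) ->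
  cint (fun z => g z * f z).
Proof.
move=> [mf Lf] mg g1; split; first exact: cmeasM.
apply: le_lt_trans Lf; apply: ge0_le_integral_nomeas => t _; first by rewrite lee_fin nc_ge0.
by rewrite lee_fin ncM ler_piMl ?nc_ge0 // g1 //; exact: circ_circle.
Qed.

Lemma cint_bounded f (c : R) : cmeas f -> (forall z, circle z -> nc (f z) <= c) -> cint f.
Proof.
move=> mf fc; split=> //; apply: (@le_lt_trans _ _ (\int[mu]_(t in (I01 : set R)) c%:E)%E).
  apply: ge0_le_integral_nomeas => t _; rewrite lee_fin ?nc_ge0 //.
  by apply: fc; exact: circ_circle.
by rewrite integral01_cst ltry.
Qed.

Lemma cint0 : cint (fun=> 0).
Proof.
by apply: (@cint_bounded _ 0); [exact: cmeas_cst|move=> z _; rewrite nc0].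
Qed.

Lemma cint_sum (I : Type) (s : seq I) (F : I -> R[i] -> R[i]) :
  (forall i, cint (F i)) -> cint (fun z => \sum_(i <- s) F i z).
Proof.
move=> cF; elim: s => [|i s ih].
  by under eq_fun do rewrite big_nil; exact: cint0.
by under eq_fun do rewrite big_cons; exact: cintD.
Qed.

Lemma cintegral_sum (I : Type) (s : seq I) (F : I -> R[i] -> R[i]) :
  (forall i, cint (F i)) ->
  cintegral (fun z => \sum_(i <- s) F i z) = \sum_(i <- s) cintegral (F i).
Proof.
move=> cF; elim: s => [|i s ih].
  under eq_fun do rewrite big_nil; rewrite big_nil.
  have := cintegralZ 0 cint0; rewrite [RHS]mul0r => {2}<-; congr cintegral.
  by apply/funext => z; rewrite mul0r.
under eq_fun do rewrite big_cons; rewrite big_cons -ih cintegralD //.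
exact: cint_sum.
Qed.

Lemma eq_cintegral f g : (forall z, circle z -> f z = g z) -> cintegral f = cintegral g.
Proof.
move=> fg; rewrite /cintegral; congr (_ +i* _); apply: eq_Rintegral => t _.
  by rewrite fg //; exact: circ_circle.
by rewrite fg //; exact: circ_circle.
Qed.

Lemma ReX_circ (k : int) (t : R) : complex.Re (circ t ^ k) = cos (2 * pi * k%:~R * t).
Proof.
rewrite circX /circ /=; congr cos; rewrite -mulrzr; ring.
Qed.

Lemma ImX_circ (k : int) (t : R) : complex.Im (circ t ^ k) = sin (2 * pi * k%:~R * t).
Proof.
rewrite circX /circ /=; congr sin; rewrite -mulrzr; ring.
Qed.

Lemma continuousM_cst (a : R) : continuous (fun t : R => a * t).
Proof. by move=> t; apply: cvgM; [exact: cvg_cst|exact: cvg_id]. Qed.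

Lemma cmeas_exp (k : int) : cmeas (fun z => z ^ k).
Proof.
split.
  under eq_fun do rewrite ReX_circ.
  apply: continuous_measurable_fun => t.
  apply: (@continuous_comp _ _ _ (fun t : R => 2 * pi * k%:~R * t) cos).
    exact: continuousM_cst.
  exact: continuous_cos.
under eq_fun do rewrite ImX_circ.
apply: continuous_measurable_fun => t.
apply: (@continuous_comp _ _ _ (fun t : R => 2 * pi * k%:~R * t) sin).
  exact: continuousM_cst.
exact: continuous_sin.
Qed.

Lemma cint_exp (k : int) : cint (fun z => z ^ k).
Proof.
apply: (@cint_bounded _ 1); first exact: cmeas_exp.
by move=> z cz; rewrite nc_circle //; exact: circleX.
Qed.

Lemma integral_deriv (F f : R -> R) : continuous f ->
  (forall t : R, is_derive t (1 : R) F (f t)) ->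
  \int[mu]_(t in I01) f t = F 1 - F 0.
Proof.
move=> cf dF; rewrite /Rintegral (@continuous_FTC2 _ _ F) //.
- exact: continuous_subspaceT.
- have cF t : F x @[x --> t] --> F t.
    have := dF t => dt.
    by apply: differentiable_continuous; apply/derivable1_diffP; exact: ex_derive.
  split=> [t _| |]; first by have := dF t => dt; exact: ex_derive.
    exact: cvg_at_right_filter.
  exact: cvg_at_left_filter.
- by move=> t _; rewrite derive1E; have := dF t => dt; exact: derive_val.
Qed.

Lemma cintegral_exp (k : int) : cintegral (fun z => z ^ k) = (k == 0)%:R :> R[i].
Proof.
rewrite /cintegral.
under eq_Rintegral do rewrite ReX_circ.
under [X in _ +i* X]eq_Rintegral do rewrite ImX_circ.
have [->|k0] := eqVneq k 0.
  rewrite (@eq_Rintegral _ _ _ _ _ (cst 1)); last by move=> t _; rewrite mulr0 mul0r cos0.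
  rewrite (@eq_Rintegral _ _ _ _ _ (cst 0) (fun t => sin _)); last first.
    by move=> t _; rewrite mulr0 mul0r sin0.
  by rewrite !(Rintegral_cst _ mI01) mul0r mul1r; congr (_ +i* _); exact: (congr1 fine mu01).
set a : R := 2 * pi * k%:~R.
have a0 : a != 0 by rewrite !mulf_neq0 // ?intr_eq0 // gt_eqF // pi_gt0.
have da (t : R) : is_derive t (1 : R) ( *%R a) a.
  have h := is_deriveZ a (is_derive_id t (1 : R)).
  by apply: is_derive_eq h _; rewrite /GRing.scale /= mulr1.
have circ1 : circ (1 : R) = 1 by rewrite /circ mulr1 mulr_natl cos2pi sin2pi.
have exp1 : (1 : R[i]) ^ k = 1 by exact: exp1rz.
have cC : continuous (fun t : R => cos (a * t)).
  move=> t; apply: (@continuous_comp _ _ _ (fun t : R => a * t) cos).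
    exact: continuousM_cst.
  exact: continuous_cos.
have cS : continuous (fun t : R => sin (a * t)).
  move=> t; apply: (@continuous_comp _ _ _ (fun t : R => a * t) sin).
    exact: continuousM_cst.
  exact: continuous_sin.
have dS (t : R) : is_derive t (1 : R) (fun t : R => a^-1 * sin (a * t)) (cos (a * t)).
  have h := is_deriveZ a^-1 (is_derive1_comp (is_derive_sin (a * t)) (da t)).
  by apply: is_derive_eq h _; rewrite /GRing.scale /= mulrCA mulVf // mulr1.
have dC (t : R) : is_derive t (1 : R) (fun t : R => - a^-1 * cos (a * t)) (sin (a * t)).
  have h := is_deriveZ (- a^-1) (is_derive1_comp (is_derive_cos (a * t)) (da t)).
  apply: is_derive_eq h _; rewrite /GRing.scale /= !(mulNr, mulrN) opprK.
  by rewrite mulrCA mulVf // mulr1.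
rewrite (integral_deriv cC dS) (integral_deriv cS dC).
have s1 : sin (a * 1) = 0 by rewrite -ImX_circ circ1 exp1.
have c1 : cos (a * 1) = 1 by rewrite -ReX_circ circ1 exp1.
by rewrite s1 c1 !mulr0 sin0 cos0 !mulr0 !subrr.
Qed.

End CircleIntegral.

(** * Strong measurability and norms of vector-valued functions *)

Section Convergence.
Context {R : realType}.

Lemma cvge0P (u : nat -> \bar R) : (forall n, (0 <= u n)%E) ->
  (u @ \oo --> 0%E) <->
  (forall e : R, 0 < e -> exists n0, forall n, (n0 <= n)%N -> (u n < e%:E)%E).
Proof.
move=> u0; split.
  move=> /fine_cvgP[[n1 _ h1] /cvgrPdist_lt h2] e e0.
  have [n2 _ {}h2] := h2 e e0; exists (maxn n1 n2) => n nn.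
  have un : u n \is a fin_num by apply: h1; rewrite /= (leq_trans _ nn) // leq_maxl.
  have /= := h2 n (leq_trans (leq_maxr _ _) nn).
  by rewrite sub0r normrN ger0_norm ?fine_ge0 // -lte_fin fineK.
move=> h; apply/fine_cvgP; split.
  have [n0 h0] := h 1 ltr01; exists n0 => // n /= /h0 un.
  by rewrite ge0_fin_numE // (lt_trans un) // ltry.
apply/cvgrPdist_lt => e e0; have [n0 h0] := h e e0; exists n0 => // n /= /h0 un.
have uf : u n \is a fin_num by rewrite ge0_fin_numE // (lt_trans un) // ltry.
by rewrite sub0r normrN ger0_norm ?fine_ge0 // -lte_fin fineK.
Qed.

End Convergence.

Section Measurability.
Context {R : realType} {V : lmodType R[i]}.
Implicit Types (nu : V -> \bar R) (f : R[i] -> V) (p : R).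

(** A real-linear functional that is dominated by [nu] turns approximation by
    simple functions into pointwise convergence. *)
Lemma strongly_measurable_fun nu f (e : V -> R) :
  strongly_measurable nu f -> (forall v w, e (v - w) = e v - e w) ->
  (forall v, (`|e v|%:E <= nu v)%E) ->
  measurable_fun (setT : set R) (fun t => e (f (circ t))).
Proof.
move=> [_ [g sg gf]] eB eN.
apply: (@measurable_fun_cvg _ _ R setT (fun n t => e (g n (circ t)))) => [n|t _].
  have [fin _ mg] := sg n.
  move=> _ Y mY; rewrite setTI.
  have -> : (fun t => e (g n (circ t))) @^-1` Y =
      \bigcup_(v in [set v | (g n @` circle) v /\ Y (e v)]) [set t | g n (circ t) = v].
    apply/seteqP; split=> [t Yt|t [v [_ Yv] /= ->]] //=.
    by exists (g n (circ t)) => //; split => //; exists (circ t) => //; exact: circ_circle.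
  apply: fin_bigcup_measurable => [|v _]; last exact: mg.
  by apply: sub_finite_set fin => v [].
have nu0 v : (0 <= nu v)%E by apply: le_trans (eN v); rewrite lee_fin.
have := gf _ (circ_circle t); rewrite cvge0P // => h.
apply/cvgrPdist_lt => d d0; have [n0 hn0] := h d d0; exists n0 => // n /= /hn0 hn.
by rewrite distrC -eB -lte_fin; apply: le_lt_trans hn; exact: eN.
Qed.

(** Rounding the two coordinates of a point of the plane to multiples of
    [1 / (n + 1)] turns a function that is continuous near the circle into
    simple functions that approximate it. *)
Definition round n (z : R[i]) : R[i] :=
  ((Num.floor (n.+1%:R * complex.Re z))%:~R / n.+1%:R)
  +i* ((Num.floor (n.+1%:R * complex.Im z))%:~R / n.+1%:R).

Lemma floor_dist n (x : R) : `|(Num.floor (n.+1%:R * x))%:~R / n.+1%:R - x| <= n.+1%:R^-1.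
Proof.
have n0 : 0 < n.+1%:R :> R by rewrite ltr0n.
have /andP[h1 h2] := floor_itv (n.+1%:R * x).
rewrite intrD in h2; set m := (Num.floor _)%:~R in h1 h2 *.
have -> : m / n.+1%:R - x = (m - n.+1%:R * x) / n.+1%:R by field; rewrite gt_eqF.
rewrite normrM [ `|_^-1|]ger0_norm ?invr_ge0 ?(ltW n0) // ler_piMl ?invr_ge0 ?(ltW n0) //.
rewrite ler_norml; move: h1 h2; rewrite (_ : 1%:~R = 1) //; lra.
Qed.

Lemma round_dist n z : nc (round n z - z) <= 2 / n.+1%:R.
Proof.
apply: le_trans (nc_leReIm _) _; rewrite mulrDl mul1r.
by case: z => a b /=; apply: lerD; exact: floor_dist.
Qed.

Lemma floor_bounded n (x : R) : `|x| <= 1 ->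
  exists k : 'I_(2 * n.+1).+1, Num.floor (n.+1%:R * x) = k%:Z - n.+1%:Z.
Proof.
move=> x1; set m := Num.floor _.
have n0 : 0 < n.+1%:R :> R by rewrite ltr0n.
have /andP[h1 h2] := floor_itv (n.+1%:R * x); rewrite -/m in h1 h2.
move: x1; rewrite ler_norml => /andP[xl xu].
have ml : - n.+1%:Z <= m.
  rewrite /m floor_ge_int_tmp rmorphN /= -mulrN1 -[_%:~R]/(n.+1%:R : R).
  by rewrite ler_pM2l.
have mu' : m <= n.+1%:Z.
  rewrite -(ler_int R); apply: le_trans h1 _; rewrite -[_%:~R]/(n.+1%:R : R).
  by rewrite -[leRHS]mulr1 ler_pM2l.
have kl : (absz (m + n.+1%:Z)%R < (2 * n.+1).+1)%N by lia.
by exists (Ordinal kl) => /=; lia.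
Qed.

Lemma measurable_floor_fiber n (h : R -> R) (a : int) : measurable_fun setT h ->
  measurable [set t : R | Num.floor (n.+1%:R * h t) = a].
Proof.
move=> mh; have -> : [set t : R | Num.floor (n.+1%:R * h t) = a] =
    setT `&` (fun t => n.+1%:R * h t) @^-1` `[a%:~R, (a + 1)%:~R[%classic.
  rewrite setTI; apply/seteqP; split=> t /=; rewrite in_itv /=.
    by move=> <-; exact: floor_itv.
  by rewrite -floor_eq => /eqP.
apply: (measurable_funM (measurable_cst _) mh) => //.
Qed.

(** The approximating simple functions are [f] composed with [round n]; the
    values of [f] off the circle matter, because [round n] leaves it. *)
Lemma strongly_measurable_continuous nu f :
  (forall v, (0 <= nu v)%E) -> (forall z, (nu (f z) < +oo)%E) ->
  (forall z, circle z -> forall e : R, 0 < e -> exists2 d : R, 0 < d &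
     forall w, nc (w - z) < d -> (nu (f w - f z)%R < e%:E)%E) ->
  strongly_measurable nu f.
Proof.
move=> nu0 fin cf; split=> //.
exists (fun n z => f (round n z)) => [n|z cz]; last first.
  apply/cvge0P => // e e0; have [d d0 hd] := cf z cz e e0.
  have d20 : 0 < 2 / d by rewrite divr_gt0.
  exists (Num.truncn (2 / d)) => n hn; apply: hd; apply: le_lt_trans (round_dist _ _) _.
  rewrite ltr_pdivrMr ?ltr0n // -ltr_pdivrMl // mulrC.
  apply: lt_le_trans (truncnS_gt _) _; by rewrite ler_nat ltnS.
(* The coordinates lie in [-1, 1], so their floors after scaling by n + 1 take
   at most 2 (n + 1) + 1 values. *)
pose N := (2 * n.+1).+1.
pose F (k : 'I_N * 'I_N) := f (((k.1%:Z - n.+1%:Z)%:~R / n.+1%:R)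
   +i* ((k.2%:Z - n.+1%:Z)%:~R / n.+1%:R)).
split.
- apply: (@sub_finite_set _ _ (F @` setT)); last exact/finite_image/finite_finset.
  move=> _ [z cz <-].
  have [k hk] : exists k : 'I_N, Num.floor (n.+1%:R * complex.Re z) = k%:Z - n.+1%:Z.
    by apply: floor_bounded; apply: le_trans (nc_Re _) _; rewrite nc_circle.
  have [l hl] : exists k : 'I_N, Num.floor (n.+1%:R * complex.Im z) = k%:Z - n.+1%:Z.
    by apply: floor_bounded; apply: le_trans (nc_Im _) _; rewrite nc_circle.
  by exists (k, l) => //; rewrite /F /round hk hl.
- by move=> z _; exact: fin.
- move=> v; have -> : [set t : R | f (round n (circ t)) = v] =
    \bigcup_(k in [set k | F k = v])
      ([set t | Num.floor (n.+1%:R * complex.Re (circ t)) = k.1%:Z - n.+1%:Z] `&`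
       [set t | Num.floor (n.+1%:R * complex.Im (circ t)) = k.2%:Z - n.+1%:Z]).
    apply/seteqP; split=> [t ft|t [[k l] /= Fv [hk hl]]]; last by rewrite -Fv /F /round hk hl.
    have ct := circ_circle t.
    have [k hk] : exists k : 'I_N, Num.floor (n.+1%:R * complex.Re (circ t)) = k%:Z - n.+1%:Z.
      by apply: floor_bounded; apply: le_trans (nc_Re _) _; rewrite nc_circle.
    have [l hl] : exists k : 'I_N, Num.floor (n.+1%:R * complex.Im (circ t)) = k%:Z - n.+1%:Z.
      by apply: floor_bounded; apply: le_trans (nc_Im _) _; rewrite nc_circle.
    by exists (k, l) => //=; rewrite /F -ft /round hk hl.
  apply: fin_bigcup_measurable => [|k _]; first exact: finite_finset.
  have [mR mI] := @cmeas_exp R 1.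
  apply: measurableI.
    exact: (@measurable_floor_fiber n (fun t => complex.Re (circ t))).
  exact: (@measurable_floor_fiber n (fun t => complex.Im (circ t))).
Qed.

Lemma Lpnorm_le nu p f (c : R) : 0 < p -> 0 <= c -> (forall v, (0 <= nu v)%E) ->
  (forall z, circle z -> (nu (f z) <= c%:E)%E) -> (Lpnorm nu p f <= c%:E)%E.
Proof.
move=> p0 c0 nu0 hf.
have -> : c%:E = ((c `^ p)%:E `^ p^-1)%E.
  by rewrite poweR_EFin -powRrM divff ?gt_eqF // powRr1.
apply: gt0_ler_poweR; rewrite ?invr_ge0 ?(ltW p0) //.
- by rewrite in_itv /= leey andbT integral_ge0 // => t _; exact: poweR_ge0.
- by rewrite in_itv /= leey andbT lee_fin powR_ge0.
rewrite -(integral01_cst (c `^ p)); apply: ge0_le_integral_nomeas => t _.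
  exact: poweR_ge0.
rewrite -poweR_EFin; apply: gt0_ler_poweR; rewrite ?(ltW p0) //.
- by rewrite in_itv /= nu0 leey.
- by rewrite in_itv /= leey andbT lee_fin c0.
- by apply: hf; exact: circ_circle.
Qed.

Lemma Lpnorm_ge nu p f (c : R) : 0 < p -> 0 <= c -> (forall v, (0 <= nu v)%E) ->
  (forall z, circle z -> (c%:E <= nu (f z))%E) -> (c%:E <= Lpnorm nu p f)%E.
Proof.
move=> p0 c0 nu0 hf.
have -> : c%:E = ((c `^ p)%:E `^ p^-1)%E.
  by rewrite poweR_EFin -powRrM divff ?gt_eqF // powRr1.
apply: gt0_ler_poweR; rewrite ?invr_ge0 ?(ltW p0) //.
- by rewrite in_itv /= leey andbT lee_fin powR_ge0.
- by rewrite in_itv /= leey andbT integral_ge0 // => t _; exact: poweR_ge0.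
rewrite -(integral01_cst (c `^ p)); apply: ge0_le_integral_nomeas => t _.
  by rewrite lee_fin powR_ge0.
rewrite -poweR_EFin; apply: gt0_ler_poweR; rewrite ?(ltW p0) //.
- by rewrite in_itv /= leey andbT lee_fin c0.
- by rewrite in_itv /= nu0 leey.
- by apply: hf; exact: circ_circle.
Qed.

Lemma Lpnorm1E nu f : (forall v, (0 <= nu v)%E) ->
  Lpnorm nu 1 f = (\int[mu]_(t in I01) nu (f (circ t)))%E.
Proof.
move=> nu0; rewrite /Lpnorm invr1 poweRe1.
  by apply: eq_integral => t _; rewrite poweRe1.
by apply: integral_ge0 => t _; exact: poweR_ge0.
Qed.

Lemma trigpoly_LpL nu p L f (c : R) : 0 < p -> (forall v, (0 <= nu v)%E) -> nu 0 = 0%E ->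
  strongly_measurable nu f -> (forall z, circle z -> (nu (f z) <= c%:E)%E) ->
  trigpoly nu L f -> LpL nu p L f.
Proof.
move=> p0 nu_ge0 nu0 sf fc tf; have c0 : 0 <= c.
  by rewrite -lee_fin; apply: le_trans (fc 1 circle1); exact: nu_ge0.
split; first by split=> //; apply: le_lt_trans (Lpnorm_le p0 c0 nu_ge0 fc) (ltry _).
move=> e e0; exists f => //; rewrite subrr.
apply: le_lt_trans (@Lpnorm_le nu p 0 0 p0 (lexx _) nu_ge0 _) _.
  by move=> z _; rewrite nu0.
by rewrite lte_fin.
Qed.

End Measurability.

(** * Trigonometric polynomials *)

Section TrigSums.
Context {R : realType}.

Lemma cvg_exp (k : int) (z : R[i]) : z != 0 ->
  (w ^ k : R[i]^o) @[w --> (z : R[i]^o)] --> (z ^ k : R[i]^o).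
Proof.
move=> z0; have FF := nbhs_filter (z : R[i]^o).
have cX n : (w ^+ n : R[i]^o) @[w --> (z : R[i]^o)] --> (z ^+ n : R[i]^o).
  elim: n => [|n ih]; first by apply: (cvg_cst (1 : R[i]^o)); exact: FF.
  rewrite exprS (_ : (fun w => w ^+ n.+1) = (fun w : R[i] => w * w ^+ n)).
    by apply: (@cvgM R[i] R[i]^o _ FF) ih; exact: cvg_id.
  by apply/funext => w; rewrite exprS.
case: k => n; first exact: cX.
by rewrite /exprz; apply: (@cvgV R[i] R[i]^o _ FF); [rewrite expf_neq0|exact: cX].
Qed.

Lemma exp_near (k : int) (z : R[i]) (e : R) : circle z -> 0 < e ->
  exists2 d : R, 0 < d & forall w, nc (w - z) < d -> nc (w ^ k - z ^ k) < e.
Proof.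
move=> cz e0; have eC : 0 < e%:C :> R[i] by rewrite ltcR.
have /(@cvgrPdist_lt _ R[i]^o)/(_ _ eC) := @cvg_exp k z (circle_neq0 cz).
move=> /nbhs_ballP[d /= d0 hd].
move: d0; rewrite ltcE /= => /andP[/eqP dI d0].
have dE : d = (complex.Re d)%:C by case: (d) dI => a b /= ->.
exists (complex.Re d) => // w wz.
have := hd w; rewrite /ball /= norm_nc dE ltcR ncB => /(_ wz).
by rewrite norm_nc ltcR ncB.
Qed.

Section General.
Context {V : lmodType R[i]}.
Implicit Types (nu : V -> \bar R) (s : seq (V * int)) (L : set int).

Definition trigsum s : R[i] -> V := fun z => \sum_(l <- s) z ^ l.2 *: l.1.

Lemma fct_sum (U : Type) (I : Type) (r : seq I) (F : I -> U -> V) (z : U) :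
  (\sum_(i <- r) F i) z = \sum_(i <- r) F i z.
Proof. by elim: r => [|i r ih]; rewrite ?big_nil // !big_cons -ih. Qed.

Lemma exp_near_seq s (z : R[i]) (e : R) : circle z -> 0 < e ->
  exists2 d : R, 0 < d & forall w, nc (w - z) < d ->
    forall l, l \in s -> nc (w ^ l.2 - z ^ l.2) < e.
Proof.
move=> cz e0; elim: s => [|l s [d d0 hd]]; first by exists 1.
have [d' d'0 hd'] := exp_near l.2 cz e0.
exists (Num.min d d'); first by rewrite lt_min d0.
move=> w; rewrite lt_min => /andP[wd wd'] l'; rewrite inE => /orP[/eqP ->|]; first exact: hd'.
exact: hd.
Qed.

Lemma trigpoly_trigsum nu L s :
  (forall k, (nu (\sum_(l <- s) (l.2 == k)%:R *: l.1)%R < +oo)%E) ->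
  (forall l, l \in s -> L l.2) -> trigpoly nu L (trigsum s).
Proof.
move=> fin sL.
have [F FE] : exists F : {fset int}, forall k, (k \in F) = (k \in [seq l.2 | l <- s]).
  by exists (seq_fset tt [seq l.2 | l <- s]) => k; rewrite seq_fsetE.
exists F, (fun k => \sum_(l <- s) (l.2 == k)%:R *: l.1); split=> //.
  by move=> k /=; rewrite FE => /mapP[l ls ->]; exact: sL.
apply/funext => z; rewrite fct_sum /tensor /trigsum.
under [RHS]eq_bigr do rewrite scaler_sumr.
rewrite exchange_big /= big_seq [RHS]big_seq; apply: eq_bigr => l ls.
have lF : l.2 \in F by rewrite FE; apply/mapP; exists l.
rewrite (big_fsetD1 l.2) //= eqxx scale1r [X in _ + X]big1_fset ?addr0 // => k.
by rewrite !inE => /andP[/negbTE kl _] _; rewrite eq_sym kl scale0r scaler0.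
Qed.

(** The bound on [nu] stands in for the triangle inequality, which is required for
    the finitely many vectors of [s] only. *)
Lemma trigsum_LpL nu p L s (B : V -> R) : 0 < p -> (forall v, (0 <= nu v)%E) ->
  nu 0 = 0%E -> (forall v, 0 <= B v) ->
  (forall c : int -> R[i],
     (nu (\sum_(l <- s) c l.2 *: l.1)%R <= (\sum_(l <- s) nc (c l.2) * B l.1)%R%:E)%E) ->
  (forall l, l \in s -> L l.2) -> LpL nu p L (trigsum s).
Proof.
move=> p0 nu_ge0 nu0 B0 nuB sL.
have BS : 0 <= \sum_(l <- s) B l.1 by apply: sumr_ge0.
apply: (@trigpoly_LpL _ _ _ _ _ _ (\sum_(l <- s) B l.1)) => //.
- apply: strongly_measurable_continuous => // [z|z cz e e0].
    by apply: le_lt_trans (nuB (fun k => z ^ k)) (ltry _).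
  have e'0 : 0 < e / (1 + \sum_(l <- s) B l.1) by rewrite divr_gt0 // ltr_wpDr.
  have [d d0 hd] := exp_near_seq s cz e'0; exists d => // w wz.
  have -> : trigsum s w - trigsum s z = \sum_(l <- s) (w ^ l.2 - z ^ l.2) *: l.1.
    by rewrite /trigsum -sumrB; apply: eq_bigr => l _; rewrite scalerBl.
  apply: le_lt_trans (nuB (fun k => w ^ k - z ^ k)) _; rewrite lte_fin.
  apply: (@le_lt_trans _ _ (e / (1 + \sum_(l <- s) B l.1) * \sum_(l <- s) B l.1)).
    rewrite mulr_sumr big_seq [leRHS]big_seq; apply: ler_sum => l ls.
    by apply: ler_wpM2r => //; apply: ltW; exact: hd.
  by rewrite mulrAC ltr_pdivrMr ?ltr_wpDr // ltr_pM2l // ltrDr.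
- move=> z cz; apply: le_trans (nuB (fun k => z ^ k)) _; rewrite lee_fin.
  by apply: ler_sum => l _; rewrite nc_circle ?mul1r //; exact: circleX.
- apply: trigpoly_trigsum => // k.
  by apply: le_lt_trans (nuB (fun k' => (k' == k)%:R)) (ltry _).
Qed.

End General.

Lemma cnorm_ge0 (z : R[i]) : (0 <= cnorm z)%E.
Proof. by rewrite lee_fin nc_ge0. Qed.

Lemma cnorm0 : cnorm (0 : R[i]) = 0%E.
Proof. by rewrite /cnorm nc0. Qed.

Lemma trigsum_LpL_cnorm L (s : seq (R[i] * int)) : (forall l, l \in s -> L l.2) ->
  LpL cnorm 1 L (trigsum s).
Proof.
apply: (@trigsum_LpL _ _ _ _ _ (fun x => nc x)) => //.
- exact: cnorm_ge0.
- exact: cnorm0.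
- by move=> v; exact: nc_ge0.
- move=> c; rewrite lee_fin; apply: le_trans (nc_sum _ _ _) _.
  by apply: ler_sum => l _; rewrite ncM.
Qed.

Lemma trigsum_CL L (s : seq (R[i] * int)) : (forall l, l \in s -> L l.2) ->
  CL L (trigsum s).
Proof.
move=> sL; split.
  apply: continuous_in_subspaceT => z; rewrite inE => cz.
  apply: (@cvg_big R[i]^o _ +%R 0 xpredT add_continuous).
    exact: (nbhs_filter (z : R[i]^o)).
  move=> l _; apply: (@cvgMr_tmp R[i] R[i]^o _ (nbhs_filter (z : R[i]^o))).
  by apply: cvg_exp; exact: circle_neq0.
move=> e e0; exists (trigsum s); last first.
  apply: le_lt_trans (_ : _ <= 0)%E _; last by rewrite lte_fin.
  by apply: ge_ereal_sup => _ [z _ <-]; rewrite subrr /= cnorm0.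
by apply: trigpoly_trigsum => // k; exact: ltry.
Qed.

Lemma trigsum_schatten p L N (s : seq ((nat -> nat -> R[i]) * int)) : 0 < p ->
  (forall l, l \in s -> supported N l.1) ->
  (forall l, l \in s -> L l.2) -> LpL (schatten p) p L (trigsum s).
Proof.
move=> p0 supp sL; have := (@trigsum_LpL _ (schatten p) p L s
  (fun x => N%:R `^ p^-1 * \sum_(i < N) \sum_(j < N) nc (x i j))); apply => //.
- by move=> v; exact: schatten_ge0.
- exact: schatten0.
- move=> x; apply: mulr_ge0; first exact: powR_ge0.
  by apply: sumr_ge0 => i _; apply: sumr_ge0 => j _; exact: nc_ge0.
- move=> c; have xE i j : (\sum_(l <- s) c l.2 *: l.1) i j = \sum_(l <- s) c l.2 * l.1 i j.
    by rewrite !fct_sum.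
  apply: le_trans (@schatten_le_entries _ p N _ p0 _) _.
    move=> i j ij; rewrite xE big_seq big1 // => l ls.
    by rewrite supp // mulr0.
  rewrite lee_fin; under [leRHS]eq_bigr do rewrite mulrCA.
  rewrite -mulr_sumr; apply: ler_wpM2l; first exact: powR_ge0.
  under [leRHS]eq_bigr do rewrite mulr_sumr.
  rewrite [leRHS]exchange_big; apply: ler_sum => i _ /=.
  under [leRHS]eq_bigr do rewrite mulr_sumr.
  rewrite [leRHS]exchange_big; apply: ler_sum => j _ /=.
  rewrite xE; apply: le_trans (nc_sum _ _ _) _.

  by apply: ler_sum => l _; rewrite ncM.
Qed.

End TrigSums.

(** * Fourier coefficients and finite rank operators *)

Section Coefficients.
Context {R : realType}.
Implicit Types (f g : R[i] -> R[i]) (L : set int) (k m : int).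

Definition coef f k : R[i] := cintegral (fun z => z ^ (- k) * f z).

Definition zexp k : R[i] -> R[i] := fun z => z ^ k.

Lemma cint_coef f k : cint f -> cint (fun z => z ^ (- k) * f z).
Proof.
move=> cf; apply: cintM_circle => //; first exact: cmeas_exp.
by move=> z cz; rewrite nc_circle //; exact: circleX.
Qed.

Lemma coefD f g k : cint f -> cint g -> coef (fun z => f z + g z) k = coef f k + coef g k.
Proof.
move=> cf cg; rewrite /coef -cintegralD; [|exact: cint_coef..].
by congr cintegral; apply/funext => z; rewrite mulrDr.
Qed.

Lemma coefZ (c : R[i]) f k : cint f -> coef (fun z => c * f z) k = c * coef f k.
Proof.
move=> cf; rewrite /coef -cintegralZ; last exact: cint_coef.
by congr cintegral; apply/funext => z; rewrite mulrCA.
Qed.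

Lemma cintB f g : cint f -> cint g -> cint (fun z => f z - g z).
Proof.
move=> cf cg; have := cintD cf (cintZ (-1) cg); congr cint.
by apply/funext => z; rewrite mulN1r.
Qed.

Lemma coefB f g k : cint f -> cint g -> coef (fun z => f z - g z) k = coef f k - coef g k.
Proof.
move=> cf cg; have := coefD k cf (cintZ (-1) cg); rewrite coefZ // mulN1r => <-.
by congr coef; apply/funext => z; rewrite mulN1r.
Qed.

Lemma coef_sum (I : Type) (s : seq I) (F : I -> R[i] -> R[i]) k :
  (forall i, cint (F i)) -> coef (fun z => \sum_(i <- s) F i z) k = \sum_(i <- s) coef (F i) k.
Proof.
move=> cF; rewrite /coef -cintegral_sum => [|i]; last exact: cint_coef.
by congr cintegral; apply/funext => z; rewrite mulr_sumr.
Qed.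

Lemma nc_coef_le f k : cint f -> ((nc (coef f k))%:E <= L1norm f)%E.
Proof.
move=> cf; apply: le_trans (nc_cintegral_le (cint_coef k cf)) _.
apply: ge0_le_integral_nomeas => t _; first by rewrite lee_fin nc_ge0.
rewrite lee_fin ncM nc_circle ?mul1r //; apply: circleX; exact: circ_circle.
Qed.

Lemma coef_zexp k m : coef (zexp k) m = (k == m)%:R.
Proof.
rewrite /coef (@eq_cintegral _ _ (fun z => z ^ (k - m))).
  by rewrite cintegral_exp subr_eq0.
by move=> z cz; rewrite /zexp -expfzDr ?circle_neq0 // addrC.
Qed.

Lemma trigpoly_expand L f : trigpoly cnorm L f -> exists (F : {fset int}) (x : int -> R[i]),
  [set` F] `<=` L /\ forall z, f z = \sum_(k <- F) x k * z ^ k.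
Proof.
move=> [F [x [FL _ ->]]]; exists F, x; split=> // z.
rewrite fct_sum; apply: eq_bigr => k _; by rewrite /tensor /GRing.scale /= mulrC.
Qed.

Lemma trigpoly_cint L f : trigpoly cnorm L f -> cint f.
Proof.
move=> /trigpoly_expand[F [x [_ fE]]].
rewrite (_ : f = fun z => \sum_(k <- F) x k * z ^ k); last exact/funext.
by apply: cint_sum => k; apply: cintZ; exact: cint_exp.
Qed.

Lemma coef_trigpoly L f : trigpoly cnorm L f ->
  exists F : {fset int}, forall k, k \notin F -> coef f k = 0.
Proof.
move=> /trigpoly_expand[F [x [_ fE]]]; exists F => m mF.
rewrite (_ : f = fun z => \sum_(k <- F) x k * z ^ k); last exact/funext.
rewrite coef_sum; last by move=> k; apply: cintZ; exact: cint_exp.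
rewrite big_seq big1 // => k kF; rewrite coefZ; last exact: cint_exp.
rewrite (coef_zexp k) (_ : (k == m) = false) ?mulr0 //.
by apply/negP => /eqP km; move: mF; rewrite -km kF.
Qed.

(** What the proof uses of the spaces L^1_Lambda and C_Lambda. *)
Record circle_space L (X : set (R[i] -> R[i])) (N : (R[i] -> R[i]) -> \bar R) : Prop := {
  cs_cint : forall f, X f -> cint f;
  cs_norm : forall f, (L1norm f <= N f)%E;
  cs_dense : forall f, X f -> forall e : R, 0 < e ->
    exists2 P, trigpoly cnorm L P & (N (f - P)%R < e%:E)%E;
  cs_exp : forall k, L k -> X (zexp k);
  cs_exp_norm : forall k, (N (zexp k) <= 1)%E
}.

Lemma trigsum_exp k : trigsum [:: (1 : R[i], k)] = zexp k.
Proof.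
by apply/funext => z; rewrite /trigsum big_seq1 /GRing.scale /= mulr1.
Qed.

Lemma L1normE f : Lpnorm cnorm 1 f = L1norm f.
Proof. by rewrite Lpnorm1E //; exact: cnorm_ge0. Qed.

Lemma circle_space_L1 L : circle_space L (LpL cnorm 1 L) (Lpnorm cnorm 1).
Proof.
split.
- move=> f [[sf Lf] _]; rewrite L1normE in Lf; split=> //; split.
    apply: (strongly_measurable_fun (e := @complex.Re R) sf) => [v w|v].
      by case: v; case: w.
    by rewrite lee_fin nc_Re.
  apply: (strongly_measurable_fun (e := @complex.Im R) sf) => [v w|v].
    by case: v; case: w.
  by rewrite lee_fin nc_Im.
- by move=> f; rewrite L1normE.
- by move=> f [_ h] e e0; exact: h.
- move=> k Lk; rewrite -trigsum_exp; apply: trigsum_LpL_cnorm => l.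
  by rewrite inE => /eqP ->.
- move=> k; apply: Lpnorm_le => //; first exact: cnorm_ge0.
  by move=> z cz; rewrite lee_fin nc_circle //; exact: circleX.
Qed.

Lemma supnorm_le f (c : R) : (forall z, circle z -> nc (f z) <= c) -> (supnorm f <= c%:E)%E.
Proof. by move=> fc; apply: ge_ereal_sup => _ [z cz <-]; rewrite lee_fin fc. Qed.

Lemma supnorm_ge f z : circle z -> (cnorm (f z) <= supnorm f)%E.
Proof. by move=> cz; apply: ereal_sup_ubound; exists z. Qed.

Lemma L1norm_le_supnorm f : (L1norm f <= supnorm f)%E.
Proof.
have sup0 : (0 <= supnorm f)%E.
  by apply: le_trans (cnorm_ge0 (f 1)) _; apply: supnorm_ge; exact: circle1.
case E : (supnorm f) sup0 => [r| |] //; last by move=> _; rewrite leey.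
move=> r0; rewrite -(integral01_cst r); apply: ge0_le_integral_nomeas => t _.
  by rewrite lee_fin nc_ge0.
by rewrite -E; apply: supnorm_ge; exact: circ_circle.
Qed.

Lemma CL_cint L f : CL L f -> cint f.
Proof.
move=> [_ dense].
have ap (e : R) : 0 < e -> exists2 P, trigpoly cnorm L P &
    forall z, circle z -> nc (f z - P z) < e.
  move=> /dense[P tP Pe]; exists P => // z cz; rewrite -lte_fin.
  by apply: le_lt_trans Pe; exact: (supnorm_ge (f - P) cz).
have [P tP Pf] : {P : nat -> R[i] -> R[i] | forall n, trigpoly cnorm L (P n) &
    forall n z, circle z -> nc (f z - P n z) < n.+1%:R^-1}.
  have h n : {Q | trigpoly cnorm L Q & forall z, circle z -> nc (f z - Q z) < n.+1%:R^-1}.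
    by apply: cid2; apply: ap; rewrite invr_gt0 ltr0n.
  by exists (fun n => s2val (h n)) => n; case: (h n).
have lim (e : (R[i]) -> R) : (forall z w, e (z - w) = e z - e w) -> (forall z, `|e z| <= nc z) ->
    forall t : R, e (P n (circ t)) @[n --> \oo] --> e (f (circ t)).
  move=> eB eN t; apply/cvgrPdist_lt => d d0.
  exists (Num.truncn d^-1) => // n /= hn; rewrite -eB; apply: le_lt_trans (eN _) _.
  apply: lt_trans (Pf n _ (circ_circle t)) _.
  rewrite invf_plt ?posrE ?ltr0n //; apply: lt_le_trans (truncnS_gt _) _.
  by rewrite ler_nat ltnS.
have mf : cmeas f.
  split.
    apply: (@measurable_fun_cvg _ _ R setT (fun n t => complex.Re (P n (circ t)))) => [n|t _].
      by have [[]] := trigpoly_cint (tP n).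
    by apply: lim => [z w|z]; [case: z; case: w|exact: nc_Re].
  apply: (@measurable_fun_cvg _ _ R setT (fun n t => complex.Im (P n (circ t)))) => [n|t _].
    by have [[]] := trigpoly_cint (tP n).
  by apply: lim => [z w|z]; [case: z; case: w|exact: nc_Im].
have [F [x [_ PE]]] := trigpoly_expand (tP 0%N).
apply: (@cint_bounded _ _ (1 + \sum_(k <- F) nc (x k)) mf) => z cz.
rewrite -[f z](subrK (P 0%N z)); apply: le_trans (ncD _ _) _; apply: lerD.
  by have := Pf 0%N _ cz; rewrite invr1 => /ltW.
rewrite PE; apply: le_trans (nc_sum _ _ _) _; apply: ler_sum => k _.
by rewrite ncM (nc_circle (circleX k cz)) mulr1.
Qed.

Lemma circle_space_C L : circle_space L (CL L) supnorm.
Proof.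
split.
- exact: CL_cint.
- exact: L1norm_le_supnorm.
- by move=> f [_ h] e e0; exact: h.
- move=> k Lk; rewrite -trigsum_exp; apply: trigsum_CL => l.
  by rewrite inE => /eqP ->.
- move=> k; apply: supnorm_le => z cz.
  by rewrite nc_circle //; exact: circleX.
Qed.

Section Space.
Variables (L : set int) (X : set (R[i] -> R[i])) (N : (R[i] -> R[i]) -> \bar R).
Hypothesis XN : circle_space L X N.

Lemma nc_coef_leN f k : cint f -> ((nc (coef f k))%:E <= N f)%E.
Proof. by move=> cf; apply: le_trans (nc_coef_le k cf) (cs_norm XN f). Qed.

Lemma riemann_lebesgue f : X f -> forall e : R, 0 < e ->
  exists F : {fset int}, forall k, k \notin F -> nc (coef f k) < e.
Proof.
move=> Xf e e0; have [P tP Pe] := cs_dense XN Xf e0.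
have [F FP] := coef_trigpoly tP; exists F => k kF; rewrite -lte_fin.
have cP := trigpoly_cint tP; have cf := cs_cint XN Xf.
have -> : coef f k = coef (fun z => f z - P z) k by rewrite coefB // FP // subr0.
by apply: le_lt_trans Pe; apply: nc_coef_leN; exact: cintB.
Qed.

Lemma coef_null f g k : cint f -> cint g -> N (f - g) = 0%E -> coef f k = coef g k.
Proof.
move=> cf cg N0; apply/eqP; rewrite -subr_eq0 -coefB //; apply/eqP/nc_eq0.
have h := nc_coef_leN k (cintB cf cg).
apply/eqP; rewrite eq_le nc_ge0 andbT -lee_fin; apply: le_trans h _.
by rewrite -[(fun z => _)]/(f - g) N0.
Qed.

(** Adding a point outside the row space raises the rank, which is at most [n].
    With [gam m] the m-th Fourier coefficients of [n] functions, finitely many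
    coefficients determine all others on the span of these functions. *)
Lemma spanning_points n (gam : int -> 'rV[R[i]]_n) :
  exists (q : nat) (t : 'I_q -> int),
    forall m, (gam m <= \matrix_(i < q) gam (t i))%MS.
Proof.
suff H d : forall q (t : 'I_q -> int), (n - \rank (\matrix_(i < q) gam (t i)) <= d)%N ->
    exists (q : nat) (t : 'I_q -> int), forall m, (gam m <= \matrix_(i < q) gam (t i))%MS.
  exact: (H n 0%N (fun=> 0) (leq_subr _ _)).
elim: d => [|d ih] q t hd; set G := \matrix_(i < q) gam (t i) in hd.
  exists q, t => m; apply: submx_full.
  by rewrite /row_full eqn_leq rank_leq_col -subn_eq0 -leqn0.
have [h|] := pselect (forall m, (gam m <= G)%MS); first by exists q, t.
move=> /existsNP[m /negP hm].
pose t' (i : 'I_(1 + q)) := match fintype.split i with inl _ => m | inr j => t j end.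
apply: (ih (1 + q)%N t'); set G' := \matrix_(i < 1 + q) gam (t' i).
have GG' : (G <= G')%MS.
  apply/row_subP => i; rewrite rowK.
  have -> : gam (t i) = row (rshift 1 i) G'.
    by rewrite rowK /t' -[rshift 1 i]/(unsplit (inr 'I_1 i)) unsplitK.
  exact: row_sub.
have mG' : (gam m <= G')%MS.
  have -> : gam m = row (lshift q ord0) G' by rewrite rowK /t' -[lshift q ord0]/(unsplit (inl 'I_q (ord0 : 'I_1))) unsplitK.
  exact: row_sub.
have : (\rank G < \rank G')%N.
  apply: rank_ltmx; rewrite ltmxE GG' /=; apply: contra hm => hG'.
  exact: submx_trans mG' hG'.
have := rank_leq_col G'; lia.
Qed.

(** The coefficients of [T (z^m)] at finitely many points [t i] are bounded by
    [|K|], and its coefficient at [m] is a combination of these; the weights are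
    linear in the m-th coefficients of the generators of the range, which
    tend to 0 by the Riemann-Lebesgue lemma. *)
Lemma finite_rank_coef T (K : R) : operator X N T -> bounded_by X N T K -> finite_rank X N T ->
  forall e : R, 0 < e -> exists F : {fset int}, forall m, L m -> m \notin F ->
    nc (coef (T (zexp m)) m) < e.
Proof.
move=> [TX _] bT [n [g [Xg gT]]] e e0.
pose gam (m : int) : 'rV[R[i]]_n := \row_i coef (g i) m.
have [q [t hG]] := spanning_points gam; set G := \matrix_(i < q) gam (t i) in hG.
pose P := pinvmx G.
pose S : R := \sum_(s < q) \sum_(i < n) nc (P i s).
have S0 : 0 <= S by apply: sumr_ge0 => s _; apply: sumr_ge0 => i _; exact: nc_ge0.
have d0 : 0 < e / (1 + `|K| * S) by rewrite divr_gt0 // ltr_wpDr // mulr_ge0.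
have [F hF] : exists F : {fset int}, forall m, m \notin F ->
    forall i, nc (coef (g i) m) < e / (1 + `|K| * S).
  have h (i : 'I_n) := cid (riemann_lebesgue (Xg i) d0).
  exists (seq_fset tt (flatten [seq enum_fset (sval (h i)) | i <- enum 'I_n])) => m mF i.
  apply: (svalP (h i)); apply: contra mF => mi; rewrite seq_fsetE.
  by apply/flatten_mapP; exists i => //; rewrite mem_enum.
exists F => m Lm mF; have Xm := cs_exp XN Lm; have [c hc] := gT _ Xm.
have cg i : cint (g i) := cs_cint XN (Xg i).
have cT : cint (T (zexp m)) := cs_cint XN (TX _ Xm).
have coefT k : coef (T (zexp m)) k = \sum_(i < n) c i * coef (g i) k.
  transitivity (coef (fun z => \sum_(i < n) c i * g i z) k).
    apply: coef_null => //; first by apply: cint_sum => i; exact: cintZ.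
    rewrite -[RHS]hc; congr N; congr (_ - _); apply/funext => z.
    by rewrite fct_sum.
  by rewrite coef_sum => [|i]; [apply: eq_bigr => i _; rewrite coefZ|exact: cintZ].
have coefK k : nc (coef (T (zexp m)) k) <= `|K|.
  rewrite -lee_fin; apply: le_trans (nc_coef_leN k cT) _; apply: le_trans (bT _ Xm) _.
  have N1 := cs_exp_norm XN m.
  have N0 : (0 <= N (zexp m))%E by apply: le_trans (cs_norm XN _); exact: L1norm_ge0.
  have [r rE] : exists r : R, N (zexp m) = r%:E.
    by exists (fine (N (zexp m))); rewrite fineK // ge0_fin_numE // (le_lt_trans N1) // ltry.
  rewrite rE -EFinM lee_fin; rewrite rE !lee_fin in N0 N1.
  apply: le_trans (ler_wpM2r N0 (ler_norm K)) _; exact: ler_piMr.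
pose cv : 'cV[R[i]]_n := \col_i c i.
have gamE k : (gam k *m cv) 0 0 = coef (T (zexp m)) k.
  by rewrite coefT mxE; apply: eq_bigr => i _; rewrite !mxE mulrC.
have -> : coef (T (zexp m)) m = \sum_(s < q) (gam m *m P) 0 s * coef (T (zexp m)) (t s).
  transitivity ((gam m *m P *m G *m cv) 0 0); first by rewrite (mulmxKpV (hG m)) gamE.
  rewrite -mulmxA mxE; apply: eq_bigr => s _; congr (_ * _).
  by rewrite -gamE !mxE; apply: eq_bigr => i _; rewrite !mxE.
apply: (@le_lt_trans _ _ (e / (1 + `|K| * S) * (`|K| * S))); last first.
  by rewrite mulrAC ltr_pdivrMr ?ltr_pM2l ?ltrDr // ltr_wpDr // mulr_ge0.
move: hF; set d := e / _ => hF.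
apply: le_trans (nc_sum _ _ _) _; rewrite mulrCA /S !mulr_sumr; apply: ler_sum => s _.
rewrite ncM mulrC; apply: ler_pM; rewrite ?nc_ge0 //.
rewrite mxE mulr_sumr; apply: le_trans (nc_sum _ _ _) _; apply: ler_sum => i _.
rewrite ncM mxE; apply: ler_wpM2r; first exact: nc_ge0.
by apply: ltW; exact: hF.
Qed.

(** The multiplier of the signed sum of a sequence with multipliers [phi]. *)
Definition Phi (phi : nat -> int -> R[i]) (eps : nat -> bool) n m : R[i] :=
  \sum_(k < n.+1) (-1) ^+ eps k * (phi k m - (if nat_of_ord k is k'.+1 then phi k' m else 0)).

Definition multiplier (T : nat -> (R[i] -> R[i]) -> R[i] -> R[i]) (j : nat) m : R[i] :=
  coef (T j (zexp m)) m.

Lemma approx_multiplier T : approximating_sequence X N T -> forall m, L m ->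
  forall e : R, 0 < e -> exists n0, forall k : nat, (n0 <= k)%N -> nc (multiplier T k m - 1) < e.
Proof.
move=> [opT cvT] m Lm e e0; have Xm := cs_exp XN Lm.
have N0 f : (0 <= N f)%E by apply: le_trans (cs_norm XN f); exact: L1norm_ge0.
have := cvT _ Xm; rewrite cvge0P // => /(_ e e0)[n0 h]; exists n0 => k /h hk.
rewrite -lte_fin; apply: le_lt_trans hk.
have [[TX _] _ _] := opT k; have cT := cs_cint XN (TX _ Xm).
have -> : multiplier T k m - 1 = coef (fun z => T k (zexp m) z - zexp m z) m.
  by rewrite coefB // ?coef_zexp ?eqxx //; exact: cint_exp.
by apply: nc_coef_leN; apply: cintB => //; exact: cint_exp.
Qed.

Lemma cint_signed_sum T eps n m : approximating_sequence X N T -> L m ->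
  cint (signed_sum T eps n (zexp m)).
Proof.
move=> [opT _] Lm; have Xm := cs_exp XN Lm.
have cT (k : nat) : cint (T k (zexp m)) by have [[TX _] _ _] := opT k; exact: (cs_cint XN (TX _ Xm)).
rewrite /signed_sum (_ : (\sum_(k < n.+1) _) = fun z => \sum_(k < n.+1)
   (-1) ^+ eps k * Delta T k (zexp m) z); last by apply/funext => z; rewrite fct_sum.
apply: cint_sum => k; apply: cintZ; rewrite /Delta.
by case: (val k) => [|k'] //; exact: cintB.
Qed.

Lemma coef_signed_sum T eps n m : approximating_sequence X N T -> L m ->
  coef (signed_sum T eps n (zexp m)) m = Phi (multiplier T) eps n m.
Proof.
move=> [opT _] Lm; have Xm := cs_exp XN Lm.
have cT (k : nat) : cint (T k (zexp m)) by have [[TX _] _ _] := opT k; exact: (cs_cint XN (TX _ Xm)).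
rewrite /signed_sum (_ : (\sum_(k < n.+1) _) = fun z => \sum_(k < n.+1)
   (-1) ^+ eps k * Delta T k (zexp m) z); last by apply/funext => z; rewrite fct_sum.
have cD (k : nat) : cint (Delta T k (zexp m)).
  by rewrite /Delta; case: k => [|k'] //; exact: cintB.
rewrite coef_sum => [|k]; last by apply: cintZ.
apply: eq_bigr => k _; rewrite coefZ //; congr (_ * _).
rewrite /Delta /multiplier; case: (val k) => [|k']; first by rewrite subr0.
by rewrite -coefB.
Qed.

End Space.

End Coefficients.

(** * The gliding hump *)

Section GlidingHump.
Context {R : realType}.
Variables (L : set int) (phi : nat -> int -> R[i]).
Hypothesis phi_to1 : forall m, L m -> forall e : R, 0 < e ->
  exists n0, forall k, (n0 <= k)%N -> nc (phi k m - 1) < e.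
Hypothesis phi_vanish : forall k (e : R), 0 < e ->
  exists F : {fset int}, forall m, L m -> m \notin F -> nc (phi k m) < e.
Implicit Types (eps : nat -> bool) (n : nat) (b : bool) (d : R) (P : int -> bool -> Prop).

(** Freezes the signs up to [n] and repeats [b] from there on: a block of equal
    signs telescopes. *)
Definition extend eps n b : nat -> bool := fun k => if (k <= n)%N then eps k else b.

Lemma Phi_extend eps n b n' m : (n <= n')%N ->
  Phi phi (extend eps n b) n' m = Phi phi eps n m + (-1) ^+ b * (phi n' m - phi n m).
Proof.
move=> /subnK <-; elim: (n' - n)%N => [|k ih].
  rewrite add0n subrr mulr0 addr0; apply: eq_bigr => k _.
  by rewrite /extend -ltnS ltn_ord.
rewrite addSn /Phi big_ord_recr /= -/(Phi _ _ _ _) ih /extend.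
rewrite -/(Phi phi eps n m) ifF; first by ring.
by apply/negbTE; rewrite -leqNgt leq_addl.
Qed.

(** Besides having the right sign, the frequencies in [P] are settled after [n],
    so that later blocks hardly change [Phi] there. *)
Definition good P eps n d := forall m b, P m b ->
  nc (Phi phi eps n m - (-1) ^+ b) <= d /\
  forall k, (n <= k)%N -> nc (phi k m - 1) <= d.

Lemma phi_vanish_upto n d : 0 < d -> exists s : seq int, forall k m, (k <= n)%N ->
  L m -> m \notin s -> nc (phi k m) < d.
Proof.
move=> d0; elim: n => [|n [s hs]].
  have [F hF] := phi_vanish 0 d0; exists F => k m; rewrite leqn0 => /eqP ->.
  exact: hF.
have [F hF] := phi_vanish n.+1 d0; exists (s ++ F) => k m.
rewrite leq_eqVlt mem_cat negb_or => /orP[/eqP -> Lm /andP[_]|]; first exact: hF.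
by rewrite ltnS => kn Lm /andP[ms _]; exact: hs.
Qed.

Lemma phi_to1_seq (s : seq int) d : 0 < d -> (forall m, m \in s -> L m) ->
  exists n0, forall k m, (n0 <= k)%N -> m \in s -> nc (phi k m - 1) < d.
Proof.
move=> d0; elim: s => [_|m s ih hL]; first by exists 0%N.
have [n1 h1] := phi_to1 (hL m (mem_head _ _)) d0.
have [|n2 h2] := ih; first by move=> m' m's; apply: hL; rewrite inE m's orbT.
exists (maxn n1 n2) => k m'; rewrite geq_max inE => /andP[k1 k2] /orP[/eqP ->|].
  exact: h1.
exact: h2.
Qed.

Lemma infinite_notin (T : choiceType) (E : set T) (s : seq T) :
  infinite_set E -> exists2 x, E x & x \notin s.
Proof.
move=> iE; apply: contrapT => h; apply: iE.
apply: (@sub_finite_set _ _ [set` s]); last exact: finite_seq.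
move=> x Ex /=; apply: contrapT => xs; apply: h; exists x => //.
exact/negP.
Qed.

Definition adjoin P (x : int) (offs : seq int) b : int -> bool -> Prop :=
  fun m b' => P m b' \/ exists2 o, o \in offs & m = x + o /\ b' = b.

(** The new frequencies are chosen where [phi 0, ..., phi n] are small, so that
    the past is negligible there, and the block of signs [b] lasts until
    [phi] has come close to 1 on them. *)
Lemma hump P eps n d (E : set int) (offs : seq int) b : 0 < d ->
  (forall m b, P m b -> L m) -> good P eps n d -> infinite_set E ->
  (forall x o, E x -> o \in offs -> L (x + o)) ->
  exists x eps' n', E x /\
    good (adjoin P x offs b) eps' n' (3 * d).
Proof.
move=> d0 PL gP iE EL.
have n10 : 0 < 2 * n.+1%:R :> R by rewrite mulr_gt0 ?ltr0n.
(* [Phi] has n + 1 terms, each a difference of two values of [phi]. *)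
pose d' := d / (2 * n.+1%:R); have d'0 : 0 < d' by rewrite divr_gt0.
have d'd : d' <= d.
  rewrite /d' ler_pdivrMr // ler_peMr ?(ltW d0) //.
  by rewrite -natrM ler1n muln_gt0.
have [s hs] := phi_vanish_upto n d'0.
have [x Ex xs] := infinite_notin [seq m - o | m <- s, o <- offs] iE.
have xo o k : o \in offs -> (k <= n)%N -> nc (phi k (x + o)) <= d'.
  move=> oo kn; apply: ltW; apply: hs => //; first exact: EL.
  apply: contra xs => h; apply/allpairsP; exists (x + o, o) => /=.
  by rewrite h oo addrK.
have [n0 hn0] : exists n0, forall k m, (n0 <= k)%N -> m \in [seq x + o | o <- offs] ->
    nc (phi k m - 1) < d.
  by apply: phi_to1_seq => // m /mapP[ o oo ->]; exact: EL.
exists x, (extend eps n b), (maxn n n0); split=> //.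
have sgn1 b' : nc ((-1) ^+ b' : R[i]) = 1 by rewrite ncXn ncN nc1 expr1n.
move=> m b' [Pm| [ o oo [-> ->]]].
  have [g1 g2] := gP _ _ Pm; split; last first.
    move=> k; rewrite geq_max => /andP[nk _]; apply: le_trans (g2 k nk) _.
    by rewrite ler_peMl ?(ltW d0) // ler1n.
  rewrite Phi_extend ?leq_maxl //.
  have -> : Phi phi eps n m + (-1) ^+ b * (phi (maxn n n0) m - phi n m) - (-1) ^+ b' =
     (Phi phi eps n m - (-1) ^+ b') + (-1) ^+ b * ((phi (maxn n n0) m - 1) - (phi n m - 1)).
    by ring.
  apply: le_trans (ncD _ _) _; rewrite ncM sgn1 mul1r.
  have h1 := g2 n (leqnn _); have h2 := g2 _ (leq_maxl n n0).
  have := ncD (phi (maxn n n0) m - 1) (- (phi n m - 1)); rewrite ncN.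
  lra.
have mo : x + o \in [seq x + o | o <- offs] by apply/mapP; exists o.
split; last first.
  move=> k; rewrite geq_max => /andP[_ nk]; apply: le_trans (ltW (hn0 _ _ nk mo)) _.
  by rewrite ler_peMl ?(ltW d0) // ler1n.
rewrite Phi_extend ?leq_maxl //.
have -> : Phi phi eps n (x + o) + (-1) ^+ b * (phi (maxn n n0) (x + o) - phi n (x + o)) - (-1) ^+ b =
     Phi phi eps n (x + o) + (-1) ^+ b * ((phi (maxn n n0) (x + o) - 1) - phi n (x + o)).
  by ring.
apply: le_trans (ncD _ _) _; rewrite ncM sgn1 mul1r.
have hP : nc (Phi phi eps n (x + o)) <= d.
  have -> : d = \sum_(k < n.+1) (d' + d').
    rewrite sumr_const card_ord -mulr_natr /d'; field.
    by rewrite gt_eqF ?ltr0n.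
  apply: le_trans (nc_sum _ _ _) _; apply: ler_sum => k _; rewrite ncM sgn1 mul1r.
  apply: le_trans (ncD _ _) _; rewrite ncN; apply: lerD; first by apply: xo => //; rewrite -ltnS.
  case: k => -[|k] hk; first by rewrite [X in X <= _]nc0 ltW.
  by apply: xo => //; rewrite ltnW.
have h1 := ltW (hn0 _ _ (leq_maxr n n0) mo); have h2 := xo _ _ oo (leqnn n).
have := ncD (phi (maxn n n0) (x + o) - 1) (- phi n (x + o)); rewrite ncN.
lra.
Qed.

(** The points [r N] and then [c N] are added in turn: the sign at [r i + c j] is
    the one attached to whichever of the two was chosen later. Each addition
    triples the tolerance. *)
Lemma triangular_signs (A B : set int) N d : 0 < d ->
  infinite_set A -> infinite_set B -> sumset A B `<=` L ->
  exists (r c : nat -> int) eps n,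
    [/\ forall i, (i < N)%N -> A (r i), forall j, (j < N)%N -> B (c j) &
        forall i j, (i < N)%N -> (j < N)%N ->
          nc (Phi phi eps n (r i + c j) - (upper_sign i j)%:C) <= d].
Proof.
move=> d0 iA iB AB.
have LAB (u v : int) : A u -> B v -> L (u + v).
  by move=> Au Bv; apply: AB; exists u => //; exists v.
pose Q N (r c : nat -> int) (m : int) (b : bool) := exists i j,
  [/\ (i < N)%N, (j < N)%N, m = r i + c j & b = (j < i)%N].
suff H : forall d, 0 < d -> exists (r c : nat -> int) eps n,
    [/\ forall i, (i < N)%N -> A (r i), forall j, (j < N)%N -> B (c j) &
        good (Q N r c) eps n (9 ^+ N * d)].
  have dN : 0 < d / 9 ^+ N by rewrite divr_gt0 // exprn_gt0.
  have [r [c [eps [n [rA cB g]]]]] := H _ dN.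
  exists r, c, eps, n; split=> // i j iN jN.
  have [|g1 _] := g (r i + c j) (j < i)%N; first by exists i, j.
  apply: le_trans (_ : _ <= 9 ^+ N * (d / 9 ^+ N)) _; last first.
    by rewrite mulrC divfK // gt_eqF // exprn_gt0.
  move: g1; rewrite /upper_sign ltnNge; case: (i <= j)%N => //=.
  by rewrite expr1 rmorphN.
clear d d0; elim: N => [|N ih] d d0.
  by exists (fun=> 0), (fun=> 0), (fun=> false), 0%N; split=> // m b [i [j []]].
have [r [c [eps [n [rA cB g]]]]] := ih d d0.
have dN : 0 < 9 ^+ N * d by rewrite mulr_gt0 // exprn_gt0.
have QL m b : Q N r c m b -> L m.
  by move=> [i [j [iN jN -> _]]]; apply: LAB; [exact: rA|exact: cB].
have EL1 x o : A x -> o \in [seq c j | j <- iota 0 N] -> L (x + o).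
  move=> Ax /mapP[j]; rewrite mem_iota add0n => jN ->; apply: LAB => //; exact: cB.
have [x [eps1 [n1 [Ax g1]]]] := hump true dN QL g iA EL1.
pose r' (i : nat) : int := if (i == N)%N then x else r i.
have r'A i : (i < N.+1)%N -> A (r' i).
  by rewrite /r' ltnS leq_eqVlt; case: eqVneq => //= _; exact: rA.
have d1 : 0 < 3 * (9 ^+ N * d) by rewrite mulr_gt0.
set Q1 := adjoin _ _ _ _ in g1.
have QL1 m b : Q1 m b -> L m.
  by move=> [/QL //| [ o oo [-> _]]]; exact: EL1.
have EL2 y o : B y -> o \in [seq r' i | i <- iota 0 N.+1] -> L (y + o).
  move=> By /mapP[k]; rewrite mem_iota add0n => kN ->.
  by rewrite addrC; apply: LAB => //; exact: r'A.
have [y [eps2 [n2 [By g2]]]] := hump false d1 QL1 g1 iB EL2.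
pose c' (j : nat) : int := if (j == N)%N then y else c j.
exists r', c', eps2, n2; split=> //.
  by move=> j; rewrite /c' ltnS leq_eqVlt; case: eqVneq => //= _; exact: cB.
have -> : 9 ^+ N.+1 * d = 3 * (3 * (9 ^+ N * d)) by rewrite exprS; ring.
move=> m b [i [j [iN jN mE bE]]]; apply: g2.
have [jE|jNE] := eqVneq j N.
  right; exists (r' i); first by apply: map_f; rewrite mem_iota add0n.
  by rewrite mE bE jE /c' eqxx addrC ltnNge -ltnS iN.
have jN' : (j < N)%N by rewrite ltn_neqAle jNE -ltnS.
left; have [iE|iNE] := eqVneq i N.
  right; exists (c j); first by apply: map_f; rewrite mem_iota add0n.
  by rewrite mE bE iE /c' (negbTE jNE) /r' eqxx jN'.
left; exists i, j; split=> //; first by rewrite ltn_neqAle iNE -ltnS.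
by rewrite mE /c' /r' (negbTE jNE) (negbTE iNE).
Qed.

End GlidingHump.

(** * From signed sums of operators to the skew matrix *)

Section SignedSums.
Context {R : realType}.
Implicit Types (L : set int) (r c : nat -> int) (q : nat).

(** Operators are linear up to vectors of norm 0 only; a functional [Psi] that
    vanishes on such vectors does not see the difference. *)
Lemma operator_comb (W : lmodType R[i]) (X : set W) (N : W -> \bar R) (T : W -> W)
  (P : set W) (Psi : W -> R[i]) :
  operator X N T -> X `<=` P ->
  (forall (a : R[i]) f g, P f -> P g -> P (a *: f + g)) ->
  (forall (a : R[i]) f g, P f -> P g -> Psi (a *: f + g) = a * Psi f + Psi g) ->
  (forall f, P f -> N f = 0%E -> Psi f = 0) ->
  forall (I : Type) (s : seq I) (a : I -> R[i]) (F : I -> W),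
  (forall i, X (F i)) -> (forall s', X (\sum_(i <- s') a i *: F i)) ->
  Psi (T (\sum_(i <- s) a i *: F i)) = \sum_(i <- s) a i * Psi (T (F i)).
Proof.
move=> [TX Tlin] XP Pcomb Psilin Pnull I s a F XF Xs.
have PT h : X h -> P (T h) by move=> Xh; exact/XP/TX.
have lin (b : R[i]) f g : X f -> X g -> X (b *: f + g) ->
    Psi (T (b *: f + g)) = b * Psi (T f) + Psi (T g).
  move=> Xf Xg Xfg; rewrite -Psilin //; try exact: PT.
  have Pc : P (b *: T f + T g) by apply: Pcomb; exact: PT.
  have diffE : T (b *: f + g) - (b *: T f + T g) = (-1) *: (b *: T f + T g) + T (b *: f + g).
    by rewrite scaleN1r addrC.
  have := Pnull _ (Pcomb (-1) _ _ Pc (PT _ Xfg)); rewrite -diffE => /(_ (Tlin _ _ _ Xf Xg)).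
  rewrite diffE (Psilin (-1)) //; last exact: PT.
  by rewrite mulN1r addrC => /subr0_eq.
elim: s => [|i s ih]; last by rewrite !big_cons lin ?ih //; have := Xs (i :: s); rewrite big_cons.
have X0 : X 0 by have := Xs [::]; rewrite big_nil.
have := lin (-1) 0 0 X0 X0; rewrite scaler0 addr0 => /(_ X0).
by rewrite !big_nil mulN1r addNr.
Qed.

Lemma mul_ereal_bound (K c : R) (x : \bar R) : (0 <= x)%E -> (x <= c%:E)%E ->
  (K%:E * x <= (`|K| * c)%:E)%E.
Proof.
case: x => [x| |] //; rewrite -EFinM !lee_fin => x0 xc.
by apply: le_trans (ler_wpM2r x0 (ler_norm K)) _; exact: ler_wpM2l.
Qed.

Lemma sum_pair_ord (V : nmodType) N (F : nat -> nat -> V) :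
  \sum_(p : 'I_N * 'I_N) F p.1 p.2 = \sum_(i < N) \sum_(j < N) F i j.
Proof. by rewrite (pair_bigA _ (fun i j : 'I_N => F i j)). Qed.

Definition skew_sum q (F : int -> R[i]) r c : R[i] :=
  \sum_(p : 'I_(2 ^ (q ^ 2)) * 'I_(2 ^ (q ^ 2))) (skew (q ^ 2) p.1 p.2)%:C * F (r p.1 + c p.2).

Lemma trigsum_zexp (I : Type) (s : seq I) (a : I -> R[i]) (m : I -> int) :
  \sum_(i <- s) a i *: zexp (m i) = trigsum [seq (a i, m i) | i <- s].
Proof.
apply/funext => z; rewrite fct_sum /trigsum big_map; apply: eq_bigr => i _.
by rewrite /GRing.scale /= mulrC.
Qed.

Lemma supnorm_ge0 (f : R[i] -> R[i]) : (0 <= supnorm f)%E.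
Proof. by apply: le_trans (cnorm_ge0 (f 1)) _; apply: supnorm_ge; exact: circle1. Qed.

Lemma signed_sum_at (T : nat -> (R[i] -> R[i]) -> R[i] -> R[i]) eps n f (z : R[i]) :
  signed_sum T eps n f z = \sum_(k < n.+1) (-1) ^+ eps k *
    (T k f z - (if nat_of_ord k is k'.+1 then T k' f z else 0)).
Proof.
rewrite /signed_sum fct_sum; apply: eq_bigr => -[[|k] hk] _ /=; first by rewrite subr0.
by [].
Qed.

(** Let [h] be the skew matrix, of size [N], and [m_ij = r i + c j]. For [v] on
    the circle, the function [sum_ij h_ij v^(- m_ij) z^m_ij] has sup norm at
    most [2 q N], and its image under the signed sum [S] has the value
    [G v = sum_ij h_ij v^(- m_ij) (S z^m_ij) v] at [v]. The integral of [G] over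
    the circle is the sum to be bounded: this is where the operators are
    averaged over rotations. *)
Lemma unconditional_C_bound L T (K : R) q r c eps n :
  approximating_sequence (CL L) supnorm T ->
  bounded_by (CL L) supnorm (signed_sum T eps n) K -> (0 < q)%N ->
  (forall i j, (i < 2 ^ (q ^ 2))%N -> (j < 2 ^ (q ^ 2))%N -> L (r i + c j)) ->
  nc (skew_sum q (Phi (multiplier T) eps n) r c) <= `|K| * (2 * q%:R * 2 ^+ (q ^ 2)).
Proof.
move=> apT bT q0 rcL; set N := (2 ^ (q ^ 2))%N.
have XN := @circle_space_C R L.
pose m (p : 'I_N * 'I_N) := r p.1 + c p.2.
have Lm p : L (m p) by apply: rcL.
pose h (p : 'I_N * 'I_N) : R[i] := (skew (q ^ 2) p.1 p.2)%:C.
pose S := signed_sum T eps n.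
pose f (v : R[i]) : R[i] -> R[i] := \sum_p (h p * v ^ (- m p)) *: zexp (m p).
have Xs v s : CL L (\sum_(p <- s) (h p * v ^ (- m p)) *: zexp (m p)).
  by rewrite trigsum_zexp; apply: trigsum_CL => l /mapP[p _ ->]; exact: Lm.
have Sf v : circle v -> S (f v) v = \sum_p h p * v ^ (- m p) * S (zexp (m p)) v.
  move=> cv.
  have Tf k : T k (f v) v = \sum_p h p * v ^ (- m p) * T k (zexp (m p)) v.
    have [opT _ _] := apT.1 k.
    apply: (@operator_comb _ _ _ _ setT (fun g => g v) opT) => //.
    - move=> g _ g0; apply: nc_eq0; apply/eqP; rewrite eq_le nc_ge0 andbT -lee_fin.
      by apply: le_trans (supnorm_ge g cv) _; rewrite g0.
    - by move=> p; exact: (cs_exp XN (Lm p)).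
  rewrite /S signed_sum_at.
  under [RHS]eq_bigr do rewrite signed_sum_at mulr_sumr.
  rewrite exchange_big; apply: eq_bigr => k _ /=.
  under [RHS]eq_bigr do rewrite mulrCA.
  rewrite -mulr_sumr; congr (_ * _); rewrite Tf.
  case: (nat_of_ord k) => [|k']; first by rewrite subr0; apply: eq_bigr => p _; rewrite subr0.
  rewrite Tf -sumrB; apply: eq_bigr => p _. by rewrite mulrBr.
have NR : (2 ^+ (q ^ 2) : R) = N%:R by rewrite natrX.
have fsup v : circle v -> (supnorm (f v) <= (2 * q%:R * N%:R)%:E)%E.
  move=> cv; apply: supnorm_le => z cz.
  have -> : f v z = bilinear_form N (skew (q ^ 2))
      (fun i => v ^ (- r i) * z ^ (r i)) (fun j => v ^ (- c j) * z ^ (c j)).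
    rewrite /bilinear_form -(sum_pair_ord _ (fun i j => (skew (q ^ 2) i j)%:C *
      ((v ^ (- r i) * z ^ (r i)) * (v ^ (- c j) * z ^ (c j))))).
    rewrite /f fct_sum; apply: eq_bigr => p _.
    rewrite -[LHS]/(h p * v ^ (- m p) * z ^ m p) /m /h opprD !expfzDr ?circle_neq0 //.
    by ring.
  apply: le_trans (skew_form_le _ _ q0) _; rewrite !norm2_circle -/N => [|i|i].
  - by rewrite le_eqVlt; apply/orP; left; apply/eqP; ring.
  - by apply: circleM; exact: circleX.
  - by apply: circleM; exact: circleX.
pose G v := \sum_p h p * (v ^ (- m p) * S (zexp (m p)) v).
have Gbound v : circle v -> nc (G v) <= `|K| * (2 * q%:R * N%:R).
  move=> cv; have -> : G v = S (f v) v.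
    by rewrite Sf //; apply: eq_bigr => p _; rewrite mulrA.
  rewrite -lee_fin; apply: le_trans (supnorm_ge (S (f v)) cv) _.
  apply: le_trans (bT _ (Xs v _)) _; apply: mul_ereal_bound; first exact: supnorm_ge0.
  exact: fsup.
have cS p : cint (S (zexp (m p))) by exact: (cint_signed_sum XN _ _ apT (Lm p)).
have cG p : cint (fun v => h p * (v ^ (- m p) * S (zexp (m p)) v)).
  by apply: cintZ; exact: cint_coef.
have -> : skew_sum q (Phi (multiplier T) eps n) r c = cintegral G.
  rewrite /G cintegral_sum //; apply: eq_bigr => p _.
  rewrite cintegralZ; last exact: cint_coef.
  by congr (_ * _); rewrite -(coef_signed_sum XN _ _ apT (Lm p)).
rewrite NR -lee_fin; apply: le_trans (nc_cintegral_le (cint_sum _ cG)) _.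
rewrite -(integral01_cst (`|K| * _)); apply: ge0_le_integral_nomeas => t _.
  by rewrite lee_fin nc_ge0.
by rewrite lee_fin; apply: Gbound; exact: circ_circle.
Qed.

(** An entry of a matrix is bounded by its S^1-norm. *)
Lemma LpL_entry_cint L (F : R[i] -> nat -> nat -> R[i]) i j :
  LpL (schatten 1) 1 L F -> cint (fun z => F z i j).
Proof.
move=> [[sF LF] _].
have entry_le (x : nat -> nat -> R[i]) : ((nc (x i j))%:E <= schatten 1 x)%E.
  pose y (i' j' : nat) : R[i] := ((i' == i) && (j' == j))%:R.
  pose N := (maxn i j).+1.
  have iN : (i < N)%N by rewrite ltnS leq_maxl.
  have jN : (j < N)%N by rewrite ltnS leq_maxr.
  have ysum (g : nat -> nat -> R[i]) : \sum_(i' < N) \sum_(j' < N) y i' j' * g i' j' = g i j.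
    rewrite (bigD1 (Ordinal iN)) //= [X in _ + X]big1 ?addr0 => [|k /negbTE ki]; last first.
      by apply: big1 => l _; rewrite /y -[(k == i :> nat)]/(k == Ordinal iN) ki mul0r.
    rewrite (bigD1 (Ordinal jN)) //= [X in _ + X]big1 ?addr0 => [|k /negbTE ki]; last first.
      by rewrite /y -[(k == j :> nat)]/(k == Ordinal jN) ki andbF mul0r.
    by rewrite /y !eqxx mul1r.
  have -> : x i j = entry_pairing y N x by rewrite /entry_pairing ysum.
  apply: schatten1_ge => u v ou ov n.
  rewrite /pairing (ysum (fun i j => u n i * (v n j)^*%C)) ncM nc_conj.
  have le1 (w : nat -> nat -> R[i]) k : (k < N)%N -> orthonormal_seq w -> nc (w n k) <= 1.
    move=> kN ow; rewrite -(@expr_le1 _ 2) ?nc_ge0 //.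
    apply: le_trans (bessel_proj N n ow); rewrite (bigD1 (Ordinal kN)) //= lerDl.
    by apply: sumr_ge0 => l _; exact: sqr_ge0.
  by rewrite -[1]mulr1; apply: ler_pM; rewrite ?nc_ge0 // le1.
split.
  split.
    apply: (strongly_measurable_fun (e := fun x : nat -> nat -> R[i] => complex.Re (x i j)) sF).
      by move=> x y; rewrite -[(x - y) i j]/(x i j - y i j); case: (x i j); case: (y i j).
    by move=> x; apply: le_trans (entry_le x); rewrite lee_fin nc_Re.
  apply: (strongly_measurable_fun (e := fun x : nat -> nat -> R[i] => complex.Im (x i j)) sF).
    by move=> x y; rewrite -[(x - y) i j]/(x i j - y i j); case: (x i j); case: (y i j).
  by move=> x; apply: le_trans (entry_le x); rewrite lee_fin nc_Im.
apply: le_lt_trans LF; rewrite Lpnorm1E; last by move=> x; exact: schatten_ge0.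
by apply: ge0_le_integral_nomeas => t _; [rewrite lee_fin nc_ge0|exact: entry_le].
Qed.

End SignedSums.

(** * Sumsets of infinite sets *)

Section PartTwo.
Context {R : realType}.
Implicit Types (L : set int) (r c : nat -> int) (q : nat).

Definition mexp N (w : nat -> nat -> R) r c (z : R[i]) : nat -> nat -> R[i] :=
  twist N w (fun i => z ^ r i) (fun j => z ^ c j).

Definition unit_mx (i j : nat) : nat -> nat -> R[i] :=
  fun i' j' => ((i' == i) && (j' == j))%:R.

Lemma unit_mx_supported N i j : (i < N)%N -> (j < N)%N -> supported N (unit_mx i j).
Proof.
move=> iN jN i' j' h; rewrite /unit_mx (_ : _ && _ = false) //.
by apply: contraNF h => /andP[/eqP -> /eqP ->]; rewrite iN jN.
Qed.

Lemma sum_unit_mx N (F : nat -> nat -> R[i]) (i j : nat) :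
  \sum_(p : 'I_N * 'I_N) F p.1 p.2 * unit_mx p.1 p.2 i j =
  if ((i < N) && (j < N))%N then F i j else 0.
Proof.
case: ifP => [/andP[iN jN]|ij].
  rewrite (bigD1 (Ordinal iN, Ordinal jN)) //= big1 ?addr0 => [|[k l] kl].
    by rewrite /unit_mx !eqxx mulr1.
  rewrite /unit_mx /= (_ : _ && _ = false) ?mulr0 //; apply: contraNF kl => /andP[/eqP ik /eqP jl].
  by apply/eqP; congr (_, _); apply: val_inj.
apply: big1 => -[[k kN] [l lN]] _ /=; rewrite /unit_mx (_ : _ && _ = false) ?mulr0 //.
by apply: contraFF ij => /andP[/eqP -> /eqP ->]; rewrite kN lN.
Qed.

Lemma fct2_sum (I : Type) (s : seq I) (F : I -> R[i] -> nat -> nat -> R[i]) z i j :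
  (\sum_(k <- s) F k) z i j = \sum_(k <- s) F k z i j.
Proof. by rewrite !fct_sum. Qed.

(** The function [f] is the matrix of ones, of S^1-norm [N], twisted by the
    characters [z^m_ij] with [m_ij = r i + c j]. Pairing its image at [z] with
    the contraction [h_ij z^(- m_ij) / (2 q)], where [h] is the skew matrix, and
    integrating over [z] picks out the coefficients [Phi m_ij]. *)
Lemma unconditional_S1_bound L T (K : R) q r c eps n :
  approximating_sequence (LpL cnorm 1 L) (Lpnorm cnorm 1) T ->
  completely_bounded_by L (signed_sum T eps n) K -> (0 < q)%N ->
  (forall i j, (i < 2 ^ (q ^ 2))%N -> (j < 2 ^ (q ^ 2))%N -> L (r i + c j)) ->
  nc (skew_sum q (Phi (multiplier T) eps n) r c) <= `|K| * (2 * q%:R * 2 ^+ (q ^ 2)).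
Proof.
move=> apT [U [opU Utensor bU]] q0 rcL; set N := (2 ^ (q ^ 2))%N.
have N0 : (0 < N)%N by rewrite expn_gt0.
have qR : 0 < 2 * q%:R :> R by rewrite mulr_gt0 ?ltr0n.
have XN := @circle_space_L1 R L.
pose S := signed_sum T eps n.
pose m (p : 'I_N * 'I_N) := r p.1 + c p.2.
have Lm p : L (m p) by apply: rcL.
pose W := R[i] -> nat -> nat -> R[i].
pose F (p : 'I_N * 'I_N) : W := tensor (unit_mx p.1 p.2) (zexp (m p)).
have sum_LpL s : LpL (schatten 1) 1 L (\sum_(p <- s) (1 : R[i]) *: F p).
  have -> : \sum_(p <- s) (1 : R[i]) *: F p =
      trigsum (map (fun p : 'I_N * 'I_N => (unit_mx p.1 p.2, m p)) s).
    apply/funext => z; rewrite fct_sum /trigsum big_map; apply: eq_bigr => p _.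
    by rewrite scale1r.
  by apply: (@trigsum_schatten _ 1 L N) => // l /mapP[p _ ->]; [exact: unit_mx_supported|exact: Lm].
have F_LpL p : LpL (schatten 1) 1 L (F p).
  by have := sum_LpL [:: p]; rewrite big_seq1 scale1r.
pose f : W := \sum_p (1 : R[i]) *: F p.
have fE z : circle z -> f z = mexp N (fun _ _ => 1) r c z.
  move=> cz; apply/funext => i; apply/funext => j; rewrite /f fct2_sum /mexp /twist.
  rewrite -(sum_unit_mx N (fun i j => 1%:C * (z ^ r i * z ^ c j))); apply: eq_bigr => p _.
  rewrite -[LHS]/(1 * (z ^ (m p) * unit_mx p.1 p.2 i j)) /m expfzDr ?circle_neq0 //.
  by rewrite !mul1r.
have fnorm : (Lpnorm (schatten 1) 1 f <= N%:R%:E)%E.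
  apply: Lpnorm_le => //; first by move=> x; exact: schatten_ge0.
  by move=> z cz; rewrite fE //; apply: schatten_rank1_le => // i; exact: circleX.
pose y z : nat -> nat -> R[i] := fun i j => (2 * q%:R)^-1%:C *
  twist N (skew (q ^ 2)) (fun i => z ^ (- r i)) (fun j => z ^ (- c j)) i j.
pose Psi (G : W) := cintegral (fun z => entry_pairing (y z) N (G z)).
pose P : set W := [set G | forall i j, cint (fun z => G z i j)].
have cyG (G : W) : P G -> cint (fun z => entry_pairing (y z) N (G z)).
  move=> PG; apply: cint_sum => i; apply: cint_sum => j.
  have -> : (fun z => y z i j * G z i j) = (fun z => ((2 * q%:R)^-1%:C * (skew (q ^ 2) i j)%:C)
      * (z ^ (- r i) * (z ^ (- c j) * G z i j))).
    by apply/funext => z; rewrite /y /twist !ltn_ord /=; ring.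
  apply: cintZ; apply: cintM_circle; first apply: cintM_circle => //.
  - exact: cmeas_exp.
  - by move=> z cz; rewrite nc_circle //; exact: circleX.
  - exact: cmeas_exp.
  - by move=> z cz; rewrite nc_circle //; exact: circleX.
have Pcomb (a : R[i]) G H : P G -> P H -> P (a *: G + H).
  by move=> PG PH i j; apply: (cintD (cintZ a (PG i j)) (PH i j)).
have Psilin (a : R[i]) G H : P G -> P H -> Psi (a *: G + H) = a * Psi G + Psi H.
  move=> PG PH; rewrite /Psi -cintegralZ; last exact: cyG.
  rewrite -cintegralD; [|by apply: cintZ; exact: cyG|exact: cyG].
  congr cintegral; apply/funext => z; rewrite /entry_pairing mulr_sumr -big_split.
  apply: eq_bigr => i _ /=; rewrite mulr_sumr -big_split; apply: eq_bigr => j _ /=.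
  by rewrite -[(a *: G + H) z i j]/(a * G z i j + H z i j); ring.
have Psi_le G : P G -> ((nc (Psi G))%:E <= Lpnorm (schatten 1) 1 G)%E.
  move=> PG; apply: le_trans (nc_cintegral_le (cyG _ PG)) _.
  rewrite Lpnorm1E; last by move=> x; exact: schatten_ge0.
  apply: ge0_le_integral_nomeas => t _; first by rewrite lee_fin nc_ge0.
  apply: schatten1_ge => u v ou ov k; apply: skew_pairing_le => // i;
    by apply: circleX; exact: circ_circle.
have Pnull G : P G -> Lpnorm (schatten 1) 1 G = 0%E -> Psi G = 0.
  move=> PG G0; have := Psi_le _ PG; rewrite G0 lee_fin => h.
  by apply: nc_eq0; apply/eqP; rewrite eq_le h nc_ge0.
have XP : LpL (schatten 1) 1 L `<=` P by move=> G LG i j; exact: LpL_entry_cint LG.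
have Psif : Psi (U f) = \sum_p 1 * Psi (U (F p)).
  exact: (operator_comb opU XP Pcomb Psilin Pnull).
have cS p : cint (S (zexp (m p))) by exact: (cint_signed_sum XN _ _ apT (Lm p)).
have PF (p : 'I_N * 'I_N) : P (tensor (unit_mx p.1 p.2) (S (zexp (m p)))).
  move=> i j; rewrite -[X in cint X]/(fun z => S (zexp (m p)) z * unit_mx p.1 p.2 i j).
  have := cintZ (unit_mx p.1 p.2 i j) (cS p); congr cint.
  by apply/funext => z; rewrite mulrC.
have S1fin i j : (schatten 1 (unit_mx i j) < +oo)%E.
  apply: le_lt_trans (@schatten_le_entries _ 1 (maxn i j).+1 _ ltr01 _) (ltry _).
  by apply: unit_mx_supported; rewrite ltnS ?leq_maxl ?leq_maxr.
have PsiU (p : 'I_N * 'I_N) : Psi (U (F p)) = (2 * q%:R)^-1%:C *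
    ((skew (q ^ 2) p.1 p.2)%:C * Phi (multiplier T) eps n (m p)).
  transitivity (Psi (tensor (unit_mx p.1 p.2) (S (zexp (m p))))).
    have PUF := XP _ (opU.1 _ (F_LpL p)).
    have d0 := Utensor _ _ (S1fin p.1 p.2) (cs_exp XN (Lm p)).
    apply/eqP; rewrite -subr_eq0; apply/eqP.
    transitivity (Psi ((-1) *: tensor (unit_mx p.1 p.2) (S (zexp (m p))) + U (F p))).
      by rewrite (Psilin (-1)) // mulN1r addrC.
    apply: Pnull; first exact: Pcomb.
    by rewrite scaleN1r addrC.
  rewrite /Psi -(coef_signed_sum XN _ _ apT (Lm p)) /coef -/S mulrA -cintegralZ; last exact: cint_coef.
  apply: eq_cintegral => z cz; rewrite /entry_pairing.
  rewrite (bigD1 p.1) //= [X in _ + X]big1 ?addr0 => [|k /negbTE kp]; last first.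
    apply: big1 => l _; rewrite -[tensor _ _ _ _ _]/(S (zexp (m p)) z * unit_mx p.1 p.2 k l).
    by rewrite /unit_mx -[(k == p.1 :> nat)]/(k == p.1) kp !mulr0.
  rewrite (bigD1 p.2) //= [X in _ + X]big1 ?addr0 => [|k /negbTE kp]; last first.
    rewrite -[tensor _ _ _ _ _]/(S (zexp (m p)) z * unit_mx p.1 p.2 p.1 k).
    by rewrite /unit_mx -[(k == p.2 :> nat)]/(k == p.2) kp andbF !mulr0.
  rewrite -[tensor _ _ _ _ _]/(S (zexp (m p)) z * unit_mx p.1 p.2 p.1 p.2).
  rewrite /unit_mx !eqxx mulr1 /y /twist !ltn_ord /= /m opprD expfzDr ?circle_neq0 //.
  by ring.
have skewE : (2 * q%:R)^-1%:C * skew_sum q (Phi (multiplier T) eps n) r c = Psi (U f).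
  rewrite Psif /skew_sum mulr_sumr; apply: eq_bigr => p _.
  by rewrite PsiU mul1r.
have : nc (Psi (U f)) <= `|K| * N%:R.
  rewrite -lee_fin; apply: le_trans (Psi_le _ (XP _ (opU.1 _ (sum_LpL _)))) _.
  apply: le_trans (bU _ (sum_LpL _)) _; apply: mul_ereal_bound fnorm.
  exact: poweR_ge0.
rewrite -skewE ncM nc_real ger0_norm ?invr_ge0 ?(ltW qR) // ler_pdivrMl //.
by rewrite natrX mulrCA.
Qed.

(** Each term differs from [`|skew i j|] by at most half of it, because [skew] has
    the signs that [F] approximates. *)
Lemma skew_sum_ge q (F : int -> R[i]) r c :
  (forall i j, (i < 2 ^ (q ^ 2))%N -> (j < 2 ^ (q ^ 2))%N ->
     nc (F (r i + c j) - (upper_sign i j)%:C) <= 2^-1) ->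
  (q ^ 2)%:R * 2 ^+ (q ^ 2) / 2 <= nc (skew_sum q F r c).
Proof.
move=> hF; rewrite -skew_abs_sum /skew_sum.
pose h := @skew R (q ^ 2).
rewrite -(sum_pair_ord _ (fun i j => `|h i j|)) -/h.
set N := (2 ^ (q ^ 2))%N in hF *.
have E : \sum_(p : 'I_N * 'I_N) (h p.1 p.2)%:C * F (r p.1 + c p.2) =
    (\sum_(p : 'I_N * 'I_N) `|h p.1 p.2|)%:C +
    \sum_(p : 'I_N * 'I_N) (h p.1 p.2)%:C * (F (r p.1 + c p.2) - (upper_sign p.1 p.2)%:C).
  rewrite rmorph_sum -big_split; apply: eq_bigr => p _ /=.
  have -> : `|h p.1 p.2| = h p.1 p.2 * upper_sign p.1 p.2.
    (* [skew i j] is its modulus times a sign, so multiplying by that sign again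
       gives the modulus. *)
    rewrite [in RHS]/h skew_sign // -mulrA -expr2.
    by rewrite /upper_sign; case: ifP => _; rewrite ?sqrrN expr1n mulr1.
  by rewrite rmorphM /=; ring.
rewrite E; set e := \sum_p _ * (_ - _); set a := \sum_p `|_|.
have ea : nc e <= a / 2.
  apply: le_trans (nc_sum _ _ _) _; rewrite mulr_suml; apply: ler_sum => p _.
  by rewrite ncM nc_real; apply: ler_wpM2l => //; exact: hF.
have := le_trans (ler_norm _) (nc_Re (a%:C + e)); rewrite Re_add /=.
have := nc_Re e; rewrite ler_norml => /andP[].
lra.
Qed.

(** With [N = 2^(q^2)] and [q] larger than [4 |K|], the lower bound [q^2 N / 2] for
    the skew sum exceeds the upper bound [2 |K| q N]. *)
Lemma no_infinite_sumset L (phi : nat -> int -> R[i]) (K : R) :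
  (forall m, L m -> forall e : R, 0 < e ->
    exists n0, forall k : nat, (n0 <= k)%N -> nc (phi k m - 1) < e) ->
  (forall (k : nat) (e : R), 0 < e ->
    exists F : {fset int}, forall m, L m -> m \notin F -> nc (phi k m) < e) ->
  (forall q r c eps n, (0 < q)%N ->
     (forall i j, (i < 2 ^ (q ^ 2))%N -> (j < 2 ^ (q ^ 2))%N -> L (r i + c j)) ->
     nc (skew_sum q (Phi phi eps n) r c) <= `|K| * (2 * q%:R * 2 ^+ (q ^ 2))) ->
  forall A B : set int, infinite_set A -> infinite_set B -> ~ (sumset A B `<=` L).
Proof.
move=> h1 h0 hK A B iA iB AB.
pose q := (Num.truncn (4 * `|K|)).+1.
have half0 : 0 < 2^-1 :> R by rewrite invr_gt0.
have [r [c [eps [n [rA cB sgn]]]]] :=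
  triangular_signs h1 h0 (2 ^ (q ^ 2)) half0 iA iB AB.
have ge := skew_sum_ge sgn.
have le : nc (skew_sum q (Phi phi eps n) r c) <= `|K| * (2 * q%:R * 2 ^+ (q ^ 2)).
  apply: hK => // i j iN jN; apply: AB.
  by exists (r i); [exact: rA|exists (c j); [exact: cB|]].
have := le_trans ge le; rewrite natrX.
have N0 : 0 < 2 ^+ (q ^ 2) :> R by apply: exprn_gt0.
have q0 : 0 < q%:R :> R by rewrite ltr0n.
have -> : q%:R ^+ 2 * 2 ^+ (q ^ 2) / 2 = (2 ^+ (q ^ 2) * q%:R * 2) * (q%:R / 4) :> R by field.
have -> : `|K| * (2 * q%:R * 2 ^+ (q ^ 2)) = (2 ^+ (q ^ 2) * q%:R * 2) * `|K| by ring.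
rewrite ler_pM2l ?mulr_gt0 // ler_pdivrMr //.
have := truncnS_gt (4 * `|K|); rewrite -/q mulrC => lt le'.
by have := lt_le_trans lt le'; rewrite ltxx.
Qed.

Theorem no_infinite_sumset_of_approximation L :
  (exists T : nat -> (R[i] -> R[i]) -> (R[i] -> R[i]),
      approximating_sequence (LpL cnorm 1 L) (Lpnorm cnorm 1) T /\
      completely_unconditional L T) \/
  (exists T : nat -> (R[i] -> R[i]) -> (R[i] -> R[i]),
      approximating_sequence (CL L) supnorm T /\
      unconditional (CL L) supnorm T) ->
  forall A B : set int, infinite_set A -> infinite_set B -> ~ (sumset A B `<=` L).
Proof.
have vanish X N (XN : circle_space L X N) T : approximating_sequence X N T ->
  forall (k : nat) (e : R), 0 < e ->
    exists F : {fset int}, forall m, L m -> m \notin F -> nc (multiplier T k m) < e.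
  move=> [opT _] k e e0; have [oT [K bT] fT] := opT k.
  by have := finite_rank_coef XN oT bT fT e0.
case=> -[T [apT [K bK]]].
  have XN := @circle_space_L1 R L.
  apply: (@no_infinite_sumset L (multiplier T) K).
  - exact: (approx_multiplier XN apT).
  - exact: (vanish _ _ XN T apT).
  - by move=> q r c eps n q0 rcL; exact: (unconditional_S1_bound apT (bK eps n)).
have XN := @circle_space_C R L.
apply: (@no_infinite_sumset L (multiplier T) K).
- exact: (approx_multiplier XN apT).
- exact: (vanish _ _ XN T apT).
- by move=> q r c eps n q0 rcL; exact: (unconditional_C_bound apT (bK eps n)).
Qed.

End PartTwo.

(** * Sumsets of large finite sets *)

Section PartOne.
Context {R : realType}.
Implicit Types (L A B : set int) (r c : nat -> int).

Lemma card_le_avoid M A (s : seq int) : (`I_M #<= A)%card -> (size s < M)%N ->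
  exists2 x, A x & x \notin s.
Proof.
move=> MA sM; apply: contrapT => h.
have As : A `<=` [set nth 0 s i | i in `I_(size s)].
  move=> x Ax; have xs : x \in s by apply: contrapT => /negP xs; apply: h; exists x.
  by exists (index x s); rewrite ?nth_index //= index_mem.
have := card_le_trans (card_le_trans MA (subset_card_le As)) (card_image_le _ _).
by rewrite card_le_II leqNgt sM.
Qed.

Lemma greedy_choice M n A (bad : seq int -> seq int) : (`I_M #<= A)%card ->
  (forall s, (size s < n)%N -> (size (bad s) < M)%N) ->
  exists r, forall k, (k < n)%N -> A (r k) /\ r k \notin bad (map r (iota 0 k)).
Proof.
move=> MA; elim: n => [_|n ih hbad]; first by exists (fun=> 0).
have [r rP] := ih (fun s sn => hbad s (ltnW sn)).
have [|x Ax xbad] := @card_le_avoid _ _ (bad (map r (iota 0 n))) MA.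
  by apply: hbad; rewrite size_map size_iota.
pose r' (k : nat) : int := if k == n then x else r k.
have r'E k : (k <= n)%N -> map r' (iota 0 k) = map r (iota 0 k).
  move=> kn; apply/eq_in_map => i; rewrite mem_iota add0n => ik.
  by rewrite /r' ltn_eqF // (leq_trans ik).
exists r' => k; rewrite ltnS => kn; rewrite r'E // /r'.
by case: eqVneq => [->//|kNn]; apply: rP; rewrite ltn_neqAle kNn.
Qed.

(** Greedily: [c j] only has to avoid the numbers [c j' + r i' - r i] with
    [j' < j], of which there are at most n^3. *)
Lemma distinct_sums n A B : (`I_(n * (n * n)).+1 #<= A)%card ->
  (`I_(n * (n * n)).+1 #<= B)%card -> exists r c,
  [/\ forall i, (i < n)%N -> A (r i), forall j, (j < n)%N -> B (c j) &
      forall i j i' j', (i < n)%N -> (j < n)%N -> (i' < n)%N -> (j' < n)%N ->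
        r i + c j = r i' + c j' -> i = i' /\ j = j'].
Proof.
move=> hA hB.
have [|r rP] := @greedy_choice _ n _ id hA.
  by move=> s sn; rewrite ltnS; apply: leq_trans (ltnW sn) _; nia.
pose diffs := [seq r i' - r i | i' <- iota 0 n, i <- iota 0 n].
have [|c cP] := @greedy_choice _ n _ (fun s => [seq x + d | x <- s, d <- diffs]) hB.
  move=> s sn; rewrite !size_allpairs !size_iota ltnS.
  by rewrite leq_mul2r (ltnW sn) orbT.
have rN i i' : (i < n)%N -> (i' < i)%N -> r i <> r i'.
  move=> iN i'i E; have [_ /negP[]] := rP i iN.
  by rewrite E; apply: map_f; rewrite mem_iota add0n.
have cN i j i' j' : (i < n)%N -> (i' < n)%N -> (j' < j)%N -> (j < n)%N ->
    r i + c j <> r i' + c j'.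
  move=> iN i'N jj jN E; have [_ /negP[]] := cP j jN.
  apply/allpairsP; exists (c j', r i' - r i); split=> /=.
  - by apply: map_f; rewrite mem_iota add0n.
  - by apply/allpairsP; exists (i', i); rewrite !mem_iota !add0n.
  - by rewrite addrA [c j' + _]addrC -E addrAC subrr add0r.
exists r, c; split=> [i iN|j jN|i j i' j' iN jN i'N j'N E].
- by case: (rP i iN).
- by case: (cP j jN).
have [jj|jj|jj] := ltngtP j j'.
- by case: (cN i' j' i j i'N iN jj j'N).
- by case: (cN i j i' j' iN i'N jj jN).
split=> //; move: E; rewrite jj => /addIr rE.
have [ii|ii|//] := ltngtP i i'.
  by case: (rN i' i i'N ii).
by case: (rN i i' iN ii).
Qed.

(** Since the sums are distinct, one can prescribe [eps] to be [walsh l i j] at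
    [r i + c j]; the multiplier then maps the matrix [w] to [w * walsh l]. *)
Lemma unconditional_transfer L (p D : R) l r c (w : nat -> nat -> R) (up lo : R) :
  0 < p -> 0 <= up -> 0 <= lo ->
  (forall f, LpL (schatten p) p L f ->
    forall (F : {fset int}) (eps : int -> R[i]), [set` F] `<=` L ->
      (forall k, circle (eps k)) ->
    (Lpnorm (schatten p) p
       (\sum_(k <- F) tensor (fourier f k) (fun z => (eps k * z ^ k)%R))%R
     <= D%:E * Lpnorm (schatten p) p f)%E) ->
  (forall i j, (i < 2 ^ l)%N -> (j < 2 ^ l)%N -> L (r i + c j)) ->
  (forall i j i' j', (i < 2 ^ l)%N -> (j < 2 ^ l)%N -> (i' < 2 ^ l)%N -> (j' < 2 ^ l)%N ->
     r i + c j = r i' + c j' -> i = i' /\ j = j') ->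
  (forall z, circle z -> (schatten p (mexp (2 ^ l) w r c z) <= up%:E)%E) ->
  (forall z, circle z ->
     (lo%:E <= schatten p (mexp (2 ^ l) (fun i j => (w i j * walsh l i j)%R) r c z))%E) ->
  lo <= `|D| * up.
Proof.
move=> p0 up0 lo0 hD rcL inj hup hlo; set N := (2 ^ l)%N.
pose m (q : 'I_N * 'I_N) := r q.1 + c q.2.
pose s := map (fun q : 'I_N * 'I_N => ((w q.1 q.2)%:C *: unit_mx q.1 q.2 : nat -> nat -> R[i], m q))
  (index_enum _).
pose f := trigsum s.
have sum_mx (a : int -> R[i]) i j :
    \sum_(q : 'I_N * 'I_N) a (m q) * ((w q.1 q.2)%:C * unit_mx q.1 q.2 i j) =
    if ((i < N) && (j < N))%N then (w i j)%:C * a (r i + c j) else 0.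
  rewrite -(sum_unit_mx N (fun i j => (w i j)%:C * a (r i + c j))).
  by apply: eq_bigr => q _; rewrite /m; ring.
have fE z i j : f z i j = if ((i < N) && (j < N))%N then (w i j)%:C * z ^ (r i + c j) else 0.
  rewrite -(sum_mx (fun k => z ^ k)) /f /trigsum /s big_map !fct_sum.
  by apply: eq_bigr => q _.
have fL : LpL (schatten p) p L f.
  apply: (@trigsum_schatten _ p L N) => // x /mapP[q _ ->] /=; last by apply: rcL.
  move=> i j ij; rewrite -[LHS]/((w q.1 q.2)%:C * unit_mx q.1 q.2 i j).
  by rewrite (unit_mx_supported _ _ ij) ?mulr0.
have fourE k i j : fourier f k i j =
    if ((i < N) && (j < N))%N then (w i j)%:C * (r i + c j == k)%:R else 0.
  rewrite -[LHS]/(coef (fun z => f z i j) k).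
  case: ifP => ij.
    rewrite (_ : (fun z => f z i j) = fun z => (w i j)%:C * zexp (r i + c j) z).
      by rewrite coefZ ?coef_zexp //; exact: cint_exp.
    by apply/funext => z; rewrite fE ij.
  rewrite (_ : (fun z => f z i j) = fun z => 0 * zexp 0 z).
    by rewrite coefZ ?mul0r //; exact: cint_exp.
  by apply/funext => z; rewrite fE ij mul0r.
pose eps (k : int) : R[i] :=
  if [pick q : 'I_N * 'I_N | m q == k] is Some q then (walsh l q.1 q.2)%:C else 1.
have epsE i j : (i < N)%N -> (j < N)%N -> eps (r i + c j) = (walsh l i j)%:C.
  move=> iN jN; rewrite /eps; case: pickP => [[i' j'] /eqP|/(_ (Ordinal iN, Ordinal jN))].
    rewrite /m /= => E.
    by have [-> ->] := inj _ _ _ _ (ltn_ord i') (ltn_ord j') iN jN E.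
  by rewrite /m /= eqxx.
have ceps k : circle (eps k).
  rewrite /eps; case: pickP => [q _|_]; last exact: circle1.
  by apply/circleP; rewrite nc_real walsh_norm.
have [F FE] : exists F : {fset int}, forall k, (k \in F) = (k \in [seq m q | q <- index_enum _]).
  by exists (seq_fset tt [seq m q | q <- index_enum _]) => k; rewrite seq_fsetE.
have FL : [set` F] `<=` L.
  by move=> k /=; rewrite FE => /mapP[q _ ->]; apply: rcL.
have := hD f fL F eps FL ceps; set g := \sum_(k <- F) _ => hg.
have gE z : circle z -> g z = mexp N (fun i j => w i j * walsh l i j) r c z.
  move=> cz; apply/funext => i; apply/funext => j; rewrite /g fct2_sum /mexp /twist.
  transitivity (\sum_(k <- F) (eps k * z ^ k) * fourier f k i j); first by [].
  case: ifP => ij; last by rewrite big1 // => k _; rewrite fourE ij mulr0.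
  have /andP[iN jN] := ij.
  have mF : r i + c j \in F.
    rewrite FE; apply/mapP; exists (Ordinal iN, Ordinal jN) => //.
    by rewrite mem_index_enum.
  rewrite (big_fsetD1 (r i + c j)) //= fourE ij eqxx mulr1 epsE //.
  rewrite [X in _ + X]big1_fset ?addr0 => [|k].
    by rewrite expfzDr ?circle_neq0 // rmorphM /=; ring.
  rewrite !inE => /andP[/negbTE kij _] _.
  by rewrite fourE ij eq_sym kij !mulr0.
have lo_le : (lo%:E <= Lpnorm (schatten p) p g)%E.
  have glo z : circle z -> (lo%:E <= schatten p (g z))%E.
    by move=> cz; rewrite (gE z cz); exact: (hlo z cz).
  exact: (Lpnorm_ge p0 lo0 (@schatten_ge0 R p) glo).
have le_up : (Lpnorm (schatten p) p f <= up%:E)%E.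
  have fup z : circle z -> (schatten p (f z) <= up%:E)%E; last first.
    exact: (Lpnorm_le p0 up0 (@schatten_ge0 R p) fup).
  move=> cz; have -> : f z = mexp N w r c z; last exact: (hup z cz).
  apply/funext => i; apply/funext => j; rewrite fE /mexp /twist.
  by case: ifP => // _; rewrite expfzDr // circle_neq0.
rewrite -lee_fin; apply: le_trans lo_le _; apply: le_trans hg _.
by apply: mul_ereal_bound => //; exact: poweR_ge0.
Qed.

Lemma powers_unbounded (b D : R) : 1 < b -> exists l : nat, D < b ^+ l.
Proof.
move=> b1; have b10 : 0 < b - 1 by rewrite subr_gt0.
have bern l : 1 + l%:R * (b - 1) <= b ^+ l.
  elim: l => [|l ih]; first by rewrite mul0r addr0 expr0.
  rewrite exprS; have b0 : 0 <= b by lra.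
  apply: le_trans (ler_wpM2l b0 ih); rewrite -natr1.
  have : 0 <= l%:R * (b - 1) ^+ 2 by rewrite mulr_ge0 ?sqr_ge0.
  rewrite expr2; lra.
exists (Num.truncn (D / (b - 1))).+1; apply: lt_le_trans (bern _).
have := truncnS_gt (D / (b - 1)); rewrite ltr_pdivrMr //; lra.
Qed.

Theorem no_large_sumset L (p : R) : 1 <= p -> p <> 2 -> completely_unconditional_basis p L ->
  exists N : nat, forall A B : set int,
    (`I_N #<= A)%card -> (`I_N #<= B)%card -> ~ (sumset A B `<=` L).
Proof.
move=> p1 p2 [D hD]; have p0 : 0 < p by lra.
pose a : R := `|p^-1 - 2^-1|.
have a0 : 0 < a.
  rewrite normr_gt0 subr_eq0; apply/eqP => /invr_inj; exact: p2.
have b1 : 1 < 2 `^ a :> R.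
  have := @gt0_ltr_powR R a a0 1 2; rewrite powR1; apply; rewrite ?nnegrE //.
  by rewrite ltr1n.
have [l hl] := powers_unbounded `|D| b1.
pose n := (2 ^ l)%N.
exists (n * (n * n)).+1 => A B hA hB AB.
have [r [c [rA cB rcI]]] := distinct_sums hA hB.
have rcL i j : (i < n)%N -> (j < n)%N -> L (r i + c j).
  by move=> iN jN; apply: AB; exists (r i); [exact: rA|exists (c j); [exact: cB|]].
have M0 : 0 < 2 ^+ l :> R by apply: exprn_gt0.
have nM : n%:R = 2 ^+ l :> R by rewrite natrX.
have n0 : (0 < n)%N by rewrite expn_gt0.
have sq : Num.sqrt (2 ^+ l) = (2 ^+ l) `^ 2^-1 :> R by rewrite powR12_sqrt // ltW.
(* Both norms are powers of 2^l, so only the exponents are compared below. *)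
have Mp : (2 ^+ l) `^ 2^-1 * (2 ^+ l) `^ p^-1 = (2 ^+ l) `^ (2^-1 + p^-1) :> R.
  by rewrite powRD // (gt_eqF M0) implybT.
have M1 : (2 ^+ l : R) = (2 ^+ l) `^ 1 by rewrite powRr1 // ltW.
have Ma : (2 ^+ l) `^ a = (2 `^ a) ^+ l :> R.
  by rewrite -powR_mulrn // -powRrM mulrC powRrM powR_mulrn ?powR_ge0.
have sa0 : 0 <= Num.sqrt (2 ^+ l) * (2 ^+ l) `^ p^-1 :> R.
  by rewrite mulr_ge0 ?sqrtr_ge0 ?powR_ge0.
have cx (z : R[i]) (k : nat -> int) : circle z -> forall i, circle (z ^ k i).
  by move=> cz i; exact: circleX.
have key x y : (2 ^+ l) `^ x <= `|D| * (2 ^+ l) `^ y -> a = x - y -> False.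
  move=> h axy; have := hl; rewrite -Ma axy powRB ?(gt_eqF M0) ?implybT //.
  by rewrite ltNge ler_pdivrMr ?powR_gt0 // h.
have [plt|pgt] := ltP p 2.
  apply: (key (2^-1 + p^-1) 1); last first.
    have : 2^-1 < p^-1 by rewrite ltf_pV2 ?posrE.
    by rewrite /a -subr_gt0 => h; rewrite gtr0_norm //; lra.
  rewrite -Mp -sq -M1.
  apply: (@unconditional_transfer L p D l r c (fun _ _ => 1)) => //.
  - by move=> z cz; rewrite -nM; apply: schatten_rank1_le => //; exact: cx.
  - move=> z cz; rewrite /mexp.
    have -> : (fun i j => 1 * walsh l i j) = walsh l :> (nat -> nat -> R).
      by apply/funext => i; apply/funext => j; rewrite mul1r.
    by apply: schatten_walsh_ge => //; exact: cx.
apply: (key 1 (2^-1 + p^-1)); last first.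
  have h : p^-1 <= 2^-1 by rewrite lef_pV2 ?posrE.
  by rewrite /a ler0_norm ?subr_le0 //; lra.
rewrite -Mp -sq -M1.
apply: (@unconditional_transfer L p D l r c (walsh l)) => //.
- by move=> z cz; apply: schatten_walsh_le => //; exact: cx.
- move=> z cz; rewrite -nM /mexp.
  have -> : (fun i j => walsh l i j * walsh l i j) = (fun _ _ => 1) :> (nat -> nat -> R).
    apply/funext => i; apply/funext => j; rewrite -expr2 -real_normK ?num_real //.
    by rewrite walsh_norm expr1n.
  by apply: schatten_rank1_ge => //; exact: cx.
Qed.

End PartOne.

Theorem theorem1p5 (R : realType) (Lambda : set int) :
  (forall p : R, 1 <= p -> p <> 2 ->
    completely_unconditional_basis p Lambda ->
    exists N : nat, forall A B : set int,
      (`I_N #<= A)%card -> (`I_N #<= B)%card -> ~ (sumset A B `<=` Lambda)) /\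
  ((exists T : nat -> (R[i] -> R[i]) -> (R[i] -> R[i]),
      approximating_sequence (LpL cnorm 1 Lambda) (Lpnorm cnorm 1) T /\
      completely_unconditional Lambda T) \/
   (exists T : nat -> (R[i] -> R[i]) -> (R[i] -> R[i]),
      approximating_sequence (CL Lambda) supnorm T /\
      unconditional (CL Lambda) supnorm T) ->
   forall A B : set int,
     infinite_set A -> infinite_set B -> ~ (sumset A B `<=` Lambda)).
Proof. by split; [exact: no_large_sumset|exact: no_infinite_sumset_of_approximation]. Qed.
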